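(* Let $\eta$ be a Poisson process on a measurable space $(\mathbb{X},\mathcal{X})$ with $\sigma$-finite intensity measure $\mu$, let $F\in L^1(\mathbb{P}_\eta)$, and put $\kappa:=\frac{\sqrt{e}}{2(\sqrt{e}-1)}$. (i) If $\mathbb{P}$-almost surely $V^+\le L$ for some $L>0$, then $$\mathbb{P}(F-\mathbb{E}[F]\ge t)\le e^{-ct^2/L}$$ for every $t\ge 4\sqrt{\kappa}$, with $c=\log(2)/(8\kappa)$. If $\mathbb{P}$-almost surely $V^-\le L$ for some $L>0$, then $$\mathbb{P}(F-\mathbb{E}[F]\le -t)\le e^{-ct^2/L}$$ for every $t\ge 4\sqrt{\kappa}$, with $c=\log(2)/(8\kappa)$. (ii) If $\mathbb{P}$-almost surely $V\le L$ for some $L>0$, then $$\mathbb{P}(|F-\mathbb{E}[F]|\ge t)\le 2e^{-ct^2/L}$$ for every $t\ge 0$, with $c=\log(2)/(16\kappa)$.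
   Context: Let $\mathsf{N}(\mathbb{X})$ be the space of $\sigma$-finite counting measures on $(\mathbb{X},\mathcal{X})$, equipped with the smallest $\sigma$-field making all maps $\xi\mapsto\xi(B)$, $B\in\mathcal{X}$, measurable. A point process is a measurable map from a fixed probability space $(\Omega,\mathcal{F},\mathbb{P})$ to $\mathsf{N}(\mathbb{X})$. A Poisson process $\eta$ with $\sigma$-finite intensity measure $\mu$ is a point process such that $\eta(B)$ is Poisson distributed with mean $\mu(B)$ for all $B\in\mathcal{X}$, and $\eta(B_1),\dots,\eta(B_n)$ are independent for pairwise disjoint $B_1,\dots,B_n\in\mathcal{X}$. A Poisson functional is a random variable $F$ with $F=f(\eta)$ $\mathbb{P}$-almost surely for some measurable $f:\mathsf{N}(\mathbb{X})\to\mathbb{R}$ (a representative of $F$). $L^p(\mathbb{P}_\eta)$ is the space of Poisson functionals $F$ with $\mathbb{E}|F|^p<\infty$. We write $F(\eta)=f(\eta)$, $F(\eta-\delta_x)=f(\eta-\delta_x)$, and the difference operator is $D_xF:=f(\eta+\delta_x)-f(\eta)$, where $\delta_x$ is the Dirac measure at $x\in\mathbb{X}$. Notation: $x_+:=\max\{0,x\}$ and $x_-:=\min\{0,x\}$ for $x\in\mathbb{R}$, with $(y)_\pm^2:=((y)_\pm)^2$. Moreover, $$V^+:=\int_{\mathbb{X}}(D_xF)_-^2\,\mu(\mathrm{d}x)+\int_{\mathbb{X}}(F(\eta)-F(\eta-\delta_x))_+^2\,\eta(\mathrm{d}x),$$ $$V^-:=\int_{\mathbb{X}}(D_xF)_+^2\,\mu(\mathrm{d}x)+\int_{\mathbb{X}}(F(\eta)-F(\eta-\delta_x))_-^2\,\eta(\mathrm{d}x),$$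 $$V:=\int_{\mathbb{X}}(D_xF)^2\,\mu(\mathrm{d}x)+\int_{\mathbb{X}}(F(\eta)-F(\eta-\delta_x))^2\,\eta(\mathrm{d}x).$$ *)

(* Defs.v *)
From HB Require Import structures.
From mathcomp Require Import all_boot all_order all_algebra.
From mathcomp Require Import all_classical all_reals all_analysis.
From mathcomp Require Import measurable_realfun.

Set Implicit Arguments.
Unset Strict Implicit.
Unset Printing Implicit Defensive.

Import Order.TTheory GRing.Theory Num.Theory.
Import numFieldNormedType.Exports.

Local Open Scope classical_set_scope.
Local Open Scope ring_scope.
Local Open Scope ereal_scope.

Definition integer_valued {d} {X : measurableType d} {R : realType}
    (xi : set X -> \bar R) : Prop :=
  forall B, measurable B -> xi B = +oo \/ exists n : nat, xi B = n%:R%:E.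

Record counting_measure {d} (X : measurableType d) (R : realType) :=
  CountingMeasure {
    counting_measure_val :> {measure set X -> \bar R} ;
    counting_measure_sigma_finite : sigma_finite setT counting_measure_val ;
    counting_measure_integer : integer_valued counting_measure_val }.

Section counting_measure_space.
Context {d} {X : measurableType d} {R : realType}.
Local Notation N := (counting_measure X R).

Lemma mzero_sigma_finite : sigma_finite setT (@mzero d X R).
Proof.
exists (fun=> setT) => [|_]; first by rewrite bigcup_const //; exists 0%N.
by split; [exact: measurableT | rewrite /mzero/= ltry].
Qed.

Lemma mzero_integer : integer_valued (@mzero d X R).
Proof. by move=> B _; right; exists 0%N. Qed.

HB.instance Definition _ := gen_eqMixin N.
HB.instance Definition _ := gen_choiceMixin N.
HB.instance Definition _ :=
  isPointed.Build N (CountingMeasure mzero_sigma_finite mzero_integer).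

Definition counting_evaluation_sets : set_system N :=
  \bigcup_(B in measurable)
    preimage_set_system setT (fun xi : N => xi B) measurable.

HB.instance Definition _ :=
  @isMeasurable.Build (sigma_display counting_evaluation_sets) N
    <<s counting_evaluation_sets >>
    (@sigma_algebra0 _ setT counting_evaluation_sets)
    (@sigma_algebraC _ counting_evaluation_sets)
    (@sigma_algebra_bigcup _ setT counting_evaluation_sets).

Lemma add_dirac_sigma_finite (xi : N) (x : X) :
  sigma_finite setT (measure_add xi (\d_x : {measure set X -> \bar R})).
Proof.
have [A UA mA] := counting_measure_sigma_finite xi.
exists A => // i; split; first exact: (mA i).1.
by rewrite measure_addE lte_add_pinfty ?(mA i).2//= diracE ltry.
Qed.

Lemma add_dirac_integer (xi : N) (x : X) :
  integer_valued (measure_add xi (\d_x : {measure set X -> \bar R})).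
Proof.
move=> B mB; rewrite measure_addE/= diracE.
have [->|[n ->]] := counting_measure_integer xi mB; first by left.
by right; exists (n + (x \in B))%N; rewrite natrD EFinD.
Qed.

Definition add_dirac (xi : N) (x : X) : N :=
  CountingMeasure (add_dirac_sigma_finite xi x) (add_dirac_integer xi x).

(* [xi - \d_x] as a counting measure, if there is one. A library measure also
   carries values on non-measurable sets, so the choice is unique only up to
   these; a measurable function on N cannot see them. *)
Definition remove_dirac (xi : N) (x : X) : option N :=
  if pselect (exists zeta : N,
       forall B, measurable B -> xi B = zeta B + \d_x B) is left ex
  then Some (projT1 (cid ex)) else None.

Definition difference (f : N -> R) (xi : N) (x : X) : R :=
  (f (add_dirac xi x) - f xi)%R.

(* [phi (f xi - f (xi - \d_x)) ^ 2]. The value +oo is given to the points x for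
   which [xi - \d_x] is not in N, where the expression is undefined: a finite
   integral against xi then implies that it is defined where it matters. When
   xi is a sum of Dirac masses, it is defined at every point of xi. If X has
   non-measurable singletons, this function of x need not be measurable; its
   integral is then the supremum of the integrals of the simple functions below
   it, which still sums the values at the points of xi. *)
Definition removal_sq (phi : R -> R) (f : N -> R) (xi : N) (x : X) : \bar R :=
  if remove_dirac xi x is Some zeta
  then ((phi (f xi - f zeta)) ^+ 2)%:E else +oo.

Definition pos_part (y : R) : R := Num.max 0%R y.
Definition neg_part (y : R) : R := Num.min 0%R y.

Definition Vplus (mu : set X -> \bar R) (f : N -> R) (xi : N) : \bar R :=
  \int[mu]_x ((neg_part (difference f xi x)) ^+ 2)%:E +
  \int[xi]_x removal_sq pos_part f xi x.

Definition Vminus (mu : set X -> \bar R) (f : N -> R) (xi : N) : \bar R :=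
  \int[mu]_x ((pos_part (difference f xi x)) ^+ 2)%:E +
  \int[xi]_x removal_sq neg_part f xi x.

Definition Vtotal (mu : set X -> \bar R) (f : N -> R) (xi : N) : \bar R :=
  \int[mu]_x ((difference f xi x) ^+ 2)%:E +
  \int[xi]_x removal_sq id f xi x.

End counting_measure_space.

Section poisson_process.
Context {dO} {Omega : measurableType dO} {R : realType}.
Variable P : probability Omega R.

(* The second argument of [poisson_prob] is not used by its definition. A Poisson
   variable with infinite mean is almost surely infinite. *)
Definition poisson_distributed (Y : Omega -> \bar R) (m : \bar R) : Prop :=
  match m with
  | r%:E => forall k : nat,
      P [set w | Y w = k%:R%:E] = poisson_prob r 0%N [set k]
  | +oo => P [set w | Y w = +oo] = 1
  | -oo => False
  end.

Definition mutually_independent {d} {T : measurableType d} (n : nat)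
    (Y : 'I_n -> Omega -> T) : Prop :=
  forall A : 'I_n -> set T, (forall i, measurable (A i)) ->
    P (\bigcap_(i in [set: 'I_n]) (Y i @^-1` A i)) =
    \prod_(i < n) P (Y i @^-1` A i).

Definition poisson_process {d} {X : measurableType d}
    (mu : set X -> \bar R) (eta : Omega -> counting_measure X R) : Prop :=
  [/\ measurable_fun setT eta,
      (forall B, measurable B ->
         poisson_distributed (fun w => eta w B) (mu B)) &
      (forall (n : nat) (B : 'I_n -> set X),
         (forall i, measurable (B i)) -> trivIset setT B ->
         mutually_independent (fun i w => eta w (B i)))].

Definition representative {d} {X : measurableType d}
    (eta : Omega -> counting_measure X R) (F : Omega -> R)
    (f : counting_measure X R -> R) : Prop :=
  measurable_fun setT f /\ {ae P, forall w, F w = f (eta w)}.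

End poisson_process.

(* Main.v *)
From HB Require Import structures.
From mathcomp Require Import all_boot all_order all_algebra.
From mathcomp Require Import all_classical all_reals all_analysis.
From mathcomp Require Import measurable_realfun.
From mathcomp Require Import ring lra.
Require Import Defs.

(** Write Ent(Z) = E[Z ln Z] - E[Z] ln E[Z].  The tail bounds come from the
    entropy method, and the constant they yield is better than the stated one:
    if V^+ <= L almost surely, then P(F - E F >= t) <= exp(- t^2 / (12 L)) for
    every t >= 0, while ln 2 / (8 kappa) <= 1 / 12 ([tail_rate_le]).  The lower
    tail is the upper tail of -F, because V^- of F is V^+ of -F; the two-sided
    bound follows because V dominates both.

    Modified logarithmic Sobolev inequality.  For the Bregman divergence
    B(v, u) = v (ln v - ln u) - v + u of x ln x,
      Ent(Z(eta)) <= E int B(Z(eta + delta_x), Z(eta)) mu(dx).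
    For Z = exp(l F) an elementary estimate ([bregman_exp_le]) bounds the
    integrand by
      3/4 l^2 (Z(eta) (D_x F)_-^2 + Z(eta + delta_x) (D_x F)_+^2).
    The first term is controlled by the integral against mu in V^+.  The Mecke
    equation turns the second one into the integral of
    Z(eta) (F(eta) - F(eta - delta_x))_+^2 against eta, which is controlled by
    the other half of V^+.  Hence Ent(Z) <= 3/2 L l^2 E[Z]
    ([entropy_inequality]).

    Herbst argument.  Testing the entropy bound against a tilted density
    compares the exponential moments at l and l / 2 ([laplace_half]); iterating
    down to 0 gives E exp(l (F - E F)) <= exp(3 L l^2), and the Chernoff bound
    concludes.  This needs F bounded.  A truncation of F has smaller positive
    and negative parts of all its increments, so it inherits the bound on V^+,
    and the means of the truncations converge ([upper_tail]).

    Proof of the Sobolev inequality ([local_entropy]).  Fix a window W of finite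
    measure m and let [step] be the Markov operator that adds, with probability
    h m, a point with law mu restricted to W and divided by m.  One step
    increases the entropy by at most h times the integrated divergence
    ([entropy_step]), and the divergence of the averaged function is at most the
    averaged divergence, by joint convexity of B ([gain_step]).  After n steps
    with h = 1/n, started from a configuration without points in W, the number
    of added points is binomial, and the binomial weights converge to Poisson
    weights: by the Mecke equation the result has a density with respect to the
    law of eta, and this density tends to 1 boundedly ([cvg_window_weight]).
    The starting configuration is still random outside W; this is harmless
    because every bounded measurable Z is close in L^1 to a function of the
    points in a large enough window ([local_approximation]).

    The Mecke equation ([mecke]) is obtained from the independence of the
    counts: on boxes it is the recursion r p(k) = (k + 1) p(k + 1) of the
    Poisson weights, and two finite measures that agree on an
    intersection-stable generator agree.

    The integrand F(eta) - F(eta - delta_x) need not be measurable in x.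
    However (xi, x) |-> (xi + delta_x, x) generates the whole product
    sigma-algebra ([adjoin_preimage]), so a measurable function of (xi, x)
    extends measurably to all pairs along this map; the extension lies below
    the integrand of V^+ ([lift_le_removal_sq]), and the integral of a nonnegative function, as a supremum over simple functions,
    is monotone without measurability. *)

Set Implicit Arguments.
Unset Strict Implicit.
Unset Printing Implicit Defensive.

Import Order.TTheory GRing.Theory Num.Theory.
Import numFieldNormedType.Exports.

Local Open Scope classical_set_scope.
Local Open Scope ring_scope.
Local Open Scope ereal_scope.

(** * The space of counting measures *)

Section counting_space.
Context {d} {X : measurableType d} {R : realType}.
Local Notation N := (counting_measure X R).

Lemma measurable_eval (B : set X) : measurable B ->
  measurable_fun setT (fun xi : N => xi B).
Proof.
move=> mB _ Y mY; apply: sub_sigma_algebra.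
by exists B => //; exists Y.
Qed.

Lemma measurable_fun_counting {dT} {T : measurableType dT} (g : T -> N) :
  (forall B, measurable B -> measurable_fun setT (fun t => g t B)) ->
  measurable_fun setT g.
Proof.
move=> mg; apply: (measurability (counting_evaluation_sets : set (set N))) => //.
move=> _ [_ [B mB [Y mY <-]] <-].
have := mg _ mB measurableT Y mY; rewrite setTI => h.
rewrite !setTI; exact: h.
Qed.

(** The evaluation maps generate the sigma-algebra, so a measurable set cannot
    tell apart two measures that agree on measurable sets, although they may
    differ as set functions. *)
Lemma counting_measurable_ext (xi zeta : N) (A : set N) :
  (forall B, measurable B -> xi B = zeta B) -> measurable A -> A xi -> A zeta.
Proof.
move=> xz mA.
suff : <<s counting_evaluation_sets >> `<=` [set A : set N | A xi <-> A zeta].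
  by move=> /(_ _ mA) /= [].
apply: smallest_sub; last first.
  by move=> _ [B mB [Y mY <-]]; rewrite /= /preimage /setI /= xz.
split => //=.
  by move=> C /= [h1 h2]; split => -[_ h]; split => // ?; apply: h; [exact: h2|exact: h1].
move=> F FP; split => -[i _ Fi]; exists i => //; exact/FP.
Qed.

Lemma counting_fun_ext (xi zeta : N) (f : N -> R) :
  (forall B, measurable B -> xi B = zeta B) -> measurable_fun setT f ->
  f xi = f zeta.
Proof.
move=> xz mf; apply/esym.
have mA : measurable (f @^-1` [set f xi]).
  by rewrite -[X in measurable X]setTI; exact: mf.
exact: (@counting_measurable_ext xi zeta _ xz mA).
Qed.

(** The two remaining record fields are propositions. *)
Lemma counting_measure_eq (xi zeta : N) :
  (forall B, xi B = zeta B) -> xi = zeta.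
Proof.
case: xi zeta => m1 s1 i1 [m2 s2 i2] /= e.
have m12 : m1 = m2 by apply: eq_measure; apply/funext.
move: s2 i2; rewrite -m12 => s2 i2.
by rewrite (Prop_irrelevance s1 s2) (Prop_irrelevance i1 i2).
Qed.

Lemma add_diracE (xi : N) x (B : set X) : add_dirac xi x B = xi B + \d_x B.
Proof. exact: measure_addE. Qed.

Lemma add_diracAC (xi : N) x y :
  add_dirac (add_dirac xi x) y = add_dirac (add_dirac xi y) x.
Proof. by apply: counting_measure_eq => B; rewrite !add_diracE addeAC. Qed.

Lemma measurable_add_dirac :
  measurable_fun setT (fun z : N * X => add_dirac z.1 z.2).
Proof.
apply: measurable_fun_counting => B mB.
under eq_fun do rewrite add_diracE.
apply: emeasurable_funD.
  exact: (measurableT_comp (measurable_eval mB) measurable_fst).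
under eq_fun do rewrite diracE -indicE.
apply/measurable_EFinP.
exact: (measurableT_comp (measurable_indic mB) measurable_snd).
Qed.

Lemma measurable_add_dirac2 x : measurable_fun setT (fun xi : N => add_dirac xi x).
Proof.
exact: (measurableT_comp measurable_add_dirac (measurable_pair2 x)).
Qed.

Lemma measurable_add_dirac1 (xi : N) : measurable_fun setT (fun x => add_dirac xi x).
Proof.
exact: (measurableT_comp measurable_add_dirac (measurable_pair1 xi)).
Qed.

End counting_space.

(** * Poisson counts *)

Section poisson_law.
Context {R : realType}.

Definition poisson_weight (r : R) (k : nat) : R :=
  (r ^+ k / k`!%:R * expR (- r))%R.

Lemma poisson_prob_set1 (r : R) (k : nat) : (0 <= r)%R ->
  poisson_prob r 0%N [set k] = (poisson_weight r k)%:E.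
Proof.
rewrite /poisson_prob le_eqVlt => /predU1P[<-|r0].
  rewrite ltxx diracE /poisson_weight expr0n oppr0 expR0 mulr1.
  case: k => [|k].
    by rewrite mem_set// fact0 divr1.
  by rewrite memNset//= mul0r.
by rewrite r0 esum_set1 ?lee_fin ?poisson_pmf_ge0// /poisson_pmf r0.
Qed.

(** The recursion behind the Mecke equation. *)
Lemma poisson_weightS (r : R) (k : nat) :
  (r * poisson_weight r k = k.+1%:R * poisson_weight r k.+1)%R.
Proof.
rewrite /poisson_weight factS natrM exprS.
have k0 : (k.+1%:R != 0 :> R)%R by rewrite pnatr_eq0.
have f0 : (k`!%:R != 0 :> R)%R by rewrite pnatr_eq0 -lt0n fact_gt0.
by field; rewrite f0 addrC natr1 k0.
Qed.

Context {d} {X : measurableType d} (mu : {measure set X -> \bar R}).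
Local Notation N := (counting_measure X R).

Definition count_event (I : finType) (D : I -> set X) (c : I -> nat) : set N :=
  [set xi | forall i, xi (D i) = (c i)%:R%:E].

Lemma measurable_count_event (I : finType) (D : I -> set X) (c : I -> nat) :
  (forall i, measurable (D i)) -> measurable (count_event D c).
Proof.
move=> mD.
rewrite (_ : count_event D c = \bigcap_(i in [set: I])
    ((fun xi : N => xi (D i)) @^-1` [set (c i)%:R%:E])); last first.
  by apply/seteqP; split => [xi h i _|xi h i]; [exact: h|exact: (h i)].
apply: fin_bigcap_measurable => // i _.
by rewrite -[X in measurable X]setTI; apply: measurable_eval.
Qed.

(** The only information on the Poisson law used below: a formulation on the law
    itself, with a product formula over any finite type of disjoint sets. *)
Definition poisson_counts (nu : {measure set N -> \bar R}) :=
  forall (I : finType) (D : I -> set X) (c : I -> nat),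
    (forall i, measurable (D i)) -> trivIset setT D ->
    (forall i, mu (D i) < +oo) ->
    nu (count_event D c) =
    (\prod_i poisson_weight (fine (mu (D i))) (c i))%:E.

Context {dO} {Omega : measurableType dO} (P : probability Omega R).

Lemma poisson_process_counts (eta : {mfun Omega >-> N}) :
  poisson_process P mu eta -> poisson_counts (distribution P eta).
Proof.
move=> [_ dist indep] I D c mD tD fD.
pose D' (i : 'I_#|I|) := D (enum_val i); pose c' (i : 'I_#|I|) := c (enum_val i).
have tD' : trivIset setT D'.
  apply/trivIsetP => i j _ _ ij; move/trivIsetP : tD; apply => //.
  by apply: contra ij => /eqP /enum_val_inj ->.
have h := indep #|I| D' (fun i => mD _) tD' (fun i => [set (c' i)%:R%:E])
  (fun i => emeasurable_set1 _).
have e : \bigcap_(i in [set: 'I_#|I|])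
    ((fun w => eta w (D' i)) @^-1` [set (c' i)%:R%:E]) = eta @^-1` count_event D c.
  apply/seteqP; split => [w h' i|w h' i _]; last exact: (h' _).
  by have := h' (enum_rank i) Logic.I; rewrite /= /D' /c' enum_rankK.
rewrite /distribution /= /pushforward.
apply: (eq_trans (congr1 P (esym e))); apply: (eq_trans h); rewrite -prodEFin.
rewrite [RHS](eq_bigl (fun i => i \in I))// [RHS]big_enum_val/=.
apply: eq_bigr => i _.
have := dist _ (mD (enum_val i)).
have mDi : mu (D' i) \is a fin_num by rewrite ge0_fin_numE// fD.
rewrite /poisson_distributed -[mu _]fineK// => /(_ (c' i)) /= h1.
by rewrite -poisson_prob_set1 ?fine_ge0.
Qed.

End poisson_law.

(** * The Mecke equation *)

Section atoms.
Context {d} {X : measurableType d} {R : realType}.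

Lemma measure_finType_bigcup {d'} {T : measurableType d'} (I : finType)
    (Q : pred I) (m : {measure set T -> \bar R}) (G : I -> set T) :
  (forall i, measurable (G i)) -> trivIset setT G ->
  m (\bigcup_(i in [set i | Q i]) G i) = \sum_(i | Q i) m (G i).
Proof.
move=> mG tG; rewrite measure_fin_bigcup//=; last exact: sub_trivIset tG.
by rewrite [RHS]bigfs ?index_enum_uniq// => i _; rewrite mem_index_enum.
Qed.

Variables (J : finType) (F : J -> set X) (U : set X).
Hypotheses (mF : forall j, measurable (F j)) (mU : measurable U).

(** The sets [F j] meet [U] in unions of these pairwise disjoint sets, so joint
    counts of overlapping sets reduce to independent counts. *)
Definition atom (a : {ffun J -> bool}) : set X :=
  [set x | U x /\ forall j, F j x <-> a j].

Lemma measurable_atom a : measurable (atom a).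
Proof.
rewrite (_ : atom a = U `&` \bigcap_(j in [set: J])
    (if a j then F j else ~` F j)); last first.
  apply/seteqP; split => [x [Ux h]|x [Ux h]]; split => // j; last first.
    by have := h j Logic.I; case: (a j) => // hj; split => // /hj.
  by move=> _; have := h j; case: (a j) => -[h1 h2]; [exact: h2|move=> /h1].
apply: measurableI => //; apply: fin_bigcap_measurable => // j _.
by case: (a j) => //; exact: measurableC.
Qed.

Lemma trivIset_atom : trivIset setT atom.
Proof.
move=> a b _ _ [x [[_ ha] [_ hb]]]; apply/ffunP => j.
by apply/idP/idP => [/ha/hb|/hb/ha].
Qed.

Lemma bigcup_atom j :
  F j `&` U = \bigcup_(a in [set a : {ffun J -> bool} | a j]) atom a.
Proof.
apply/seteqP; split => [x [Fx Ux]|x [a /= aj [Ux /(_ j) h]]]; last first.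
  by split => //; apply/h.
exists [ffun j => `[<F j x>]] => /=; first by rewrite ffunE; exact/asboolP.
by split => // i; rewrite ffunE; split => /asboolP.
Qed.

Lemma measure_atom (m : {measure set X -> \bar R}) j :
  m (F j `&` U) = \sum_(a : {ffun J -> bool} | a j) m (atom a).
Proof.
rewrite bigcup_atom measure_finType_bigcup//.
  exact: measurable_atom.
exact: trivIset_atom.
Qed.

End atoms.

Section mecke_atom.
Context {d} {X : measurableType d} {R : realType}.
Local Notation N := (counting_measure X R).
Variables (mu : {measure set X -> \bar R}) (nu : probability N R).
Hypothesis Hnu : poisson_counts mu nu.

(** Adding a point in [D b] turns the counts [c] with [c b] lowered by one into
    the counts [c], so both sides are multiples of Poisson probabilities and the
    identity is [poisson_weightS]. *)
Lemma mecke_atom (I : finType) (D : I -> set X) (c : I -> nat) (b : I) :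
  (forall i, measurable (D i)) -> trivIset setT D ->
  (forall i, mu (D i) < +oo) ->
  \int[nu]_xi mu (D b `&` [set x | count_event D c (add_dirac xi x)]) =
  (c b)%:R%:E * nu (count_event D c).
Proof.
move=> mD tD fD.
have Db x i : D b x -> \d_x (D i) = (i == b)%:R%:E :> \bar R.
  move=> Dx; rewrite diracE; congr (_%:R%:E); have [->|ib] := eqVneq i b.
    by rewrite mem_set.
  rewrite memNset// => Di; move/eqP: ib; apply; apply: tD => //.
  by exists x.
have [cb0|] := posnP (c b).
  rewrite cb0 mul0e integral0_eq// => xi _.
  rewrite (_ : _ `&` _ = set0) ?measure0//; apply/seteqP; split => // x [Dx /(_ b)].
  rewrite add_diracE Db// eqxx cb0 => /eqP.
  by rewrite padde_eq0// ?onee_eq0 ?andbF// lee_fin.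
case E : (c b) => [//|k] _.
pose c' i := if i == b then k else c i.
have mE : measurable (count_event D c' : set N) by exact: measurable_count_event.
have -> : k.+1%:R%:E * nu (count_event D c) = mu (D b) * nu (count_event D c').
  rewrite !Hnu// -[mu (D b)]fineK ?ge0_fin_numE// -!EFinM; congr (_%:E).
  rewrite (bigD1 b)//= [in RHS](bigD1 b)//= [c' b]/c' eqxx E.
  rewrite [RHS]mulrA poisson_weightS mulrA; congr (_ * _)%R.
  by apply: eq_bigr => i /negbTE ib; rewrite /c' ib.
rewrite (eq_integral (fun xi => mu (D b) * (\1_(count_event D c') xi)%:E)).
  by rewrite ge0_integralZl// ?integral_indic ?setIT//; exact/measurable_EFinP.
move=> xi _.
have h x : D b x -> count_event D c (add_dirac xi x) <-> count_event D c' xi.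
  move=> Dx; split => H i; have := H i; rewrite ?add_diracE Db// /c'.
    have [->|ib] := eqVneq i b; last by rewrite adde0.
    rewrite E; case: (xi (D b)) => [r| |]//=; rewrite -EFinD => -[].
    by rewrite -[k.+1%:R]natr1 => /addIr ->.
  have [->|ib] := eqVneq i b; last by rewrite adde0.
  by rewrite E => ->; rewrite -EFinD natr1.
have [Exi|Exi] := pselect (count_event D c' xi).
  rewrite indicE mem_set// mule1; congr (mu _).
  by apply/seteqP; split => [x []//|x Dx]; split => //; exact/h.
rewrite indicE memNset// mule0 (_ : _ `&` _ = set0) ?measure0//.
by apply/seteqP; split => // x [Dx] /(h _ Dx).
Qed.

End mecke_atom.

Section campbell.
Context {d} {X : measurableType d} {R : realType}.
Local Notation N := (counting_measure X R).
Variables (nu : probability N R) (W : set X) (mW : measurable W) (k : nat).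

(** Restricting to at most [k] points in the window keeps all measures finite,
    which the uniqueness theorem for measures requires. *)
Definition few_points : set N := [set xi | xi W <= k%:R%:E].

Lemma measurable_few_points : measurable few_points.
Proof.
rewrite /few_points -[X in measurable X]setTI.
apply: emeasurable_fun_infty_c => //; exact: measurable_eval.
Qed.

Definition window_kernel (xi : N) : {measure set X -> \bar R} :=
  if xi W <= k%:R%:E then (mrestr xi mW : {measure set X -> \bar R})
  else (mzero : {measure set X -> \bar R}).

Lemma window_kernelE xi A :
  window_kernel xi A = xi (A `&` W) * (\1_few_points xi)%:E.
Proof.
rewrite /window_kernel indicE; case: ifPn => h.
  by rewrite mem_set// mule1.
by rewrite memNset ?mule0//; exact/negP.
Qed.

Let measurable_window_kernel A : measurable A ->
  measurable_fun setT (window_kernel ^~ A).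
Proof.
move=> mA; under eq_fun do rewrite window_kernelE.
apply: emeasurable_funM.
  by apply: measurable_eval; exact: measurableI.
by apply/measurable_EFinP; apply: measurable_indic; exact: measurable_few_points.
Qed.

HB.instance Definition _ :=
  isKernel.Build _ _ N X R window_kernel measurable_window_kernel.

Let window_kernel_uub : measure_fam_uub window_kernel.
Proof.
exists k.+1%:R%R => xi; rewrite window_kernelE setTI indicE.
case: (boolP (_ \in _)) => [/set_mem h|_]; last by rewrite mule0 lte_fin.
by rewrite mule1 (le_lt_trans h)// lte_fin ltr_nat.
Qed.

HB.instance Definition _ :=
  Kernel_isFinite.Build _ _ N X R window_kernel window_kernel_uub.

Lemma measurable_window_integral (g : N * X -> \bar R) :
  measurable_fun setT g -> (forall z, 0 <= g z) ->
  measurable_fun setT (fun xi => \int[window_kernel xi]_x g (xi, x)).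
Proof. exact: (@measurable_kfcomp _ _ N X R window_kernel g). Qed.

Let measurable_xs E : measurable E ->
  measurable_fun setT (fun xi => window_kernel xi (xsection E xi)).
Proof.
by move=> mE; apply: (@measurable_fun_xsection_finite_kernel _ _ N X R
  window_kernel); rewrite inE.
Qed.

(** The Campbell measure of the point process of law [nu], truncated to the
    window and to configurations in [few_points]. *)
Definition campbell (E : set (N * X)) :=
  \int[nu]_xi window_kernel xi (xsection E xi).

Let campbell0 : campbell set0 = 0.
Proof. by rewrite /campbell integral0_eq// => xi _; rewrite xsection0. Qed.

Let campbell_ge0 E : 0 <= campbell E.
Proof. exact: integral_ge0. Qed.

Let campbell_sigma_additive : semi_sigma_additive campbell.
Proof.
move=> F mF tF mUF.
rewrite [X in _ --> X](_ : _ = \sum_(n <oo) campbell (F n)).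
  by apply/cvg_closeP; split; [exact: is_cvg_nneseries|rewrite closeE].
rewrite -integral_nneseries//; last by move=> n; exact: measurable_xs.
apply: eq_integral => x _; apply/esym/cvg_lim => //=; rewrite xsection_bigcup.
apply: (measure_sigma_additive _ (trivIset_xsection tF)) => ?.
exact: measurable_xsection.
Qed.

HB.instance Definition _ := isMeasure.Build _ _ _ campbell
  campbell0 campbell_ge0 campbell_sigma_additive.

Import HBNNSimple.

(** The usual passage from indicators to simple functions to monotone limits. *)
Lemma integral_campbell (g : N * X -> \bar R) :
  measurable_fun setT g -> (forall z, 0 <= g z) ->
  \int[campbell]_z g z = \int[nu]_xi \int[window_kernel xi]_x g (xi, x).
Proof.
move=> mg g0; pose f_ := nnsfun_approx measurableT mg.
have lim_f z : g z = limn (fun n => (f_ n z)%:E).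
  by apply/esym/cvg_lim => //; exact: cvg_nnsfun_approx.
have mono z : {homo (fun n => (f_ n z)%:E) : n m / (n <= m)%N >-> n <= m}.
  by move=> a b ab; rewrite lee_fin; exact/lefP/nd_nnsfun_approx.
have mf n xi : measurable_fun setT (fun x => (f_ n (xi, x))%:E).
  by apply/measurable_EFinP; exact: measurableT_comp.
rewrite (eq_integral (fun z => limn (fun n => (f_ n z)%:E))); last first.
  by move=> z _; exact: lim_f.
rewrite monotone_convergence//; last 2 first.
- by move=> n; exact/measurable_EFinP.
- by move=> n z _; rewrite lee_fin.
rewrite [RHS](eq_integral (fun xi =>
    limn (fun n => \int[window_kernel xi]_x (f_ n (xi, x))%:E))); last first.
  move=> xi _; rewrite -monotone_convergence//.
    by apply: eq_integral => x _; exact: lim_f.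
  by move=> n x _; rewrite lee_fin.
rewrite [RHS]monotone_convergence//; last 3 first.
- move=> n; apply: (measurable_window_integral (g := fun z => (f_ n z)%:E)).
    exact/measurable_EFinP.
  by move=> z; rewrite lee_fin.
- by move=> n xi _; apply: integral_ge0 => x _; rewrite lee_fin.
- move=> xi _ a b ab; apply: ge0_le_integral => //.
  + by move=> x _; rewrite lee_fin.
  + by move=> x _; exact: mono.
congr (limn _); apply/funext => n.
under eq_integral do rewrite fimfunE -fsumEFin//.
rewrite ge0_integral_fsum//; last 2 first.
- move=> r; apply/measurable_EFinP; exact: measurable_funM.
- by move=> r z _; rewrite EFinM nnfun_muleindic_ge0.
rewrite [RHS](eq_integral (fun xi => \sum_(r \in range (f_ n))
    \int[window_kernel xi]_x (r * \1_(f_ n @^-1` [set r]) (xi, x))%:E)); last first.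
  move=> xi _; under eq_integral do rewrite fimfunE -fsumEFin//.
  rewrite ge0_integral_fsum//.
  - move=> r; apply/measurable_EFinP; apply: measurable_funM => //.
    exact: measurableT_comp.
  - by move=> r x _; rewrite EFinM nnfun_muleindic_ge0.
have mfr r : measurable (f_ n @^-1` [set r]) by [].
have inner r xi : \int[window_kernel xi]_x (r * \1_(f_ n @^-1` [set r]) (xi, x))%:E
    = r%:E * window_kernel xi (xsection (f_ n @^-1` [set r]) xi).
  have := @integralZl_indic _ X R (window_kernel xi) setT measurableT
    (fun r => xsection (f_ n @^-1` [set r]) xi) r.
  rewrite integral_indic ?setIT//; last exact: measurable_xsection.
  move=> <-; last 2 first.
  - by move=> r0; rewrite preimage_nnfun0// xsection0.
  - exact: measurable_xsection.
  by apply: eq_integral => x _; rewrite !indicE mem_xsection.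
rewrite ge0_integral_fsum//; last 2 first.
- move=> r; under eq_fun do rewrite inner.
  by apply: emeasurable_funM => //; exact: measurable_xs.
- move=> r xi _; apply: integral_ge0 => x _.
  by rewrite EFinM nnfun_muleindic_ge0.
apply: eq_fsbigr => r _.
rewrite integralZl_indic_nnsfun// integral_indic// setIT.
rewrite [RHS](eq_integral (fun xi =>
  r%:E * window_kernel xi (xsection (f_ n @^-1` [set r]) xi))); last first.
  by move=> xi _; exact: inner.
have [r0|r0] := leP 0%R r.
  by rewrite ge0_integralZl//; exact: measurable_xs.
rewrite /= preimage_nnfun0// measure0 mule0 integral0_eq// => xi _.
by rewrite xsection0 measure0 mule0.
Qed.

End campbell.

Section cylinder.
Context {d} {X : measurableType d} {R : realType}.
Local Notation N := (counting_measure X R).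
Variables (I : finType) (B : I -> set X) (kk : I -> nat) (W C : set X) (k : nat).
Hypotheses (mB : forall i, measurable (B i)) (mW : measurable W)
  (mC : measurable C).

(** The sets whose indicators matter for a box with counts [kk] on the sets [B]
    and point in [C]: the atoms are taken with respect to all of them. *)
Definition cyl_family (j : option (option I)) : set X :=
  match j with None => C | Some None => W | Some (Some i) => B i end.

Definition cyl_union : set X := W `|` \bigcup_(i in [set: I]) B i.

Definition cyl_atom := atom cyl_family cyl_union.

Lemma measurable_cyl_family j : measurable (cyl_family j).
Proof. by case: j => [[i|]|]; [exact: mB|exact: mW|exact: mC]. Qed.

Lemma measurable_cyl_union : measurable cyl_union.
Proof. by rewrite /cyl_union; apply: measurableU => //; apply: fin_bigcup_measurable => // i _; exact: mB. Qed.

Lemma measurable_cyl_atom a : measurable (cyl_atom a).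
Proof.
apply: measurable_atom; [exact: measurable_cyl_family|exact: measurable_cyl_union].
Qed.

Lemma cyl_family_union j : cyl_family (Some j) `&` cyl_union = cyl_family (Some j).
Proof.
apply/setIidl => x; case: j => [i|] /= h; last by left.
by right; exists i.
Qed.

Lemma measure_cyl_atom (m : {measure set X -> \bar R}) j :
  m (cyl_family (Some j)) =
  \sum_(a : {ffun option (option I) -> bool} | a (Some j)) m (cyl_atom a).
Proof.
rewrite -cyl_family_union; apply: measure_atom; first exact: measurable_cyl_family.
exact: measurable_cyl_union.
Qed.

Lemma cyl_atom_le (m : {measure set X -> \bar R}) a :
  (m (cyl_atom a) = 0) \/ exists j, m (cyl_atom a) <= m (cyl_family (Some j)).
Proof.
have [->|/set0P [x [Ux xa]]] := eqVneq (cyl_atom a) set0.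
  by left; rewrite measure0.
right; suff [j aj] : exists j, a (Some j).
  exists j; apply: le_measure; rewrite ?inE; [exact: measurable_cyl_atom|
    exact: measurable_cyl_family|].
  by move=> y [_ /(_ (Some j)) [_]]; apply.
case: Ux => [Wx|[i _ Bx]]; first by exists None; exact/xa.
by exists (Some i); exact/xa.
Qed.

(** An a priori bound on the number of points in any atom, which makes the
    decomposition into atom counts finite. *)
Definition cyl_bound := (k + \sum_i kk i)%N.

Definition cyl_index :=
  ({ffun {ffun option (option I) -> bool} -> 'I_cyl_bound.+1} *
   {ffun option (option I) -> bool})%type.

(** Admissible pairs of counts on the atoms and of an atom containing the point:
    those that reproduce the counts [kk], at most [k] points in [W], and a point
    in both [C] and [W]. *)
Definition cyl_ok (p : cyl_index) : bool :=
  [&& [forall i, (\sum_(a : {ffun option (option I) -> bool} | a (Some (Some i))) p.1 a)%N == kk i],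
      (\sum_(a : {ffun option (option I) -> bool} | a (Some None)) p.1 a <= k)%N, p.2 None & p.2 (Some None)].

Definition cyl_box (p : cyl_index) : set (N * X) :=
  count_event cyl_atom (fun a => p.1 a) `*` cyl_atom p.2.

Definition cylinder : set (N * X) :=
  (count_event B kk `&` few_points W k) `*` (C `&` W).

Lemma count_event_cyl_sum (c : {ffun option (option I) -> bool} -> nat) (xi : N) j :
  count_event cyl_atom c xi ->
  xi (cyl_family (Some j)) = (\sum_(a : {ffun option (option I) -> bool} | a (Some j)) c a)%:R%:E.
Proof.
move=> h; rewrite measure_cyl_atom (eq_bigr (fun a => (c a)%:R%:E)).
  by rewrite sumEFin -natr_sum.
by move=> a _; exact: h.
Qed.

(** Integer values and the bound [cyl_bound] leave finitely many possible counts
    on the atoms, and these determine the counts on [B] and [W]. *)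
Lemma cylinder_boxes : cylinder = \bigcup_(p in [set p | cyl_ok p]) cyl_box p.
Proof.
apply/seteqP; split; last first.
  move=> [xi x] [[c b] /= /and4P[/forallP Q1 Q2 bC bW]] [/= Ec [_ xb]].
  split; split => /=; last 2 first.
  - exact/(xb None).
  - exact/(xb (Some None)).
  - by move=> i; rewrite (count_event_cyl_sum (Some i) Ec) (eqP (Q1 i)).
  - by rewrite /few_points/= (count_event_cyl_sum None Ec) lee_fin ler_nat.
move=> [xi x] [/= [EB fW] [Cx Wx]].
have bnd j : xi (cyl_family (Some j)) <= cyl_bound%:R%:E.
  case: j => [i|] /=.
    by rewrite EB lee_fin ler_nat /cyl_bound (bigD1 i)//= addnCA leq_addr.
  by rewrite (le_trans fW)// lee_fin ler_nat leq_addr.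
have /choice [c cE] a : exists n : 'I_cyl_bound.+1, xi (cyl_atom a) = n%:R%:E.
  have le_a : xi (cyl_atom a) <= cyl_bound%:R%:E.
    case: (cyl_atom_le xi a) => [->|[j /le_trans]]; last exact.
    by rewrite lee_fin.
  have [ao|[n an]] := counting_measure_integer xi (measurable_cyl_atom a).
    by move: le_a; rewrite ao leye_eq.
  move: le_a; rewrite an lee_fin ler_nat -ltnS => nM.
  by exists (Ordinal nM).
have Ec : count_event cyl_atom (fun a => c a) xi by move=> a; exact: cE.
exists ([ffun a => c a], [ffun j => `[< cyl_family j x >]]).
  apply/and4P; split => /=.
  - apply/forallP => i.
    have := count_event_cyl_sum (Some i) Ec; rewrite /= EB => -[/eqP].
    rewrite eqr_nat => /eqP ->; apply/eqP/eq_bigr => a _.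
    by rewrite ffunE.
  - have := count_event_cyl_sum None Ec => /= e; move: fW.
    rewrite /few_points/= e lee_fin ler_nat; apply: leq_trans.
    by under eq_bigr do rewrite ffunE.
  - by rewrite ffunE; exact/asboolP.
  - by rewrite ffunE; exact/asboolP.
split => /=; first by move=> a; rewrite ffunE.
split; first by left.
by move=> j; rewrite ffunE; split => /asboolP.
Qed.

Lemma measurable_cyl_box p : measurable (cyl_box p).
Proof.
apply: measurableX; last exact: measurable_cyl_atom.
by apply: measurable_count_event; exact: measurable_cyl_atom.
Qed.

Lemma trivIset_cyl_box : trivIset setT cyl_box.
Proof.
move=> [c b] [c' b'] _ _ [[xi x] [[/= h1 h2] [/= h1' h2']]].
congr (_, _).
  apply/ffunP => a; apply/val_inj/eqP => /=.
  by rewrite -(eqr_nat R) -eqe -h1 h1'.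
exact: (@trivIset_atom _ X _ cyl_family cyl_union b b' Logic.I Logic.I (ex_intro _ x (conj h2 h2'))).
Qed.

Lemma measure_cylinder (m : {measure set (N * X) -> \bar R}) :
  m cylinder = \sum_(p | cyl_ok p) m (cyl_box p).
Proof.
rewrite cylinder_boxes measure_finType_bigcup//.
  exact: measurable_cyl_box.
exact: trivIset_cyl_box.
Qed.

Lemma cyl_box_sub p : cyl_ok p ->
  [/\ count_event cyl_atom (fun a => p.1 a) `<=` (few_points W k : set N) &
      cyl_atom p.2 `<=` W].
Proof.
case: p => c b /and4P[/= _ Q2 _ bW]; split => [xi Ec|x [_ xb]]; last exact/(xb (Some None)).
by rewrite /few_points/= (count_event_cyl_sum None Ec) lee_fin ler_nat.
Qed.

End cylinder.

Section mrestr_integral.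
Context {d} {T : measurableType d} {R : realType}.

Lemma ge0_integral_mrestr (m : {measure set T -> \bar R}) (D : set T)
    (mD : measurable D) (f : T -> \bar R) :
  measurable_fun setT f -> (forall x, 0 <= f x) ->
  \int[mrestr m mD]_x f x = \int[m]_(x in D) f x.
Proof.
move=> mf f0.
rewrite (@ge0_negligible_integral _ _ _ _ setT (~` D))//.
- rewrite setTD setCK; apply: eq_measure_integral => A mA AD.
  by rewrite /= /mrestr setIidl.
- exact: measurableC.
- by rewrite /= /mrestr setICl measure0.
Qed.

End mrestr_integral.

Section generators.
Context {d} {X : measurableType d} {R : realType}.
Local Notation N := (counting_measure X R).
Variable mu : {sigma_finite_measure set X -> \bar R}.

(** An intersection-stable generator of the product sigma-algebra. Only sets of
    finite intensity are allowed, since [poisson_counts] speaks of these. *)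
Definition box_sets : set (set (N * X)) :=
  [set E | exists n (B : 'I_n -> set X) (c : 'I_n -> nat) (C : set X),
    [/\ forall i, measurable (B i) /\ mu (B i) < +oo, measurable C &
        E = count_event B c `*` C]].

Lemma box_sets_measurable : box_sets `<=` measurable.
Proof.
move=> _ [n [B [c [C [mB mC ->]]]]]; apply: measurableX => //.
by apply: measurable_count_event => i; exact: (mB i).1.
Qed.

Lemma box_setsI : setI_closed box_sets.
Proof.
move=> _ _ [n [B [c [C [mB mC ->]]]]] [n' [B' [c' [C' [mB' mC' ->]]]]].
exists (n + n')%N.
exists (fun i : 'I_(n + n') => match fintype.split i with inl j => B j | inr j => B' j end).
exists (fun i : 'I_(n + n') => match fintype.split i with inl j => c j | inr j => c' j end).
exists (C `&` C'); split; [| exact: measurableI|].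
  by move=> i; case: (fintype.split i) => j; [exact: mB|exact: mB'].
rewrite -setXI; congr (_ `*` _); apply/seteqP; split => xi.
  by move=> [h h'] i; case: (fintype.split i) => j; [exact: h|exact: h'].
move=> h; split => i.
  have := h (lshift _ i); case: fintype.splitP => j /= e.
    by have -> : j = i by apply: ord_inj; rewrite -e.
  by have := ltn_ord i; rewrite e ltnNge leq_addr.
have := h (rshift _ i); case: fintype.splitP => j /= e.
  by have := ltn_ord j; rewrite -e ltnNge leq_addr.
by have -> : j = i by apply/ord_inj/eqP; rewrite -(eqn_add2l n) e.
Qed.

(** Preimages of single integers determine those of all sets, the preimage of
    infinity being the complement of their union. *)
Lemma measurable_fun_nat_or_infty {d'} {T : measurableType d'} (v : T -> \bar R) :
  (forall t, v t = +oo \/ exists n, v t = n%:R%:E) ->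
  (forall n : nat, measurable (v @^-1` [set n%:R%:E])) ->
  measurable_fun setT v.
Proof.
move=> vn mv _ Y mY; rewrite setTI.
have -> : v @^-1` Y = (\bigcup_(n in [set n : nat | Y n%:R%:E]) v @^-1` [set n%:R%:E])
    `|` (if pselect (Y +oo) then ~` \bigcup_n v @^-1` [set n%:R%:E] else set0).
  apply/seteqP; split => [t /= Yt|t [[n /= Yn /= -> //]|]].
    case: (vn t) => [vt|[n nt]]; last by left; exists n => //=; rewrite -nt.
    right; rewrite vt in Yt; case: pselect => // _ [n _ /=].
    by rewrite vt.
  case: pselect => //= Yo h; case: (vn t) => [vt|[n nt]].
    by rewrite /preimage /= vt.
  by exfalso; apply: h; exists n.
apply: measurableU; first exact: bigcup_measurable.
case: pselect => /= _; last exact: measurable0.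
by apply: measurableC; exact: bigcup_measurable.
Qed.

(** A set of infinite intensity is an increasing union of sets of finite
    intensity, so its count is a limit of counts that the boxes control. *)
Lemma box_sets_generate : @measurable _ (N * X)%type = <<s box_sets >>.
Proof.
apply/seteqP; split; last first.
  apply: smallest_sub; [exact: sigma_algebra_measurable|exact: box_sets_measurable].
pose G := g_sigma_algebraType box_sets.
have mfst : measurable_fun setT (fst : G -> N).
  apply: measurable_fun_counting => B mB.
  have [F [FT ndF mF]] := (sigma_finiteP _ _).1 (sigma_finiteT mu).
  apply: (emeasurable_fun_cvg (fun n (t : G) => t.1 (B `&` F n))).
    move=> n; apply: measurable_fun_nat_or_infty.
      move=> t; apply: counting_measure_integer.
      by apply: measurableI => //; exact: (mF n).1.
    move=> k; apply: sub_sigma_algebra.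
    exists 1%N, (fun _ => B `&` F n), (fun _ => k), setT.
    have mBF : measurable (B `&` F n) by apply: measurableI => //; exact: (mF n).1.
    split => //.
      move=> _; split => //.
      by rewrite (le_lt_trans _ (mF n).2)// le_measure ?inE//; exact: (mF n).1.
    by apply/seteqP; split => [t h|t [/(_ ord0)]//]; split.
  move=> t _.
  have {2}-> : B = \bigcup_n (B `&` F n) by rewrite -setI_bigcupr -FT setIT.
  apply: nondecreasing_cvg_mu.
  - by move=> n; apply: measurableI => //; exact: (mF n).1.
  - by apply: bigcup_measurable => n _; apply: measurableI => //; exact: (mF n).1.
  - by move=> n m nm; apply/subsetPset; apply: setIS; exact/subsetPset/ndF.
have msnd : measurable_fun setT (snd : G -> X).
  move=> _ C mC; rewrite setTI; apply: sub_sigma_algebra.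
  exists 0%N, (fun=> set0), (fun=> 0%N), C; split => //; first by case.
  by apply/seteqP; split => [t h|t []//]; split => // -[].
rewrite measurable_prod_measurableType; apply: smallest_sub.
  exact: smallest_sigma_algebra.
move=> _ [A mA [C mC <-]].
have -> : A `*` C = (fst @^-1` A) `&` (snd @^-1` C) by [].
apply: (@measurableI _ G).
  by have := mfst measurableT A mA; rewrite setTI.
by have := msnd measurableT C mC; rewrite setTI.
Qed.

End generators.

Section mecke.
Context {d} {X : measurableType d} {R : realType}.
Local Notation N := (counting_measure X R).

(** The map along which the Mecke equation transports measures. *)
Definition adjoin (z : N * X) : N * X := (add_dirac z.1 z.2, z.2).

Lemma measurable_adjoin : measurable_fun setT adjoin.
Proof. by apply: measurable_fun_pair => //; exact: measurable_add_dirac. Qed.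

HB.instance Definition _ := isMeasurableFun.Build _ _ _ _ adjoin measurable_adjoin.

Variables (mu : {sigma_finite_measure set X -> \bar R}) (nu : probability N R).
Hypothesis Hnu : poisson_counts mu nu.
Variables (W : set X) (mW : measurable W) (Wfin : mu W < +oo) (k : nat).

Local Notation muW := (mfrestr mW Wfin).

Let mS : measurable ((few_points W k : set N) `*` (setT : set X)).
Proof. by apply: measurableX => //; exact: measurable_few_points. Qed.

(** The law of a configuration with one point added in the window, together with
    the added point. *)
Let added : {measure set (N * X) -> \bar R} :=
  measure_function_pushforward__canonical__measure_function_Measure
    (nu \x muW) measurable_adjoin.

Lemma addedE E : measurable E ->
  added E = \int[nu]_xi mu (W `&` [set x | E (adjoin (xi, x))]).
Proof.
move=> mE; rewrite /added/= /pushforward /product_measure1/=.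
apply: eq_integral => xi _; rewrite /mfrestr /mrestr setIC; congr (mu (_ `&` _)).
by apply/seteqP; split => x; rewrite /xsection/= inE.
Qed.

Lemma added_campbell_box (I : finType) (D : I -> set X) (c : I -> nat) b :
  (forall i, measurable (D i)) -> trivIset setT D -> (forall i, mu (D i) < +oo) ->
  count_event D c `<=` (few_points W k : set N) -> D b `<=` W ->
  mrestr added mS (count_event D c `*` D b) =
  campbell nu mW k (count_event D c `*` D b).
Proof.
move=> mD tD fD Ek DW.
have mE : measurable (count_event D c : set N) by exact: measurable_count_event.
rewrite /= /mrestr setIidl; last by move=> [xi x] [/= /Ek].
rewrite addedE; last exact: measurableX.
transitivity (\int[nu]_xi mu (D b `&` [set x | count_event D c (add_dirac xi x)])).
  apply: eq_integral => xi _; congr (mu _); apply/seteqP; split => [x [_ []//]|].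
  by move=> x [Dx Ex]; split => //; exact: DW.
rewrite mecke_atom// /campbell.
rewrite (eq_integral (fun xi => (c b)%:R%:E * (\1_(count_event D c) xi)%:E)).
  by rewrite ge0_integralZl// ?integral_indic ?setIT//; exact/measurable_EFinP.
move=> xi _; rewrite indicE; case: (boolP (xi \in _)) => [xiE|xiE].
  rewrite in_xsectionX// window_kernelE indicE mem_set ?mule1; last first.
    by apply: Ek; exact: set_mem.
  by rewrite setIidl//; exact: (set_mem xiE).
by rewrite mule0 notin_xsectionX// measure0.
Qed.

(** Both measures are finite and agree on [box_sets]: a box, cut down to the
    window, is a finite disjoint union of products of atoms, where
    [mecke_atom] applies. *)
Lemma added_campbell E : measurable E ->
  mrestr added mS E = campbell nu mW k E.
Proof.
move=> mE; apply: (measure_unique (box_sets mu) (fun=> setT)) => //.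
- exact: box_sets_generate.
- exact: box_setsI.
- move=> _; exists 0%N, (fun=> set0), (fun=> 0%N), setT; split => //; first by case.
  by apply/seteqP; split => [t _|//]; split => // -[].
- by rewrite bigcup_const//; exists 0%N.
- move=> _ [n [B [c [C [mB mC ->]]]]].
  have mBn i := (mB i).1.
  pose K : set (N * X) := cylinder B c W C k.
  have mK : measurable K.
    apply: measurableX; last exact: measurableI.
    by apply: measurableI; [exact: measurable_count_event|exact: measurable_few_points].
  have e1 : mrestr added mS (count_event B c `*` C) = mrestr added mS K.
    rewrite /= /mrestr !addedE; last 2 first.
    + exact: measurableI.
    + by apply: measurableI => //; apply: measurableX => //; exact: measurable_count_event.
    apply: eq_integral => xi _; congr (mu _); apply/seteqP; split => [x|x].
      by move=> [Wx [[/= h1 h2] [h3 _]]].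
    by move=> [Wx [[/= [h1 h1'] [h2 h2']] _]].
  have e2 : campbell nu mW k (count_event B c `*` C) = campbell nu mW k K.
    apply: eq_integral => xi _; rewrite !window_kernelE.
    have [fxi|fxi] := pselect (few_points W k xi); last first.
      by rewrite indicE memNset// !mule0.
    congr (xi _ * _); apply/seteqP; split => x [xK Wx]; split => //.
      move: xK; rewrite /xsection/= !inE => -[/= h1 h2].
      by split => //=; split.
    by move: xK; rewrite /xsection/= !inE => -[/= [h1 _] [h2 _]]; split.
  apply: (etrans e1); apply: etrans (esym e2).
  pose m1 : {measure set (N * X) -> \bar R} := mrestr added mS.
  pose m2 : {measure set (N * X) -> \bar R} := campbell nu mW k.
  rewrite -[LHS]/(m1 K) -[RHS]/(m2 K) !measure_cylinder//; apply: eq_bigr => p okp.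
  have [s1 s2] := cyl_box_sub (R := R) mBn mW mC okp.
  have := @added_campbell_box _ (cyl_atom B W C) (fun a => p.1 a) p.2.
  apply => //.
  + by move=> a; exact: measurable_cyl_atom.
  + exact: trivIset_atom.
  + move=> a; have [->//|[j /le_lt_trans]] := cyl_atom_le mBn mW mC mu a.
    by apply; case: j => [i|//]; exact: (mB i).2.
- move=> _; rewrite /= /mrestr setTI (le_lt_trans (y := added setT))//.
    by rewrite le_measure ?inE.
  rewrite /added/= /pushforward preimage_setT -setXTT product_measure1E//.
  have h : mfrestr mW Wfin setT < +oo by rewrite /mfrestr /mrestr setTI.
  apply: (le_lt_trans _ h); rewrite -[leRHS]mul1e; apply: lee_wpmul2r => //.
  exact: probability_le1.
Qed.

(** The Mecke equation, truncated to a window and to few points in it. *)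
Theorem mecke (g : N * X -> \bar R) :
  measurable_fun setT g -> (forall z, 0 <= g z) ->
  \int[nu]_xi \int[muW]_x
    (g (add_dirac xi x, x) * (\1_(few_points W k) (add_dirac xi x))%:E) =
  \int[nu]_xi \int[window_kernel mW k xi]_x g (xi, x).
Proof.
move=> mg g0.
rewrite -integral_campbell//.
transitivity (\int[mrestr added mS]_z g z); last first.
  by apply: eq_measure_integral => A mA _; exact: added_campbell.
rewrite ge0_integral_mrestr// integral_mkcond.
have mgS : measurable_fun setT (g \_ (few_points W k `*` setT)).
  by apply/(measurable_restrictT _ mS); exact: measurable_funTS.
have gS0 z : 0 <= (g \_ (few_points W k `*` setT)) z.
  by apply: erestrict_ge0.
rewrite [RHS](ge0_integral_pushforward measurable_adjoin)//.
rewrite preimage_setT fubini_tonelli1//.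
- apply: eq_integral => xi _; apply: eq_integral => x _.
  rewrite /= patchE indicE /adjoin/=; case: (boolP (_ \in few_points W k)) => h.
    by rewrite mule1 mem_set//; split => //=; exact: set_mem.
  rewrite mule0 memNset// => -[/= h1 _]; move/negP : h; apply; exact: mem_set.
- exact: measurableT_comp mgS measurable_adjoin.
- by move=> z; exact: gS0.
Qed.

End mecke.

(** * Subtracting a point measurably *)

Section lift.
Context {d} {X : measurableType d} {R : realType}.
Local Notation N := (counting_measure X R).

(** Both coordinates are measurable functions of the image: the configuration is
    recovered by subtracting the Dirac mass of the second coordinate from the
    value on each measurable set. *)
Lemma adjoin_preimage (E : set (N * X)) : measurable E ->
  exists2 E', measurable E' & E = (@adjoin d X R) @^-1` E'.
Proof.
move=> mE; pose T := g_sigma_algebra_preimageType (@adjoin d X R).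
have madj B : measurable B -> @measurable _ T ((@adjoin d X R) @^-1` B).
  by move=> mB; exists B => //; rewrite setTI.
have msnd : measurable_fun setT (snd : T -> X).
  move=> _ C mC; rewrite setTI.
  apply: (madj (snd @^-1` C)); rewrite -[X in measurable X]setTI.
  exact: measurable_snd.
have mfst : measurable_fun setT (fst : T -> N).
  apply: measurable_fun_counting => B mB _ Y mY; rewrite setTI.
  pose v (z : N * X) := z.1 B - \d_z.2 B.
  have mv : measurable_fun setT v.
    apply: emeasurable_funB.
      exact: (measurableT_comp (measurable_eval mB) measurable_fst).
    under eq_fun do rewrite diracE -indicE.
    apply/measurable_EFinP.
    exact: (measurableT_comp (measurable_indic mB) measurable_snd).
  have := madj (v @^-1` Y); rewrite -[X in measurable X -> _]setTI => /(_ (mv measurableT Y mY)).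
  congr measurable; apply/seteqP.
  suff e z : v (adjoin z) = z.1 B by split => z; rewrite /preimage /= -e.
  by rewrite /v -[(adjoin z).1]/(add_dirac z.1 z.2) -[(adjoin z).2]/(z.2) add_diracE addeK// diracE.
have : measurable_fun setT (fun t : T => (t.1, t.2) : N * X).
  exact: measurable_fun_pair.
move=> /(_ measurableT E mE); rewrite setTI => -[E' mE' EE'].
exists E' => //; rewrite setTI in EE'; rewrite EE'.
by apply/seteqP; split => -[].
Qed.

(** The superlevel sets at rational heights lift by [adjoin_preimage], and the
    supremum of the heights reached recovers the function. *)
Lemma adjoin_lift (g : N * X -> \bar R) :
  measurable_fun setT g -> (forall z, 0 <= g z) ->
  exists G : N * X -> \bar R,
    [/\ measurable_fun setT G, forall z, 0 <= G z & forall z, G (adjoin z) = g z].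
Proof.
move=> mg g0.
have mE q : measurable [set z | (ratr q)%:E < g z].
  rewrite -[X in measurable X]setTI; exact: emeasurable_fun_o_infty.
have /choice [E /all_and2 [mE' EE']] q : exists E', measurable E' /\
    [set z | (ratr q)%:E < g z] = (@adjoin d X R) @^-1` E'.
  by have [E' ? ?] := adjoin_preimage (mE q); exists E'.
pose S z := [set (ratr q)%:E | q in [set q : rat | E q z]] : set (\bar R).
exists (fun z => maxe 0 (ereal_sup (S z))); split => [|z|z].
- apply: measurable_maxe => //.
  apply: (measurability _ (ErealGenOInfty.measurableE R)) => // _ [_ [x ->] <-].
  rewrite setTI (_ : _ @^-1` _ = \bigcup_(q in [set q : rat | (x < ratr q)%R]) E q).
    rewrite bigcup_mkcond; apply: bigcupT_measurable_rat => q.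
    by case: ifPn.
  apply/seteqP; split => [z /=|z [q /= xq Eq] /=]; rewrite in_itv/= andbT.
    by move=> /ereal_sup_gt [_ [q Eq <-]]; rewrite lte_fin => xq; exists q.
  apply: lt_le_trans (ereal_sup_ubound _); last by exists q; [exact: Eq|].
  by rewrite lte_fin.
- by rewrite le_max lexx.
- have ES q : E q (adjoin z) <-> (ratr q)%:E < g z.
    by have := EE' q => /seteqP [h1 h2]; split => [/h2|/h1].
  apply/eqP; rewrite eq_le; apply/andP; split.
    rewrite ge_max g0/=; apply: ge_ereal_sup => _ [q /= /ES h <-]; exact: ltW.
  rewrite leNgt; apply/negP => hlt.
  have [r /andP[r1 r2]] : exists r : R, (maxe 0 (ereal_sup (S (adjoin z))) <= r%:E < g z)%E.
    move: hlt; case e: (maxe _ _) => [r| |].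
    + by exists r; rewrite lexx.
    + by rewrite ltNge leey.
    + have : 0 <= maxe 0 (ereal_sup (S (adjoin z))) by rewrite le_max lexx.
      by rewrite e.
  have [q /andP[q1 q2]] : exists q : rat, (r < ratr q)%R && ((ratr q)%:E < g z).
    case: (g z) r2 => [s| |//]; rewrite ?lte_fin.
      by move=> /rat_in_itvoo [q]; rewrite in_itv/= => /andP[h1 h2]; exists q; rewrite h1 lte_fin.
    have [q] := rat_in_itvoo (ltr_pwDr (@ltr01 R) (lexx r)).
    by rewrite in_itv/= => /andP[h1 h2]; exists q; rewrite h1 ltry.
  have : (ratr q)%:E <= r%:E.
    apply: le_trans r1; rewrite le_max; apply/orP; right.
    by apply: ereal_sup_ubound; exists q => //; exact/ES.
  by rewrite lee_fin leNgt q1.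
Qed.

Lemma integral_le_nonmeasurable {dT} {T : measurableType dT}
    (m : {measure set T -> \bar R}) (f1 f2 : T -> \bar R) :
  (forall x, 0 <= f1 x) -> (forall x, f1 x <= f2 x) ->
  \int[m]_x f1 x <= \int[m]_x f2 x.
Proof.
move=> f10 f12; have f20 x : 0 <= f2 x by exact: le_trans (f12 x).
rewrite !ge0_integralTE//; apply: ereal_sup_le => _ [h hf <-].
by exists h => // x; exact: le_trans (hf x) (f12 x).
Qed.

End lift.

Section finite_window.
Context {d} {X : measurableType d} {R : realType}.
Local Notation N := (counting_measure X R).
Variables (mu : {sigma_finite_measure set X -> \bar R}) (nu : probability N R).
Hypothesis Hnu : poisson_counts mu nu.
Variables (W : set X) (mW : measurable W) (Wfin : mu W < +oo).

Lemma measure_point_count (k : nat) :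
  nu [set xi | xi W = k%:R%:E] = (poisson_weight (fine (mu W)) k)%:E.
Proof.
have := @Hnu unit (fun=> W) (fun=> k) (fun=> mW) _ (fun=> Wfin).
rewrite big_const card_unit /= mulr1 => <-; last by move=> [] [].
by congr (nu _); apply/seteqP; split => [xi h []|xi /(_ tt)].
Qed.

(** Poisson weights of a finite parameter sum to 1. *)
Lemma finite_points : nu (~` \bigcup_k few_points W k) = 0.
Proof.
pose F k : set N := [set xi | xi W = k%:R%:E].
have mF k : measurable (F k : set N).
  have := measurable_eval (R := R) mW measurableT (emeasurable_set1 k%:R%:E).
  by rewrite setTI.
have tF : trivIset setT F.
  move=> i j _ _ [xi []]; rewrite /F /= => h1 h2; apply/eqP.
  by rewrite -(eqr_nat R) -eqe -h1 h2.
have nuF : nu (\bigcup_k F k) = 1.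
  rewrite measure_bigcup//.
  have eT : [set: nat] = \bigcup_k [set k] by apply/seteqP; split => // k _; exists k.
  rewrite -[RHS](probability_setT (poisson_prob (fine (mu W)) 0%N)) [in RHS]eT.
  have tS : trivIset setT (fun k : nat => [set k]) by move=> i j _ _ [k [/= -> ->]].
  rewrite measure_bigcup//.
  apply: eq_eseriesr => k _; apply: (etrans (measure_point_count k)).
  by rewrite -poisson_prob_set1// fine_ge0.
apply/eqP; rewrite -measure_le0.
have mf : measurable (\bigcup_k few_points W k : set N).
  by apply: bigcup_measurable => k _; exact: measurable_few_points.
have mbF : measurable (\bigcup_k F k) by exact: bigcup_measurable.
rewrite (@le_trans _ _ (nu (~` \bigcup_k F k)))//.
  apply: le_measure; rewrite ?inE; [exact: measurableC|exact: measurableC|].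
  by apply: subsetC => xi [k _ /= h]; exists k => //; rewrite /few_points/= h.
by rewrite probability_setC// nuF subee.
Qed.

End finite_window.

Section removal.
Context {d} {X : measurableType d} {R : realType}.
Local Notation N := (counting_measure X R).
Context {dO} {Omega : measurableType dO} (P : probability Omega R).
Variables (mu : {sigma_finite_measure set X -> \bar R}) (eta : {mfun Omega >-> N}).
Local Notation nu := (distribution P eta).
Hypothesis Hnu : poisson_counts mu nu.
Variables (W : set X) (mW : measurable W) (Wfin : mu W < +oo).
Local Notation muW := (mfrestr mW Wfin).

Lemma removal_sq_ge0 phi (f : N -> R) xi x : 0 <= removal_sq phi f xi x.
Proof.
by rewrite /removal_sq; case: remove_dirac => // z; rewrite lee_fin sqr_ge0.
Qed.

Lemma remove_diracP (xi zeta : N) x : remove_dirac xi x = Some zeta ->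
  forall B, measurable B -> xi B = add_dirac zeta x B.
Proof.
rewrite /remove_dirac; case: pselect => // ex [<-] B mB.
by rewrite add_diracE; exact: (projT2 (cid ex)).
Qed.

(** Where [xi] is not of the form [zeta + \d_x], the right-hand side is
    infinite. Elsewhere [xi] and [add_dirac zeta x] agree on measurable sets, so
    no measurable function separates them. *)
Lemma lift_le_removal_sq phi (f f1 : N -> R) (G : N * X -> \bar R) xi x :
  measurable_fun setT f -> measurable_fun setT G ->
  (forall a b, ((pos_part (f1 a - f1 b)) ^+ 2 <= (phi (f a - f b)) ^+ 2)%R) ->
  (forall z, G (adjoin z) = ((pos_part (difference f1 z.1 z.2)) ^+ 2)%:E) ->
  G (xi, x) <= removal_sq phi f xi x.
Proof.
move=> mf mG ff1 GE; rewrite /removal_sq.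
case E : (remove_dirac xi x) => [zeta|]; last exact: leey.
have xz := remove_diracP E.
have -> : f xi = f (add_dirac zeta x) by exact: counting_fun_ext.
have -> : G (xi, x) = G (adjoin (zeta, x)).
  have mGx : measurable_fun setT (fun xi => G (xi, x)).
    exact: (measurableT_comp mG (measurable_pair2 x)).
  have mA : measurable ((fun xi => G (xi, x)) @^-1` [set G (xi, x)]).
    rewrite -[X in measurable X]setTI.
    exact: (mGx measurableT _ (emeasurable_set1 _)).
  exact/esym/(@counting_measurable_ext _ _ _ xi (add_dirac zeta x) _ xz mA).
by rewrite GE lee_fin; exact: ff1.
Qed.

(** The Mecke equation for the lift of the squared positive part of the
    difference, followed by the almost sure bound on the integral against the
    point process. The truncation to [few_points] is removed at the end by
    monotone convergence. *)
Lemma removal_bound phi (f f1 h : N -> R) (L : R) :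
  measurable_fun setT f -> measurable_fun setT f1 -> measurable_fun setT h ->
  (forall xi, 0 <= h xi)%R -> (0 <= L)%R ->
  (forall a b, ((pos_part (f1 a - f1 b)) ^+ 2 <= (phi (f a - f b)) ^+ 2)%R) ->
  {ae P, forall w, \int[eta w]_x removal_sq phi f (eta w) x <= L%:E} ->
  \int[nu]_xi \int[muW]_x
    (h (add_dirac xi x) * (pos_part (difference f1 xi x)) ^+ 2)%:E
  <= L%:E * \int[nu]_xi (h xi)%:E.
Proof.
move=> mf mf1 mh h0 L0 ff1 HV.
pose u (z : N * X) := ((pos_part (difference f1 z.1 z.2)) ^+ 2)%:E.
have mu_ : measurable_fun setT u.
  apply/measurable_EFinP; apply: measurable_funX; apply: measurable_maxr => //.
  apply: measurable_funB; first exact: (measurableT_comp mf1 measurable_add_dirac).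
  exact: (measurableT_comp mf1 measurable_fst).
have u0 z : 0 <= u z by rewrite lee_fin sqr_ge0.
have [G [mG G0 GE]] := adjoin_lift mu_ u0.
pose A xi := \int[muW]_x
    (h (add_dirac xi x) * (pos_part (difference f1 xi x)) ^+ 2)%:E.
have mhu : measurable_fun setT (fun z : N * X => (h (add_dirac z.1 z.2))%:E * u z).
  apply: emeasurable_funM => //; apply/measurable_EFinP.
  exact: (measurableT_comp mh measurable_add_dirac).
have hu0 z : 0 <= (h (add_dirac z.1 z.2))%:E * u z.
  by rewrite mule_ge0// lee_fin.
have mA : measurable_fun setT A.
  exact: (measurable_fun_fubini_tonelli_F (m2 := muW) _ mhu hu0).
have A0 xi : 0 <= A xi.
  by apply: integral_ge0 => x _; rewrite lee_fin mulr_ge0// sqr_ge0.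
have mhT : measurable_fun setT (EFin \o h) by exact/measurable_EFinP.
(* The case of at most k points in the window, the added one included. *)
have bound k : \int[nu]_xi \int[muW]_x ((h (add_dirac xi x))%:E * u (xi, x) *
    (\1_(few_points W k) (add_dirac xi x))%:E) <= L%:E * \int[nu]_xi (h xi)%:E.
  pose g (z : N * X) := (h z.1)%:E * G z.
  have mg : measurable_fun setT g.
    apply: emeasurable_funM => //.
    exact: (measurableT_comp mhT measurable_fst).
  have g0 z : 0 <= g z by rewrite mule_ge0// lee_fin.
  have := mecke Hnu mW Wfin k mg g0.
  rewrite [LHS](eq_integral (fun xi => \int[muW]_x ((h (add_dirac xi x))%:E *
      u (xi, x) * (\1_(few_points W k) (add_dirac xi x))%:E))); last first.
    move=> xi _; apply: eq_integral => x _; congr (_ * _).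
    by rewrite /g -[(add_dirac xi x, x)]/(adjoin (xi, x)) GE.
  move=> ->.
  rewrite -ge0_integralZl//; last first.
    by move=> xi _; rewrite lee_fin.
  pose c xi := \int[window_kernel mW k xi]_x g (xi, x).
  have mc : measurable_fun setT c by exact: measurable_window_integral.
  rewrite (ge0_integral_distribution eta mc); last first.
    by move=> xi; apply: integral_ge0.
  rewrite (ge0_integral_distribution eta (f := fun xi => L%:E * (h xi)%:E)); last 2 first.
  - exact: emeasurable_funM.
  - by move=> xi; rewrite mule_ge0// lee_fin.
  apply: ae_ge0_le_integral => //.
  - by move=> w _; apply: integral_ge0.
  - exact: measurableT_comp.
  - by move=> w _; rewrite /= mule_ge0// lee_fin.
  - by apply: measurableT_comp => //; exact: emeasurable_funM.
  - apply: filterS HV => w HVw _; rewrite /= /c /g /=.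
    rewrite ge0_integralZl//; last 2 first.
    + exact: (measurableT_comp mG (measurable_pair1 _)).
    + by rewrite lee_fin.
    rewrite [leRHS]muleC; apply: lee_wpmul2l; first by rewrite lee_fin.
    apply: le_trans HVw.
    have GR x : G (eta w, x) <= removal_sq phi f (eta w) x.
      exact: (lift_le_removal_sq _ _ mf mG ff1 GE).
    apply: (@le_trans _ _ (\int[eta w]_x G (eta w, x))); last first.
      by apply: integral_le_nonmeasurable => // x; exact: G0.
    have mGx : measurable_fun setT (fun x => G (eta w, x)).
      exact: (measurableT_comp mG (measurable_pair1 _)).
    rewrite /window_kernel; case: ifPn => _.
      by rewrite ge0_integral_mrestr//; exact: ge0_subset_integral.
    by rewrite integral_measure_zero integral_ge0.
(* The added point raises the count by one, whence k + 1. *)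
have le_k k : \int[nu]_(xi in few_points W k) A xi <= L%:E * \int[nu]_xi (h xi)%:E.
  apply: le_trans (bound k.+1).
  have mfk : measurable (few_points W k : set N) by exact: measurable_few_points.
  rewrite integral_mkcond; apply: ge0_le_integral => //.
  - by move=> xi _; exact: erestrict_ge0.
  - by apply/(measurable_restrictT _ mfk); exact: measurable_funTS.
  - pose v (z : N * X) := (h (add_dirac z.1 z.2))%:E * u z *
      (\1_(few_points W k.+1) (add_dirac z.1 z.2))%:E.
    apply: (measurable_fun_fubini_tonelli_F (m2 := muW) v).
      apply: emeasurable_funM => //; apply/measurable_EFinP.
      apply: (measurableT_comp (measurable_indic _) measurable_add_dirac).
      exact: measurable_few_points.
    by move=> z; rewrite mule_ge0// lee_fin.
  - move=> xi _; rewrite patchE; case: ifPn => [/set_mem xik|_]; last first.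
      apply: integral_ge0 => x _; apply: mule_ge0; first exact: (hu0 (xi, x)).
      by rewrite lee_fin.
    rewrite le_eqVlt; apply/orP; left; apply/eqP; apply: eq_integral => x _.
    rewrite indicE mem_set ?mule1//; rewrite /few_points/= add_diracE -natr1 EFinD.
    apply: leeD; first exact: xik.
    by rewrite diracE lee_fin; case: (x \in W) => //=.
pose F k := few_points W k : set N.
have mF k : measurable (F k) by exact: measurable_few_points.
have mbF : measurable (\bigcup_k F k) by exact: bigcup_measurable.
have mN : measurable (~` \bigcup_k F k) by exact: measurableC.
have nN : nu (~` \bigcup_k F k) = 0 by exact: (finite_points Hnu mW Wfin).
rewrite -[leLHS]/(\int[nu]_xi A xi) (ge0_negligible_integral mN _ _ _ nN)//.
rewrite setTD setCK.
have ndF : nondecreasing_seq F.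
  move=> i j ij; apply/subsetPset => xi; rewrite /F /few_points/= => /le_trans; apply.
  by rewrite lee_fin ler_nat.
have cvgA : \int[nu]_(xi in F k) A xi @[k --> \oo] -->
    \int[nu]_(xi in \bigcup_k F k) A xi.
  by apply: ge0_nondecreasing_set_cvg_integral => //; move=> *; exact: measurable_funTS.
rewrite -(cvg_lim _ cvgA)//; apply: lime_le; first by apply/cvg_ex; eexists; exact: cvgA.
by apply: nearW => k; exact: le_k.
Qed.

End removal.

(** * Bounded measurable functions *)

Section bounded_measurable.
Local Open Scope ring_scope.
Context {d} {T : measurableType d} {R : realType}.
Implicit Types g : T -> R.

(** Short for bounded measurable function. All integrands of the entropy argument
    are of this kind, which makes real-valued integrals against finite measures
    behave without integrability side conditions. *)
Definition bmf g := measurable_fun setT g /\ exists M, forall x, `|g x| <= M.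

Lemma bmf_cst c : bmf (cst c).
Proof. by split => //; exists `|c|. Qed.

Lemma bmfD g1 g2 : bmf g1 -> bmf g2 -> bmf (fun x => g1 x + g2 x).
Proof.
move=> [m1 [M1 b1]] [m2 [M2 b2]]; split; first exact: measurable_funD.
by exists (M1 + M2) => x; rewrite (le_trans (ler_normD _ _))// lerD.
Qed.

Lemma bmfM g1 g2 : bmf g1 -> bmf g2 -> bmf (fun x => g1 x * g2 x).
Proof.
move=> [m1 [M1 b1]] [m2 [M2 b2]]; split; first exact: measurable_funM.
by exists (M1 * M2) => x; rewrite normrM ler_pM.
Qed.

Lemma bmfZ c g : bmf g -> bmf (fun x => c * g x).
Proof. by move=> bg; apply: bmfM => //; exact: bmf_cst. Qed.

Lemma bmfB g1 g2 : bmf g1 -> bmf g2 -> bmf (fun x => g1 x - g2 x).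
Proof.
move=> b1 b2; have := bmfD b1 (bmfZ (-1) b2).
by under eq_fun do rewrite mulN1r.
Qed.

Lemma bmf_norm g : bmf g -> bmf (fun x => `|g x|).
Proof.
move=> [mg [M bg]]; split; first exact: measurableT_comp.
by exists M => x; rewrite normr_id.
Qed.

Lemma bmf_sum (I : Type) (s : seq I) (F : I -> T -> R) :
  (forall i, bmf (F i)) -> bmf (fun x => \sum_(i <- s) F i x).
Proof.
move=> bF; elim: s => [|i s ih].
  by under eq_fun do rewrite big_nil; exact: bmf_cst.
by under eq_fun do rewrite big_cons; exact: bmfD.
Qed.

Lemma bmf_indic (A : set T) : measurable A -> bmf (\1_A).
Proof.
move=> mA; split; first exact: measurable_indic.
by exists 1 => x; rewrite indicE; case: (_ \in _); rewrite ?normr1 ?normr0.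
Qed.

Lemma bmf_itv g a b : measurable_fun setT g -> (forall x, a <= g x <= b) -> bmf g.
Proof.
move=> mg gab; split => //; exists (`|a| + `|b|) => x.
have /andP[h1 h2] := gab x; have := ler_norm (- a); rewrite normrN => ha.
have hb := ler_norm b; have a0 := normr_ge0 a; have b0 := normr_ge0 b.
by rewrite ler_norml; apply/andP; split; lra.
Qed.

Lemma bmf_integrable (m : {finite_measure set T -> \bar R}) g :
  bmf g -> m.-integrable setT (EFin \o g).
Proof.
move=> [mg [M bg]]; apply: measurable_bounded_integrable => //.
  by rewrite ltey_eq fin_num_measure.
exists M; split; first exact: num_real.
by move=> r /ltW Mr x _; exact: le_trans (bg x) Mr.
Qed.

Variable m : {finite_measure set T -> \bar R}.

Lemma bint_EFin g : bmf g -> (\int[m]_x g x)%:E = (\int[m]_x (g x)%:E)%E.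
Proof.
move=> bg; rewrite /Rintegral fineK//; apply: integrable_fin_num => //.
exact: bmf_integrable.
Qed.

Lemma bintD g1 g2 : bmf g1 -> bmf g2 ->
  \int[m]_x (g1 x + g2 x) = \int[m]_x g1 x + \int[m]_x g2 x.
Proof. by move=> b1 b2; rewrite RintegralD//; exact: bmf_integrable. Qed.

Lemma bintB g1 g2 : bmf g1 -> bmf g2 ->
  \int[m]_x (g1 x - g2 x) = \int[m]_x g1 x - \int[m]_x g2 x.
Proof. by move=> b1 b2; rewrite RintegralB//; exact: bmf_integrable. Qed.

Lemma bintZ c g : bmf g -> \int[m]_x (c * g x) = c * \int[m]_x g x.
Proof. by move=> bg; rewrite RintegralZl//; exact: bmf_integrable. Qed.

Lemma bint_cst c : \int[m]_x c = c * fine (m setT).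
Proof. exact: Rintegral_cst. Qed.

Lemma bint_le g1 g2 : bmf g1 -> bmf g2 -> (forall x, g1 x <= g2 x) ->
  \int[m]_x g1 x <= \int[m]_x g2 x.
Proof. by move=> b1 b2 g12; apply: le_Rintegral => //; exact: bmf_integrable. Qed.

Lemma bint_ge0 g : (forall x, 0 <= g x) -> 0 <= \int[m]_x g x.
Proof. by move=> g0; exact: Rintegral_ge0. Qed.

Lemma bint_sum (I : Type) (s : seq I) (F : I -> T -> R) :
  (forall i, bmf (F i)) ->
  \int[m]_x (\sum_(i <- s) F i x) = \sum_(i <- s) \int[m]_x F i x.
Proof.
move=> bF; elim: s => [|i s ih].
  rewrite big_nil; under eq_Rintegral do rewrite big_nil.
  by rewrite bint_cst mul0r.
rewrite big_cons -ih -bintD//; last exact: bmf_sum.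
by apply: eq_Rintegral => x _; rewrite big_cons.
Qed.

Lemma bint_norm_le g M : bmf g -> (forall x, `|g x| <= M) ->
  `|\int[m]_x g x| <= M * fine (m setT).
Proof.
move=> bg gM; rewrite (le_trans (le_normr_Rintegral _ _))//.
  exact: bmf_integrable.
rewrite -bint_cst; apply: bint_le => //; [exact: bmf_norm|exact: bmf_cst].
Qed.

End bounded_measurable.

Lemma bmf_comp {d d'} {T : measurableType d} {T' : measurableType d'} {R : realType}
    (g : T -> R) (u : T' -> T) :
  measurable_fun setT u -> bmf g -> bmf (fun x => g (u x)).
Proof.
by move=> mu [mg [M bg]]; split; [exact: measurableT_comp|exists M => x].
Qed.

Section bounded_fubini.
Local Open Scope ring_scope.
Context {d1 d2} {T1 : measurableType d1} {T2 : measurableType d2} {R : realType}.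
Variables (m1 : {finite_measure set T1 -> \bar R})
  (m2 : {finite_measure set T2 -> \bar R}).
Variable g : T1 * T2 -> R.
Hypothesis bg : bmf g.

Let bg1 x : bmf (fun y => g (x, y)).
Proof. exact: (bmf_comp (measurable_pair1 x) bg). Qed.

Let bg2 y : bmf (fun x => g (x, y)).
Proof. exact: (bmf_comp (measurable_pair2 y) bg). Qed.

Let g_integrable : (m1 \x m2)%E.-integrable setT (EFin \o g).
Proof.
have mg : measurable_fun setT (EFin \o g) by apply/measurable_EFinP; exact: bg.1.
apply/(integrable12ltyP m1 m2 mg).
have [M bM] := bg.2.
apply: (@le_lt_trans _ _ (\int[m1]_x \int[m2]_y M%:E)%E).
  apply: ge0_le_integral => //.
  - by move=> x _; apply: integral_ge0.
  - apply: (measurable_fun_fubini_tonelli_F (m2 := m2) (fun z => `|(g z)%:E|%E)) => //.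
    exact: measurableT_comp.
  move=> x _; apply: ge0_le_integral => //.
    by apply: measurableT_comp => //; apply/measurable_EFinP; exact: (bg1 x).1.
  by move=> y _; rewrite /= lee_fin.
under eq_integral do rewrite integral_cst//.
rewrite integral_cst// ltey_eq; apply/orP; left.
by rewrite !fin_numM// fin_num_measure.
Qed.

Lemma bmf_bint1 : bmf (fun x => \int[m2]_y g (x, y)).
Proof.
have [M bM] := bg.2; split.
  have := measurable_fubini_F g_integrable => h.
  exact: measurableT_comp h.
by exists (M * fine (m2 setT)) => x; apply: bint_norm_le.
Qed.

Lemma bint_fubini :
  \int[m1]_x \int[m2]_y g (x, y) = \int[m2]_y \int[m1]_x g (x, y).
Proof.
rewrite {1}/Rintegral [in RHS]/Rintegral.
under eq_integral do rewrite bint_EFin//.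
under [in RHS]eq_integral do rewrite bint_EFin//.
by rewrite (Fubini g_integrable).
Qed.

End bounded_fubini.

(** * Entropy along the addition of random points *)

Section scalar_entropy.
Local Open Scope ring_scope.
Context {R : realType}.
Implicit Types u v c x y : R.

Definition phi_ent u : R := u * ln u.
(** The Bregman divergence of [phi_ent]. *)
Definition bregman v u : R := v * (ln v - ln u) - v + u.

Lemma ln_le_sub1 x : 0 < x -> ln x <= x - 1.
Proof.
move=> x0; have := @le_ln1Dx R (x - 1); rewrite [(1 + _)%R]addrC subrK; apply.
by rewrite ltrBrDl subrr.
Qed.

Lemma ln_ratio_le x y : 0 < x -> 0 < y -> y * (ln x - ln y) <= x - y.
Proof.
move=> x0 y0; rewrite -ln_div ?posrE//.
have := ln_le_sub1 (divr_gt0 x0 y0); rewrite -(ler_pM2l y0) => /le_trans; apply.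
by rewrite mulrBr mulr1 mulrC divfK// gt_eqF.
Qed.

Lemma phi_ent_tangent u y : 0 < u -> 0 < y ->
  phi_ent u + (1 + ln u) * (y - u) <= phi_ent y.
Proof. by move=> u0 y0; have := ln_ratio_le u0 y0; rewrite /phi_ent; nra. Qed.

(** [bregman] is jointly convex and homogeneous of degree one, hence a supremum of
    linear functions of [(v, u)], indexed here by the slope [c = v / u] where
    they touch. *)
Lemma bregman_tangent c v u : 0 < c -> 0 < v -> 0 < u ->
  v * ln c + (1 - c) * u <= bregman v u.
Proof.
move=> c0 v0 u0; have := ln_ratio_le (mulr_gt0 c0 u0) v0.
by rewrite lnM ?posrE// /bregman; nra.
Qed.

Lemma bregman_contact v u : 0 < v -> 0 < u ->
  v * ln (v / u) + (1 - v / u) * u = bregman v u.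
Proof.
move=> v0 u0; rewrite ln_div ?posrE// /bregman mulrBl mul1r divfK ?gt_eqF//.
ring.
Qed.

Lemma bregman_ge0 v u : 0 < v -> 0 < u -> 0 <= bregman v u.
Proof.
by move=> v0 u0; have := bregman_tangent ltr01 v0 u0; rewrite ln1; lra.
Qed.

End scalar_entropy.

Section one_step.
Local Open Scope ring_scope.
Context {d} {X : measurableType d} {R : realType}.
Local Notation N := (counting_measure X R).
Variable muW : {finite_measure set X -> \bar R}.
Local Notation m := (fine (muW setT)).
Variable h : R.
Hypotheses (h0 : 0 <= h) (hm : h * m <= 1).

Definition addition (g : N -> R) (xi : N) : R := \int[muW]_x g (add_dirac xi x).

(** The Markov operator of adding, with probability [h * m], one random point
    with law [muW] divided by its mass [m]. *)
Definition step (g : N -> R) (xi : N) : R := (1 - h * m) * g xi + h * addition g xi.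

(** The right-hand side of the modified logarithmic Sobolev inequality at one
    configuration. *)
Definition gain (Z : N -> R) (xi : N) : R :=
  \int[muW]_x bregman (Z (add_dirac xi x)) (Z xi).

Lemma bmf_add1 (g : N -> R) xi : bmf g -> bmf (fun x => g (add_dirac xi x)).
Proof. exact: (bmf_comp (measurable_add_dirac1 xi)). Qed.

Lemma bmf_add2 (g : N -> R) x : bmf g -> bmf (fun xi => g (add_dirac xi x)).
Proof. exact: (bmf_comp (measurable_add_dirac2 x)). Qed.

Lemma bmf_add (g : N -> R) : bmf g -> bmf (fun z : N * X => g (add_dirac z.1 z.2)).
Proof. exact: (bmf_comp measurable_add_dirac). Qed.

(** A parameter integral; the point mass is the dummy finite measure in the
    configuration variable that the Fubini lemma asks for. *)
Lemma bmf_addition (g : N -> R) : bmf g -> bmf (addition g).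
Proof. by move=> bg; exact: (bmf_bint1 (\d_(point : N)) muW (bmf_add bg)). Qed.

Lemma bmf_step (g : N -> R) : bmf g -> bmf (step g).
Proof.
by move=> bg; apply: bmfD; apply: bmfZ => //; exact: bmf_addition.
Qed.

Lemma bmf_iter (g : N -> R) k : bmf g -> bmf (iter k step g).
Proof. by move=> bg; elim: k => //= k; exact: bmf_step. Qed.

Lemma additionD g1 g2 xi : bmf g1 -> bmf g2 ->
  addition (fun z => g1 z + g2 z) xi = addition g1 xi + addition g2 xi.
Proof. by move=> b1 b2; apply: bintD; exact: bmf_add1. Qed.

Lemma additionZ c g xi : bmf g ->
  addition (fun z => c * g z) xi = c * addition g xi.
Proof. by move=> bg; apply: bintZ; exact: bmf_add1. Qed.

Lemma addition_cst c xi : addition (cst c) xi = c * m.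
Proof. exact: bint_cst. Qed.

Lemma addition_le g1 g2 xi : bmf g1 -> bmf g2 -> (forall z, g1 z <= g2 z) ->
  addition g1 xi <= addition g2 xi.
Proof. by move=> b1 b2 g12; apply: bint_le => //; exact: bmf_add1. Qed.

Lemma addition_ge0 g xi : (forall z, 0 <= g z) -> 0 <= addition g xi.
Proof. by move=> g0; exact: bint_ge0. Qed.

Lemma stepD g1 g2 xi : bmf g1 -> bmf g2 ->
  step (fun z => g1 z + g2 z) xi = step g1 xi + step g2 xi.
Proof. by move=> b1 b2; rewrite /step additionD//; ring. Qed.

Lemma stepZ c g xi : bmf g -> step (fun z => c * g z) xi = c * step g xi.
Proof. by move=> bg; rewrite /step additionZ//; ring. Qed.

Lemma stepB g1 g2 xi : bmf g1 -> bmf g2 ->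
  step (fun z => g1 z - g2 z) xi = step g1 xi - step g2 xi.
Proof.
move=> b1 b2; have -> : (fun z => g1 z - g2 z) = (fun z => g1 z + (-1) * g2 z).
  by apply/funext => z; rewrite mulN1r.
by rewrite stepD ?stepZ ?mulN1r//; exact: bmfZ.
Qed.

Lemma step_cst c xi : step (cst c) xi = c.
Proof. by rewrite /step addition_cst /=; ring. Qed.

Lemma step_le g1 g2 xi : bmf g1 -> bmf g2 -> (forall z, g1 z <= g2 z) ->
  step g1 xi <= step g2 xi.
Proof.
move=> b1 b2 g12; apply: lerD; first by apply: ler_wpM2l => //; rewrite subr_ge0.
by apply: ler_wpM2l => //; exact: addition_le.
Qed.

Lemma iter_le k g1 g2 xi : bmf g1 -> bmf g2 -> (forall z, g1 z <= g2 z) ->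
  iter k step g1 xi <= iter k step g2 xi.
Proof.
by move=> b1 b2 g12; elim: k xi => //= k ih xi; apply: step_le => //; exact: bmf_iter.
Qed.

Lemma iter_cst k c xi : iter k step (cst c) xi = c.
Proof.
elim: k xi => //= k ih xi; have -> : iter k step (cst c) = cst c by exact/funext.
exact: step_cst.
Qed.

Lemma iterB k g1 g2 xi : bmf g1 -> bmf g2 ->
  iter k step (fun z => g1 z - g2 z) xi = iter k step g1 xi - iter k step g2 xi.
Proof.
move=> b1 b2; elim: k xi => //= k ih xi.
by rewrite -stepB; [congr step; exact/funext|exact: bmf_iter..].
Qed.

Lemma iter_itv k g a b xi : bmf g -> (forall z, a <= g z <= b) ->
  a <= iter k step g xi <= b.
Proof.
move=> bg gab; apply/andP; split.
  rewrite -(iter_cst k a xi); apply: iter_le => //; first exact: bmf_cst.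
  by move=> z; have /andP[] := gab z.
rewrite -(iter_cst k b xi); apply: iter_le => //; first exact: bmf_cst.
by move=> z; have /andP[] := gab z.
Qed.

(** Adding a fixed point commutes with adding a random one. *)
Lemma step_add_dirac g xi x : step (fun z => g (add_dirac z x)) xi =
  step g (add_dirac xi x).
Proof.
rewrite /step /addition; congr (_ + _ * _).
by apply: eq_Rintegral => y _; rewrite add_diracAC.
Qed.

Section entropy_step.
Variables (a b : R) (a0 : 0 < a).
Implicit Type Z : N -> R.

Lemma bmf_ln {dT} {T : measurableType dT} (Z : T -> R) :
  measurable_fun setT Z -> (forall z, a <= Z z <= b) -> bmf (fun z => ln (Z z)).
Proof.
move=> mZ Zab; apply: (@bmf_itv _ _ _ _ (ln a) (ln b)).
  exact: measurableT_comp.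
move=> z; have /andP[h1 h2] := Zab z.
have z0 : 0 < Z z by exact: lt_le_trans a0 h1.
by rewrite !ler_ln ?posrE ?h1 ?h2// (lt_le_trans z0).
Qed.

Lemma bmf_phi_ent {dT} {T : measurableType dT} (Z : T -> R) :
  measurable_fun setT Z -> (forall z, a <= Z z <= b) -> bmf (fun z => phi_ent (Z z)).
Proof. by move=> mZ Zab; apply: bmfM; [exact: bmf_itv Zab|exact: bmf_ln]. Qed.

Lemma bmf_bregman {dT} {T : measurableType dT} (Y Z : T -> R) :
  measurable_fun setT Y -> (forall z, a <= Y z <= b) ->
  measurable_fun setT Z -> (forall z, a <= Z z <= b) ->
  bmf (fun z => bregman (Y z) (Z z)).
Proof.
move=> mY Yab mZ Zab; apply: bmfD; last exact: bmf_itv Zab.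
apply: bmfB; last exact: bmf_itv Yab.
by apply: bmfM; [exact: bmf_itv Yab|apply: bmfB; exact: bmf_ln].
Qed.

Variable Z : N -> R.
Hypotheses (mZ : measurable_fun setT Z) (Zab : forall z, a <= Z z <= b).

Let Z0 z : 0 < Z z.
Proof. by apply: lt_le_trans a0 _; have /andP[] := Zab z. Qed.

Let bZ : bmf Z. Proof. exact: bmf_itv Zab. Qed.

Let mZadd : measurable_fun setT (fun z : N * X => Z (add_dirac z.1 z.2)).
Proof. exact: measurableT_comp mZ measurable_add_dirac. Qed.

Let mZfst : measurable_fun setT (fun z : N * X => Z z.1).
Proof. exact: measurableT_comp mZ measurable_fst. Qed.

Lemma bmf_bregman_add :
  bmf (fun z : N * X => bregman (Z (add_dirac z.1 z.2)) (Z z.1)).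
Proof. exact: bmf_bregman. Qed.

Lemma bmf_gain : bmf (gain Z).
Proof. exact: (bmf_bint1 (\d_(point : N)) muW bmf_bregman_add). Qed.

Lemma gain_ge0 xi : 0 <= gain Z xi.
Proof. by apply: bint_ge0 => x; exact: bregman_ge0. Qed.

(** The tangent of [phi_ent] at [Z xi] bounds [phi_ent (step Z xi)] from below,
    and what remains is exactly the divergence. *)
Lemma entropy_step xi :
  step (phi_ent \o Z) xi - phi_ent (step Z xi) <= h * gain Z xi.
Proof.
have bP : bmf (phi_ent \o Z) by exact: bmf_phi_ent.
have gE : gain Z xi = addition (phi_ent \o Z) xi - (1 + ln (Z xi)) * addition Z xi
    + Z xi * m.
  have b1 : bmf (fun x => (phi_ent \o Z) (add_dirac xi x)) by exact: bmf_add1.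
  have b2 : bmf (fun x => (1 + ln (Z xi)) * Z (add_dirac xi x)).
    by apply: bmfZ; exact: bmf_add1.
  rewrite -additionZ// -bint_cst /addition -bintB// -bintD//; [|exact: bmfB|exact: bmf_cst].
  by apply: eq_Rintegral => x _; rewrite /bregman /= /phi_ent; ring.
have s0 : 0 < step Z xi.
  by have /andP[h1 _] := iter_itv 1 xi bZ Zab; exact: lt_le_trans h1.
have := phi_ent_tangent (Z0 xi) s0.
rewrite gE /step /= /phi_ent.
set A := addition Z xi; set B := addition _ xi; set u := Z xi; set l := ln u.
move=> H; apply: le_trans (lerB (lexx _) H) _.
rewrite le_eqVlt; apply/orP; left; apply/eqP; ring.
Qed.

(** Joint convexity of [bregman]: the plane touching it at the averaged pair lies
    below it, and [step] is linear and monotone. Fubini then exchanges the added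
    random points. *)
Lemma gain_step xi : gain (step Z) xi <= step (gain Z) xi.
Proof.
pose k x z := bregman (Z (add_dirac z x)) (Z z).
have mS : measurable_fun setT (step Z) by exact: (bmf_step bZ).1.
have Sab z : a <= step Z z <= b by exact: (iter_itv 1 z bZ Zab).
have S0 z : 0 < step Z z by apply: lt_le_trans a0 _; have /andP[] := Sab z.
have bk x : bmf (k x).
  by apply: bmf_bregman => //; exact: measurableT_comp mZ (measurable_add_dirac2 x).
have bmf_k3 : bmf (fun p : X * X => k p.1 (add_dirac xi p.2)).
  have m1 : measurable_fun setT (fun p : X * X => (add_dirac xi p.2, p.1)).
    apply: measurable_fun_pair => //.
    exact: (measurableT_comp (measurable_add_dirac1 xi) measurable_snd).
  exact: (bmf_comp m1 bmf_bregman_add).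
have le1 x : bregman (step Z (add_dirac xi x)) (step Z xi) <= step (k x) xi.
  set v := step Z (add_dirac xi x); set u := step Z xi.
  have v0 : 0 < v by exact: S0.
  have u0 : 0 < u by exact: S0.
  have c0 : 0 < v / u by exact: divr_gt0.
  rewrite -bregman_contact//.
  have -> : v * ln (v / u) + (1 - v / u) * u =
      step (fun z => ln (v / u) * Z (add_dirac z x) + (1 - v / u) * Z z) xi.
    rewrite stepD; [|by apply: bmfZ; exact: bmf_add2|exact: bmfZ].
    by rewrite !stepZ// ?step_add_dirac//; [rewrite -/u -/v; ring|exact: bmf_add2].
  apply: step_le => //.
    by apply: bmfD; apply: bmfZ => //; exact: bmf_add2.
  by move=> z; rewrite mulrC; exact: bregman_tangent.
apply: (@le_trans _ _ (\int[muW]_x step (k x) xi)).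
  apply: bint_le => //.
    apply: bmf_bregman => //.
      exact: measurableT_comp mS (measurable_add_dirac1 xi).
  apply: bmfD; apply: bmfZ; first exact: (bmf_comp (measurable_pair1 xi) bmf_bregman_add).
  exact: (bmf_bint1 muW muW bmf_k3).
rewrite bintD; last 2 first.
- by apply: bmfZ; exact: (bmf_comp (measurable_pair1 xi) bmf_bregman_add).
- by apply: bmfZ; exact: (bmf_bint1 muW muW bmf_k3).
rewrite !bintZ; last 2 first.
- exact: (bmf_comp (measurable_pair1 xi) bmf_bregman_add).
- exact: (bmf_bint1 muW muW bmf_k3).
rewrite /step lerD2l ler_wpM2l// (bint_fubini muW muW bmf_k3) le_eqVlt.
apply/orP; left; apply/eqP; apply: eq_Rintegral => y _.
by apply: eq_Rintegral => x _.
Qed.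

End entropy_step.
End one_step.

Section entropy_iter.
Local Open Scope ring_scope.
Context {d} {X : measurableType d} {R : realType}.
Local Notation N := (counting_measure X R).
Variable muW : {finite_measure set X -> \bar R}.
Local Notation m := (fine (muW setT)).
Variable h : R.
Hypotheses (h0 : 0 <= h) (hm : h * m <= 1).
Local Notation step := (step muW h).
Local Notation gain := (gain muW).
Variables (a b : R) (a0 : 0 < a) (Z : N -> R).
Hypotheses (mZ : measurable_fun setT Z) (Zab : forall z, a <= Z z <= b).

Let bZ : bmf Z. Proof. exact: bmf_itv Zab. Qed.

Let mI k : measurable_fun setT (iter k step Z).
Proof. exact: (bmf_iter muW h k bZ).1. Qed.

Let Iab k z : a <= iter k step Z z <= b.
Proof. exact: iter_itv. Qed.

Lemma gain_iter k xi : gain (iter k step Z) xi <= iter k step (gain Z) xi.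
Proof.
elim: k xi => //= k ih xi.
apply: le_trans (gain_step h0 hm a0 (mI k) (Iab k) xi) _.
apply: step_le => //; first exact: (bmf_gain muW a0 (mI k) (Iab k)).
by apply: bmf_iter; exact: (bmf_gain muW a0 mZ Zab).
Qed.

(** Each step adds at most [h] times the current [gain], which [gain_iter]
    compares with the initial one. *)
Lemma entropy_iter k xi :
  iter k.+1 step (phi_ent \o Z) xi - phi_ent (iter k.+1 step Z xi) <=
  k.+1%:R * h * iter k step (gain Z) xi.
Proof.
elim: k xi => [|k ih] xi.
  by rewrite mul1r; exact: (entropy_step h0 hm a0 mZ Zab xi).
have bP : bmf (phi_ent \o Z) by exact: (bmf_phi_ent a0 mZ Zab).
have bPI : bmf (phi_ent \o iter k.+1 step Z) by exact: (bmf_phi_ent a0 (mI _) (Iab _)).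
have bG : bmf (gain Z) by exact: (bmf_gain muW a0 mZ Zab).
have e1 := entropy_step h0 hm a0 (mI k.+1) (Iab k.+1) xi.
have e2 : step (iter k.+1 step (phi_ent \o Z)) xi - step (phi_ent \o iter k.+1 step Z) xi
    <= k.+1%:R * h * iter k.+1 step (gain Z) xi.
  rewrite -stepB//; last by apply: bmf_iter.
  rewrite [iter k.+1 step (gain Z)]iterS -stepZ; last exact: bmf_iter.
  apply: step_le => //; first by apply: bmfB => //; exact: bmf_iter.
  by apply: bmfZ; exact: bmf_iter.
have e3 : h * gain (iter k.+1 step Z) xi <= h * iter k.+1 step (gain Z) xi.
  by apply: ler_wpM2l => //; exact: gain_iter.
have -> : k.+2%:R * h * iter k.+1 step (gain Z) xi = k.+1%:R * h * iter k.+1 step (gain Z) xi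
    + h * iter k.+1 step (gain Z) xi.
  by rewrite -[k.+2%:R]natr1; ring.
rewrite [iter k.+2 _ (phi_ent \o Z)]iterS [iter k.+2 _ Z]iterS.
lra.
Qed.

End entropy_iter.

Section local_functions.
Local Open Scope ring_scope.
Context {d} {X : measurableType d} {R : realType}.
Local Notation N := (counting_measure X R).
Variables (W : set X) (mW : measurable W).

Definition agree_on (xi zeta : N) :=
  forall B, measurable B -> B `<=` W -> xi B = zeta B.

Definition local (g : N -> R) := forall xi zeta, agree_on xi zeta -> g xi = g zeta.

Lemma agree_on_add xi zeta x : agree_on xi zeta ->
  agree_on (add_dirac xi x) (add_dirac zeta x).
Proof. by move=> xz B mB BW; rewrite !add_diracE xz. Qed.

Lemma local_iter (muW : {finite_measure set X -> \bar R}) h k g :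
  local g -> local (iter k (step muW h) g).
Proof.
move=> lg; elim: k => //= k ih xi zeta xz; rewrite /step /addition.
congr (_ * _ + _ * _); first exact: ih.
by apply: eq_Rintegral => x _; apply: ih; exact: agree_on_add.
Qed.

Lemma agree_on_empty (xi zeta : N) : xi W = 0 -> zeta W = 0 -> agree_on xi zeta.
Proof.
move=> x0 z0 B mB BW.
by rewrite (subset_measure0 _ _ BW)// (subset_measure0 _ _ BW).
Qed.

End local_functions.

(** * From repeated additions to the Poisson law *)

Section point_weights.
Local Open Scope ring_scope.
Context {d} {X : measurableType d} {R : realType}.
Local Notation N := (counting_measure X R).
Variables (mu : {sigma_finite_measure set X -> \bar R}) (nu : probability N R).
Hypothesis Hnu : poisson_counts mu nu.
Variables (W : set X) (mW : measurable W) (Wfin : (mu W < +oo)%E).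
Local Notation muW := (mfrestr mW Wfin).
Local Notation m := (fine (muW setT)).
Implicit Type g : N -> R.

Definition point_set j : set N := [set xi | xi W = j%:R%:E].
Local Notation pt j := (\1_(point_set j) : N -> R).

Lemma measurable_point_set j : measurable (point_set j).
Proof.
have := measurable_eval (R := R) mW measurableT (emeasurable_set1 j%:R%:E).
by rewrite setTI.
Qed.

Lemma bmf_pt j : bmf (pt j).
Proof. by apply: bmf_indic; exact: measurable_point_set. Qed.

Lemma pt_ge0 j xi : 0 <= pt j xi.
Proof. by rewrite indicE. Qed.

Lemma pt_add j xi x : W x -> pt j.+1 (add_dirac xi x) = pt j xi.
Proof.
move=> Wx; rewrite !indicE; congr (_%:R); apply: congr1.
apply/idP/idP; rewrite !inE /point_set /= add_diracE diracE mem_set//.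
  case: (xi W) => [r| |]//=; rewrite -EFinD => -[].
  by rewrite -[j.+1%:R]natr1 => /addIr ->.
by move=> ->; rewrite -EFinD natr1.
Qed.

Let mecke_point_ge0 j g : bmf g -> (forall xi, 0 <= g xi) ->
  \int[nu]_xi (pt j xi * addition muW g xi) =
  j.+1%:R * \int[nu]_xi (pt j.+1 xi * g xi).
Proof.
move=> bg g0; pose g' (z : N * X) := (pt j.+1 z.1 * g z.1)%:E.
have mg' : measurable_fun setT g'.
  apply/measurable_EFinP; apply: measurable_funM.
    exact: (measurableT_comp (bmf_pt j.+1).1 measurable_fst).
  exact: (measurableT_comp bg.1 measurable_fst).
have g'0 z : (0 <= g' z)%E by rewrite lee_fin mulr_ge0// pt_ge0.
have := mecke Hnu mW Wfin j.+1 mg' g'0.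
rewrite [LHS](eq_integral (fun xi => (pt j xi * addition muW g xi)%:E)); last first.
  move=> xi _.
  rewrite -bintZ; last exact: bmf_add1.
  rewrite bint_EFin; last by apply: bmfZ; exact: bmf_add1.
  have mg1 : measurable_fun setT (fun x => g (add_dirac xi x)).
    exact: (bmf_add1 xi bg).1.
  rewrite /mfrestr !ge0_integral_mrestr; last 4 first.
  - by apply/measurable_EFinP; exact: measurable_funM.
  - by move=> x; rewrite lee_fin mulr_ge0// pt_ge0.
  - apply: emeasurable_funM.
      exact: (measurableT_comp mg' (measurableT_comp measurable_adjoin (measurable_pair1 xi))).
    apply/measurable_EFinP.
    apply: (measurableT_comp (measurable_indic _) (measurable_add_dirac1 xi)).
    exact: measurable_few_points.
  - by move=> x; rewrite mule_ge0// lee_fin.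
  apply: eq_integral => x /set_mem Wx; rewrite /g' /= pt_add//.
  rewrite [in X in (_ * X)%E]indicE.
  have [xij|xij] := pselect (point_set j xi); last first.
    by rewrite indicE memNset// !mul0r mul0e.
  rewrite mem_set ?mule1//.
  by rewrite /few_points/= add_diracE xij diracE mem_set// -EFinD natr1.
rewrite [RHS](eq_integral (fun xi => (j.+1%:R * (pt j.+1 xi * g xi))%:E)); last first.
  move=> xi _; rewrite /g' /= integral_cst// window_kernelE setTI.
  have [xij|xij] := pselect (point_set j.+1 xi); last first.
    by rewrite indicE memNset// !mul0r mulr0 mul0e.
  have fxi : few_points W j.+1 xi by rewrite /few_points/= xij.
  rewrite xij [\1_(few_points _ _) _]indicE mem_set// mule1 -EFinM.
  by rewrite mulrC.
move=> H; rewrite -bintZ; last by apply: bmfM => //; exact: bmf_pt.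
by rewrite /Rintegral H.
Qed.

(** The Mecke equation on configurations with exactly [j] points before and [j + 1]
    points after the addition, each of which may be the added one. *)
Lemma mecke_point j g : bmf g ->
  \int[nu]_xi (pt j xi * addition muW g xi) =
  j.+1%:R * \int[nu]_xi (pt j.+1 xi * g xi).
Proof.
move=> bg; have [M bM] := bg.2.
have bM' : bmf (cst M : N -> R) by exact: bmf_cst.
have M0 : 0 <= M by exact: le_trans (bM point).
have e1 := mecke_point_ge0 j bM' (fun=> M0).
have bgM : bmf (fun xi => g xi + M) by exact: bmfD.
have gM0 xi : 0 <= g xi + M by have := bM xi; rewrite ler_norml => /andP[]; lra.
have e2 := mecke_point_ge0 j bgM gM0.
have bpt i (f : N -> R) : bmf f -> bmf (fun xi => pt i xi * f xi).
  by move=> bf; apply: bmfM => //; exact: bmf_pt.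
have -> : \int[nu]_xi (pt j.+1 xi * g xi) = \int[nu]_xi (pt j.+1 xi * (g xi + M)) -
    \int[nu]_xi (pt j.+1 xi * M).
  rewrite -bintB; [|exact: bpt..].
  by apply: eq_Rintegral => xi _; ring.
rewrite mulrBr -e2 -e1 -bintB; last 2 first.
- by apply: bpt; exact: bmf_addition.
- by apply: bpt; exact: bmf_addition.
apply: eq_Rintegral => xi _; rewrite additionD//; ring.
Qed.

Section iterated.
Variable h : R.
Local Notation q := (1 - h * m).

(** With this factorial normalisation [mecke_point] loses its coefficient,
    so that the iteration becomes the binomial formula. *)
Definition fact_moment j g := j`!%:R * \int[nu]_xi (pt j xi * g xi).

Lemma fact_moment_step j g : bmf g ->
  fact_moment j (step muW h g) = q * fact_moment j g + h * fact_moment j.+1 g.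
Proof.
move=> bg; rewrite /fact_moment factS natrM.
have b1 : bmf (fun xi => pt j xi * g xi) by apply: bmfM => //; exact: bmf_pt.
have b2 : bmf (fun xi => pt j xi * addition muW g xi).
  by apply: bmfM; [exact: bmf_pt|exact: bmf_addition].
have -> : \int[nu]_xi (pt j xi * step muW h g xi) =
    q * \int[nu]_xi (pt j xi * g xi) + h * \int[nu]_xi (pt j xi * addition muW g xi).
  rewrite -!bintZ// -bintD; [|exact: bmfZ..].
  by apply: eq_Rintegral => xi _; rewrite /step; ring.
rewrite mecke_point//; ring.
Qed.

(** Pascal's rule. *)
Lemma binomial_step (F : nat -> R) (k : nat) :
  \sum_(i < k.+2) 'C(k.+1, i)%:R * q ^+ (k.+1 - i) * h ^+ i * F i =
  q * (\sum_(i < k.+1) 'C(k, i)%:R * q ^+ (k - i) * h ^+ i * F i) +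
  h * (\sum_(i < k.+1) 'C(k, i)%:R * q ^+ (k - i) * h ^+ i * F i.+1).
Proof.
rewrite big_ord_recl /= bin0 subn0 expr0 mulr1 mul1r.
rewrite (eq_bigr (fun i : 'I_k.+1 => 'C(k, i.+1)%:R * q ^+ (k - i) * h ^+ i.+1 * F i.+1 +
    h * ('C(k, i)%:R * q ^+ (k - i) * h ^+ i * F i.+1))); last first.
  by move=> i _; rewrite /bump /= add1n subSS binS natrD exprS; ring.
rewrite big_split /= -mulr_sumr addrA; congr (_ + _).
rewrite big_ord_recr /= bin_small// !mul0r addr0.
rewrite [in RHS]big_ord_recl /= bin0 subn0 expr0 mulr1 mul1r mulrDr mulrA -exprS.
congr (_ + _); rewrite mulr_sumr; apply: eq_bigr => i _.
have -> : (k - i = (k - (bump 0 i)).+1)%N by rewrite /bump /= add1n subnSK.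
by rewrite /bump /= add1n exprS; ring.
Qed.

Lemma fact_moment_iter k j g : bmf g ->
  fact_moment j (iter k (step muW h) g) =
  \sum_(i < k.+1) 'C(k, i)%:R * q ^+ (k - i) * h ^+ i * fact_moment (j + i) g.
Proof.
move=> bg; elim: k j => [|k ih] j.
  by rewrite big_ord_recl big_ord0 /= bin0 subn0 expr0 expr0 addn0; ring.
rewrite iterS fact_moment_step; last exact: bmf_iter.
rewrite !ih (binomial_step (fun i => fact_moment (j + i) g)).
congr (_ + _ * _); apply: eq_bigr => i _.
by rewrite addSnnS.
Qed.

End iterated.

End point_weights.

Section poisson_limit.
Local Open Scope ring_scope.
Context {R : realType}.
Variable m : R.
Hypothesis m0 : 0 <= m.
Local Notation h n := (n.+1%:R^-1 : R).
Local Notation q n := (1 - h n * m).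

(** The binomial probability of [i] successes among [n + 1] trials of success
    probability [m / (n + 1)], divided by the Poisson probability of [i] with
    mean [m]; the powers of [m] are cancelled. *)
Definition rare_weight n i : R :=
  expR m * ('C(n.+1, i)%:R * q n ^+ (n.+1 - i) * h n ^+ i * i`!%:R).

Let h0 n : 0 <= h n. Proof. by rewrite invr_ge0. Qed.

Lemma rare_step_le1 n : m <= n.+1%:R -> h n * m <= 1.
Proof. by move=> mn; rewrite mulrC ler_pdivrMr// mul1r. Qed.

Lemma rare_weight_bound n i : m <= n.+1%:R -> 0 <= rare_weight n i <= expR m.
Proof.
move=> mn; have hm := rare_step_le1 mn.
have q0 : 0 <= q n by rewrite subr_ge0.
have q1 : q n <= 1 by rewrite gerBl mulr_ge0.
rewrite /rare_weight; apply/andP; split.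
  by rewrite mulr_ge0 ?expR_ge0// !mulr_ge0// exprn_ge0.
rewrite -[leRHS]mulr1; apply: ler_wpM2l; first exact: expR_ge0.
have -> : 'C(n.+1, i)%:R * q n ^+ (n.+1 - i) * h n ^+ i * i`!%:R =
  q n ^+ (n.+1 - i) * ((n.+1 ^_ i)%:R * h n ^+ i) by rewrite -bin_ffact natrM; ring.
rewrite mulr_ile1 ?exprn_ge0 ?mulr_ge0 ?exprn_ge0 ?exprn_ile1//.
rewrite exprVn ler_pdivrMr ?exprn_gt0// mul1r -natrX ler_nat.
elim: i => // i ih; rewrite ffactnSr expnSr leq_mul//.
by rewrite leq_subr.
Qed.

Lemma cvg_hn : (fun n => h n) @ \oo --> (0 : R).
Proof. exact: (@cvg_harmonic R). Qed.

Lemma cvg_qn : (fun n => q n) @ \oo --> (1 : R).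
Proof.
rewrite -[X in _ --> X]subr0; apply: cvgB; first exact: cvg_cst.
by rewrite -[X in _ --> X](mul0r m); apply: cvgM; [exact: cvg_hn|exact: cvg_cst].
Qed.

Lemma cvg_qV : (fun n => (q n)^-1) @ \oo --> (1 : R).
Proof.
by rewrite -[X in _ --> X]invr1; apply: cvgV; [exact: oner_neq0|exact: cvg_qn].
Qed.

(** Squeezed between the two estimates that [1 + x <= expR x] gives for
    [1 - m / (n + 1)] and for its inverse. *)
Lemma cvg_exp_power : (fun n => expR m * q n ^+ n.+1) @ \oo --> (1 : R).
Proof.
have qgt0 : \forall n \near \oo, 0 < q n.
  have := cvg_qn => /cvgr_gt; apply; exact: ltr01.
apply: (@squeeze_cvgr _ _ _ _ (fun n => expR (m - m / q n)) (cst 1)); last 2 first.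
- have c : (fun n => m - m / q n) @ \oo --> (0 : R).
    rewrite -[X in _ --> X](subrr m); apply: cvgB; first exact: cvg_cst.
    by rewrite -[X in _ --> X](mulr1 m); apply: cvgM; [exact: cvg_cst|exact: cvg_qV].
  by rewrite -[X in _ --> X](expR0 R); exact: (cvg_comp _ _ c (@continuous_expR R 0)).
- exact: cvg_cst.
near=> n.
have q0 : 0 < q n by near: n.
have e1 : n.+1%:R * (h n * m) = m by rewrite mulrA divff ?mul1r// pnatr_eq0.
apply/andP; split.
  rewrite expRD; apply: ler_wpM2l; first exact: expR_ge0.
  rewrite -{1}e1 -mulrA -mulrN expRM_natl; apply: lerXn2r.
  - by rewrite nnegrE expR_ge0.
  - by rewrite nnegrE ltW.
  rewrite expRN -[leRHS]invrK lef_pV2 ?posrE ?expR_gt0 ?invr_gt0//.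
  apply: le_trans (expR_ge1Dx _).
  rewrite le_eqVlt; apply/orP; left; apply/eqP.
  have qn0 : q n != 0 by rewrite gt_eqF.
  by apply: (mulIf qn0); rewrite mulVf// mulrDl mul1r divfK// subrK.
rewrite -[leRHS](expRxMexpNx_1 m); apply: ler_wpM2l; first exact: expR_ge0.
have -> : expR (- m) = expR (- (h n * m)) ^+ n.+1 by rewrite -expRM_natl mulrN e1.
apply: lerXn2r.
- by rewrite nnegrE ltW.
- by rewrite nnegrE expR_ge0.
exact: expR_ge1Dx.
Unshelve. all: by end_near. Qed.

Lemma cvg_ffact i : (fun n => (n.+1 ^_ i)%:R * h n ^+ i) @ \oo --> (1 : R).
Proof.
elim: i => [|i ih].
  by under eq_fun do rewrite ffactn0 expr0 mulr1; exact: cvg_cst.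
have e : \forall n \near \oo,
    ((n.+1 ^_ i)%:R * h n ^+ i) * (1 - i%:R * h n) = (n.+1 ^_ i.+1)%:R * h n ^+ i.+1.
  near=> n; rewrite ffactnSr natrM exprSr natrB; last first.
    by apply: leqW; near: n; exists i.
  have n0 : n.+1%:R != 0 :> R by rewrite pnatr_eq0.
  by rewrite mulrACA mulrBl divff.
suff : (fun n => ((n.+1 ^_ i)%:R * h n ^+ i) * (1 - i%:R * h n)) @ \oo --> (1 : R).
  by apply: cvg_trans; exact: near_eq_cvg e.
rewrite -[X in _ --> X]mulr1; apply: cvgM; first exact: ih.
rewrite -[X in _ --> X]subr0; apply: cvgB; first exact: cvg_cst.
by rewrite -[X in _ --> X](mulr0 i%:R); apply: cvgM; [exact: cvg_cst|exact: cvg_hn].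
Unshelve. all: by end_near. Qed.

(** The law of rare events. *)
Lemma cvg_rare_weight i : (fun n => rare_weight n i) @ \oo --> (1 : R).
Proof.
have qgt0 : \forall n \near \oo, 0 < q n.
  have := cvg_qn => /cvgr_gt; apply; exact: ltr01.
have e : \forall n \near \oo, (expR m * q n ^+ n.+1) * (q n)^-1 ^+ i *
    ((n.+1 ^_ i)%:R * h n ^+ i) = rare_weight n i.
  near=> n; have q0 : 0 < q n by near: n.
  have ni : (i <= n.+1)%N by apply: leqW; near: n; exists i.
  have e1 : q n ^+ n.+1 = q n ^+ (n.+1 - i) * q n ^+ i by rewrite -exprD subnK.
  rewrite /rare_weight -bin_ffact natrM e1.
  have -> : expR m * (q n ^+ (n.+1 - i) * q n ^+ i) * (q n)^-1 ^+ i =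
    expR m * q n ^+ (n.+1 - i).
    by rewrite -!mulrA -exprMn divff ?gt_eqF// expr1n mulr1.
  ring.
suff : (fun n => (expR m * q n ^+ n.+1) * (q n)^-1 ^+ i *
    ((n.+1 ^_ i)%:R * h n ^+ i)) @ \oo --> (1 : R).
  by apply: cvg_trans; exact: near_eq_cvg e.
rewrite -[X in _ --> X]mulr1; apply: cvgM; last exact: cvg_ffact.
rewrite -[X in _ --> X]mulr1; apply: cvgM; first exact: cvg_exp_power.
rewrite -[X in _ --> X](expr1n R i); elim: i {e} => [|i ih].
  by under eq_fun do rewrite expr0; exact: cvg_cst.
under eq_fun do rewrite exprS.
rewrite exprS; apply: cvgM => //.
exact: cvg_qV.
Unshelve. all: by end_near. Qed.

End poisson_limit.

Section window_entropy.
Local Open Scope ring_scope.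
Context {d} {X : measurableType d} {R : realType}.
Local Notation N := (counting_measure X R).
Variables (mu : {sigma_finite_measure set X -> \bar R}) (nu : probability N R).
Hypothesis Hnu : poisson_counts mu nu.
Variables (W : set X) (mW : measurable W) (Wfin : (mu W < +oo)%E).
Local Notation muW := (mfrestr mW Wfin).
Local Notation m := (fine (muW setT)).
Local Notation pt j := (\1_(point_set W j) : N -> R).
Implicit Type g : N -> R.

Let m0 : 0 <= m. Proof. by rewrite fine_ge0. Qed.

(** The density, with respect to the law of the process, of the configuration
    obtained by [n + 1] steps from an empty window. *)
Definition window_weight n (xi : N) : R :=
  \sum_(i < n.+2) rare_weight m n i * pt i xi.

Lemma bmf_window_weight n : bmf (window_weight n).
Proof. by apply: bmf_sum => i; apply: bmfZ; exact: bmf_pt. Qed.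

Lemma window_weight_moment n g : bmf g ->
  expR m * \int[nu]_xi (pt 0 xi * iter n.+1 (step muW n.+1%:R^-1) g xi) =
  \int[nu]_xi (window_weight n xi * g xi).
Proof.
move=> bg; have := fact_moment_iter Hnu mW Wfin n.+1%:R^-1 n.+1 0 bg.
rewrite {1}/fact_moment fact0 mul1r => ->.
rewrite mulr_sumr.
transitivity (\sum_(i < n.+2) \int[nu]_xi (rare_weight m n i * (pt i xi * g xi))).
  apply: eq_bigr => i _; rewrite bintZ; last by apply: bmfM => //; exact: bmf_pt.
  by rewrite /rare_weight /fact_moment add0n !mulrA.
rewrite -bint_sum; last by move=> i; apply: bmfZ; apply: bmfM => //; exact: bmf_pt.
apply: eq_Rintegral => xi _; rewrite /window_weight mulr_suml.
by apply: eq_bigr => i _; rewrite mulrA.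
Qed.

Lemma window_weightE n (xi : N) j : xi W = j%:R%:E ->
  window_weight n xi = if (j < n.+2)%N then rare_weight m n j else 0.
Proof.
move=> xij; have pE i : pt i xi = (i == j)%:R.
  rewrite indicE; congr (_%:R); apply: congr1; apply/idP/eqP; rewrite inE /point_set/= xij.
    by move=> -[/eqP]; rewrite eqr_nat => /eqP.
  by move=> ->.
case: ifPn => jn.
  rewrite /window_weight (bigD1 (Ordinal jn))//= pE eqxx mulr1 big1 ?addr0// => i ij.
  rewrite pE; case: eqP => [e|]; last by rewrite mulr0.
  by move/eqP : ij => []; apply: ord_inj.
rewrite /window_weight big1// => i _; rewrite pE; case: eqP => [e|]; last by rewrite mulr0.
by move: jn; rewrite -e ltn_ord.
Qed.

Lemma window_weight_infty n (xi : N) : xi W = +oo%E -> window_weight n xi = 0.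
Proof.
move=> xio; rewrite /window_weight big1// => i _.
by rewrite indicE memNset ?mulr0// /point_set /= xio.
Qed.

Lemma window_weight_bound n (xi : N) : m <= n.+1%:R -> 0 <= window_weight n xi <= expR m.
Proof.
move=> mn; have [xio|[j xij]] := counting_measure_integer xi mW.
  by rewrite window_weight_infty// lexx expR_ge0.
rewrite (window_weightE n xij); case: ifPn => _; first exact: rare_weight_bound.
by rewrite lexx expR_ge0.
Qed.

(** From this index on the steps have success probability at most 1. *)
Definition weight_start := (Num.truncn m).+1.

Lemma weight_start_le n : m <= (n + weight_start).+1%:R.
Proof.
have /andP[_ /ltW h] := truncn_itv m0.
by rewrite (le_trans h)// ler_nat leqW// leq_addl.
Qed.

(** Dominated convergence, the densities being bounded by [expR m]. *)
Lemma cvg_window_weight g : bmf g ->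
  (fun n => \int[nu]_xi (window_weight (n + weight_start) xi * g xi)) @ \oo -->
  \int[nu]_xi g xi.
Proof.
move=> bg; have [M bM] := bg.2.
have bw n : bmf (fun xi => window_weight n xi * g xi).
  by apply: bmfM => //; exact: bmf_window_weight.
pose f_ n xi := (window_weight (n + weight_start) xi * g xi)%:E.
have M0 : 0 <= M by exact: le_trans (bM point).
have mf n : measurable_fun setT (f_ n) by apply/measurable_EFinP; exact: (bw _).1.
have mg : measurable_fun setT (EFin \o g) by apply/measurable_EFinP; exact: bg.1.
have cf : {ae nu, forall xi, setT xi -> f_ ^~ xi @ \oo --> (EFin \o g) xi}.
  exists (~` \bigcup_k few_points W k); split.
  + by apply: measurableC; apply: bigcup_measurable => k _; exact: measurable_few_points.
  + exact: (finite_points Hnu mW Wfin).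
  + apply: subsetC => xi [k _ fxi] _; apply: cvg_EFin; first exact: nearW.
    have [xio|[j xij]] := counting_measure_integer xi mW.
      by move: fxi; rewrite /few_points/= xio.
    rewrite -[X in _ --> X]mul1r; apply: cvgM; last exact: cvg_cst.
    have e : \forall n \near \oo, rare_weight m (n + weight_start) j =
        window_weight (n + weight_start) xi.
      near=> n; rewrite (window_weightE _ xij) ifT//.
      have jn : (j <= n)%N by near: n; exists j.
      by rewrite ltnS (leq_trans jn)// leqW// leq_addr.
    suff : (fun n => rare_weight m (n + weight_start) j) @ \oo --> (1 : R).
      by apply: cvg_trans; exact: near_eq_cvg e.
    rewrite (cvg_shiftn weight_start (fun n => rare_weight m n j)).
    exact: cvg_rare_weight.
have ig : nu.-integrable setT (cst (expR m * M)%:E).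
  exact: (bmf_integrable nu (bmf_cst (expR m * M))).
have df : {ae nu, forall xi n, setT xi -> (`|f_ n xi| <= cst (expR m * M)%:E xi)%E}.
  apply: aeW => xi n _; rewrite /f_ lee_fin normrM.
  have /andP[w0 w1] := window_weight_bound xi (weight_start_le n).
  by apply: ler_pM => //; rewrite ger0_norm.
have [_ _ key] := dominated_convergence measurableT mf mg cf ig df.
rewrite /Rintegral.
apply: fine_cvg; rewrite fineK; first exact: key.
by apply: integrable_fin_num => //; exact: bmf_integrable.
Unshelve. all: by end_near. Qed.

End window_entropy.

(** * Entropy of functions depending on a window *)

Section local_entropy.
Local Open Scope ring_scope.
Context {d} {X : measurableType d} {R : realType}.
Local Notation N := (counting_measure X R).
Variables (mu : {sigma_finite_measure set X -> \bar R}) (nu : probability N R).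
Hypothesis Hnu : poisson_counts mu nu.
Variables (W : set X) (mW : measurable W) (Wfin : (mu W < +oo)%E).
Local Notation muW := (mfrestr mW Wfin).
Local Notation m := (fine (muW setT)).
Local Notation pt := (\1_(point_set W 0) : N -> R).
Local Notation Ex g := (\int[nu]_xi g xi).
Variables (a b : R) (a0 : 0 < a) (Z Z' : N -> R).
Hypotheses (mZ : measurable_fun setT Z) (Zab : forall z, a <= Z z <= b).
Hypotheses (bZ' : bmf Z') (lZ' : local W Z').

Let m0 : 0 <= m. Proof. by rewrite fine_ge0. Qed.

Lemma mass_empty : expR m * \int[nu]_xi pt xi = 1.
Proof.
have -> : \int[nu]_xi pt xi = poisson_weight m 0.
  rewrite /Rintegral integral_indic ?setIT//; last exact: measurable_point_set.
  apply: (etrans (congr1 fine (measure_point_count Hnu mW Wfin 0))) => /=.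
  by rewrite /mfrestr /mrestr setTI.
by rewrite /poisson_weight expr0 fact0 divr1 mul1r expRxMexpNx_1.
Qed.

Lemma bint_mean_itv (g : N -> R) : bmf g -> (forall z, a <= g z <= b) ->
  a <= Ex g <= b.
Proof.
move=> bg gab.
have nT : fine (nu setT) = 1 by rewrite (_ : nu setT = 1%E)//; exact: probability_setT.
apply/andP; split.
  rewrite -[leLHS]mulr1 -nT -bint_cst; apply: bint_le => //; first exact: bmf_cst.
  by move=> z; have /andP[] := gab z.
rewrite -[leRHS]mulr1 -nT -bint_cst; apply: bint_le => //; first exact: bmf_cst.
by move=> z; have /andP[] := gab z.
Qed.

(** A Lipschitz constant of [phi_ent] on the interval from [a] to [b]. *)
Definition phi_lip : R := 1 + `|ln a| + `|ln b|.

Lemma phi_ent_lip u v : a <= u <= b -> a <= v <= b ->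
  phi_ent u <= phi_ent v + phi_lip * `|u - v|.
Proof.
move=> /andP[au ub] /andP[av vb].
have u0 : 0 < u by exact: lt_le_trans au.
have v0 : 0 < v by exact: lt_le_trans av.
have b0 : 0 < b by exact: lt_le_trans ub.
have := phi_ent_tangent u0 v0.
have la : ln a <= ln u by rewrite ler_ln ?posrE.
have lb : ln u <= ln b by rewrite ler_ln ?posrE.
suff : (1 + ln u) * (u - v) <= phi_lip * `|u - v| by lra.
rewrite (le_trans (ler_norm _))// normrM ler_wpM2r//.
rewrite (le_trans (ler_normD _ _))// normr1 /phi_lip -addrA lerD2l.
have := ler_norm (- ln a); rewrite normrN => na; have nb := ler_norm (ln b).
have na0 := normr_ge0 (ln a); have nb0 := normr_ge0 (ln b).
by rewrite ler_norml; apply/andP; split; lra.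
Qed.

Let bZ : bmf Z. Proof. exact: bmf_itv Zab. Qed.
Let bP : bmf (phi_ent \o Z). Proof. exact: (bmf_phi_ent a0 mZ Zab). Qed.
Let bG : bmf (gain muW Z). Proof. exact: (bmf_gain muW a0 mZ Zab). Qed.
Let bD : bmf (fun z => `|Z z - Z' z|). Proof. by apply: bmf_norm; exact: bmfB. Qed.
Let bpt : bmf pt. Proof. exact: bmf_pt. Qed.

Lemma iter_norm_sub (h : R) k xi : 0 <= h -> h * m <= 1 ->
  `|iter k (step muW h) Z xi - iter k (step muW h) Z' xi| <=
  iter k (step muW h) (fun z => `|Z z - Z' z|) xi.
Proof.
move=> h0 hm; rewrite -iterB// ler_norml; apply/andP; split.
  rewrite lerNl; have -> : - iter k (step muW h) (fun z => Z z - Z' z) xi =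
      iter k (step muW h) (fun z => Z' z - Z z) xi by rewrite !iterB//; ring.
  apply: iter_le => //; first exact: bmfB.
  by move=> z; rewrite distrC ler_norm.
by apply: iter_le => //; [exact: bmfB|move=> z; exact: ler_norm].
Qed.

(** [entropy_iter] is integrated over the configurations with an empty window. There
    the iterates of the local function [Z'] are constant, equal to a weighted
    mean of [Z'], so replacing [Z] by [Z'] inside [phi_ent] costs only a multiple
    of the distance between them. *)
Lemma weighted_entropy n : m <= n.+1%:R -> m < n.+1%:R ->
  \int[nu]_xi (window_weight mW Wfin n xi * phi_ent (Z xi)) <=
  phi_ent (Ex Z) + phi_lip * `|\int[nu]_xi (window_weight mW Wfin n xi * Z' xi) - Ex Z|
  + phi_lip * \int[nu]_xi (window_weight mW Wfin n xi * `|Z xi - Z' xi|)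
  + (1 - n.+1%:R^-1 * m)^-1 * \int[nu]_xi (window_weight mW Wfin n xi * gain muW Z xi).
Proof.
move=> mn mn'; set w := window_weight mW Wfin n.
set h : R := n.+1%:R^-1; set S := step muW h.
have h0 : 0 <= h by rewrite invr_ge0.
have hm : h * m <= 1 by exact: rare_step_le1.
have q0 : 0 < 1 - h * m.
  by rewrite subr_gt0 /h mulrC ltr_pdivrMr// mul1r.
have nh : n.+1%:R * h = 1 by rewrite divff// pnatr_eq0.
pose kap := iter n.+1 S Z' point.
have kapE xi : pt xi * iter n.+1 S Z' xi = pt xi * kap.
  have [x0|x0] := pselect (point_set W 0 xi); last first.
    by rewrite indicE memNset// !mul0r.
  congr (_ * _); apply: (local_iter _ _ _ lZ'); exact: agree_on_empty.
have kapM : kap = \int[nu]_xi (w xi * Z' xi).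
  rewrite /w -(window_weight_moment Hnu)//.
  under eq_Rintegral do rewrite kapE mulrC.
  by rewrite bintZ// mulrCA mass_empty mulr1.
have bI g : bmf g -> bmf (fun xi => pt xi * iter n.+1 S g xi).
  by move=> bg; apply: bmfM => //; exact: bmf_iter.
have EZab := bint_mean_itv bZ Zab.
(* Without points in the window the iterate of Z' equals kap. *)
have pointwise xi : pt xi * iter n.+1 S (phi_ent \o Z) xi <=
    (phi_ent (Ex Z) + phi_lip * `|kap - Ex Z|) * pt xi +
    (phi_lip * (pt xi * iter n.+1 S (fun z => `|Z z - Z' z|) xi) +
    (1 - h * m)^-1 * (pt xi * iter n.+1 S (gain muW Z) xi)).
  have [x0|x0] := pselect (point_set W 0 xi); last first.
    by rewrite indicE memNset// !mul0r !mulr0 !addr0.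
  have := kapE xi; rewrite indicE mem_set// !mul1r mulr1 => kapxi.
  have e1 := entropy_iter h0 hm a0 mZ Zab n xi; rewrite nh mul1r -/S in e1.
  have e2 : iter n S (gain muW Z) xi <= (1 - h * m)^-1 * iter n.+1 S (gain muW Z) xi.
    rewrite mulrC ler_pdivlMr// mulrC iterS {2}/S /step lerDl mulr_ge0//.
    apply: addition_ge0 => z; apply: (@le_trans _ _ (iter n S (cst 0) z)).
      by rewrite /S iter_cst.
    apply: iter_le => //; first exact: bmf_cst.
    by move=> y; exact: (gain_ge0 muW a0 Zab).
  have Iab : a <= iter n.+1 S Z xi <= b by exact: iter_itv.
  have e3 := phi_ent_lip Iab EZab.
  have e4 : `|iter n.+1 S Z xi - Ex Z| <=
      iter n.+1 S (fun z => `|Z z - Z' z|) xi + `|kap - Ex Z|.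
    rewrite -kapxi; apply: (@le_trans _ _ (`|iter n.+1 S Z xi - iter n.+1 S Z' xi| +
        `|iter n.+1 S Z' xi - Ex Z|)); first exact: ler_distD.
    by rewrite lerD2r; exact: iter_norm_sub.
  have L0 : 0 <= phi_lip by rewrite !addr_ge0.
  have e5 := ler_wpM2l L0 e4.
  lra.
have bc : bmf (fun xi => (phi_ent (Ex Z) + phi_lip * `|kap - Ex Z|) * pt xi) by exact: bmfZ.
have b2 : bmf (fun xi => phi_lip * (pt xi * iter n.+1 S (fun z => `|Z z - Z' z|) xi)).
  by apply: bmfZ; exact: bI.
have b3 : bmf (fun xi => (1 - h * m)^-1 * (pt xi * iter n.+1 S (gain muW Z) xi)).
  by apply: bmfZ; exact: bI.
have := bint_le nu (bI _ bP) (bmfD bc (bmfD b2 b3)) pointwise.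
rewrite bintD//; last exact: bmfD.
rewrite bintD// !bintZ//; [|exact: bI..].
rewrite -(ler_pM2l (expR_gt0 m)) (window_weight_moment Hnu)// mulrDr mulrDr.
rewrite !(mulrCA (expR m)) mass_empty mulr1 !(window_weight_moment Hnu)//.
by rewrite -kapM addrA.
Qed.

(** The limit of [weighted_entropy] as the number of steps grows. *)
Lemma local_entropy :
  Ex (phi_ent \o Z) <= phi_ent (Ex Z) + Ex (gain muW Z) +
    2 * phi_lip * Ex (fun z => `|Z z - Z' z|).
Proof.
set s := weight_start mW Wfin.
pose w n := window_weight mW Wfin (n + s).
have lt_s n : m < (n + s).+1%:R.
  have /andP[_ h] := truncn_itv m0.
  by rewrite (lt_le_trans h)// ler_nat leqW// leq_addl.
pose rhs n := phi_ent (Ex Z) + phi_lip * `|\int[nu]_xi (w n xi * Z' xi) - Ex Z|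
  + phi_lip * \int[nu]_xi (w n xi * `|Z xi - Z' xi|)
  + (1 - (n + s).+1%:R^-1 * m)^-1 * \int[nu]_xi (w n xi * gain muW Z xi).
have le_n n : \int[nu]_xi (w n xi * phi_ent (Z xi)) <= rhs n.
  by apply: weighted_entropy => //; exact: ltW.
have cl : (fun n => \int[nu]_xi (w n xi * phi_ent (Z xi))) @ \oo --> Ex (phi_ent \o Z).
  exact: (cvg_window_weight Hnu mW Wfin bP).
have cr : rhs @ \oo --> phi_ent (Ex Z) + phi_lip * `|Ex Z' - Ex Z|
    + phi_lip * Ex (fun z => `|Z z - Z' z|) + 1 * Ex (gain muW Z).
  apply: cvgD; last first.
    apply: cvgM; last exact: (cvg_window_weight Hnu mW Wfin bG).
    by rewrite (cvg_shiftn s (fun n => (1 - n.+1%:R^-1 * m)^-1)); exact: cvg_qV.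
  apply: cvgD; last first.
    by apply: cvgM; [exact: cvg_cst|exact: (cvg_window_weight Hnu mW Wfin bD)].
  apply: cvgD; first exact: cvg_cst.
  apply: cvgM; first exact: cvg_cst.
  apply: cvg_norm; apply: cvgB; last exact: cvg_cst.
  exact: (cvg_window_weight Hnu mW Wfin bZ').
have le_lim : Ex (phi_ent \o Z) <= phi_ent (Ex Z) + phi_lip * `|Ex Z' - Ex Z|
    + phi_lip * Ex (fun z => `|Z z - Z' z|) + 1 * Ex (gain muW Z).
  by apply: (ler_cvg_to cl cr); apply: nearW => n; exact: le_n.
have EZZ : `|Ex Z' - Ex Z| <= Ex (fun z => `|Z z - Z' z|).
  rewrite distrC -bintB//; apply: le_normr_Rintegral => //.
  by apply: bmf_integrable; exact: bmfB.
have L0 : 0 <= phi_lip by rewrite !addr_ge0.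
have := ler_wpM2l L0 EZZ; lra.
Qed.

End local_entropy.

(** * Approximation by functions of finite windows *)

Section local_approximation.
Local Open Scope ring_scope.
Context {d} {X : measurableType d} {R : realType}.
Local Notation N := (counting_measure X R).
Variables (nu : probability N R) (W : (set X)^nat).
Hypotheses (mW : forall j, measurable (W j)) (ndW : nondecreasing_seq W)
  (WT : \bigcup_j W j = setT).
Local Notation Ex g := (\int[nu]_xi g xi).
Implicit Type g : N -> R.

Definition locally_approximable g := bmf g /\ forall e, 0 < e ->
  exists j g', [/\ bmf g', local (W j) g' & Ex (fun xi => `|g xi - g' xi|) <= e].

Lemma local_le i j g : (i <= j)%N -> local (W i) g -> local (W j) g.
Proof.
move=> ij lg xi zeta xz; apply: lg => B mB BW; apply: xz => //.
by apply: subset_trans BW _; exact/subsetPset/ndW.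
Qed.

Let bdist g1 g2 : bmf g1 -> bmf g2 -> bmf (fun xi => `|g1 xi - g2 xi|).
Proof. by move=> b1 b2; apply: bmf_norm; exact: bmfB. Qed.

Lemma approx_lim g : bmf g ->
  (forall e, 0 < e -> exists g1, locally_approximable g1 /\
     Ex (fun xi => `|g xi - g1 xi|) <= e) -> locally_approximable g.
Proof.
move=> bg H; split => // e e0; have e20 : 0 < e / 2 by rewrite divr_gt0.
have [g1 [[b1 h1] le1]] := H _ e20.
have [j [g' [bg' lg' le2]]] := h1 _ e20.
exists j, g'; split => //; rewrite [leRHS]splitr.
apply: le_trans (lerD le1 le2); rewrite -bintD; [|exact: bdist..].
by apply: bint_le; [exact: bdist|apply: bmfD; exact: bdist|move=> z; exact: ler_distD].
Qed.

Lemma approx_cst c : locally_approximable (cst c).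
Proof.
split; first exact: bmf_cst.
move=> e e0; exists 0%N, (cst c); split => //; first exact: bmf_cst.
under eq_Rintegral do rewrite subrr normr0.
by rewrite bint_cst mul0r ltW.
Qed.

Lemma approxD g1 g2 : locally_approximable g1 -> locally_approximable g2 ->
  locally_approximable (fun xi => g1 xi + g2 xi).
Proof.
move=> [b1 h1] [b2 h2]; split; first exact: bmfD.
move=> e e0; have e20 : 0 < e / 2 by rewrite divr_gt0.
have [j1 [f1 [c1 l1 le1]]] := h1 _ e20; have [j2 [f2 [c2 l2 le2]]] := h2 _ e20.
exists (maxn j1 j2), (fun xi => f1 xi + f2 xi); split; first exact: bmfD.
  move=> xi zeta xz; congr (_ + _).
    by apply: (local_le (leq_maxl j1 j2)).
  by apply: (local_le (leq_maxr j1 j2)).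
rewrite [leRHS]splitr; apply: le_trans (lerD le1 le2).
rewrite -bintD; [|exact: bdist..]; apply: bint_le.
- by apply: bdist; exact: bmfD.
- by apply: bmfD; exact: bdist.
move=> z; have -> : g1 z + g2 z - (f1 z + f2 z) = (g1 z - f1 z) + (g2 z - f2 z) by ring.
exact: ler_normD.
Qed.

Lemma approxM g1 g2 : locally_approximable g1 -> locally_approximable g2 ->
  locally_approximable (fun xi => g1 xi * g2 xi).
Proof.
move=> [b1 h1] [b2 h2]; split; first exact: bmfM.
move=> e e0; have e20 : 0 < e / 2 by rewrite divr_gt0.
have [M2 bM2] := b2.2.
have M20 : 0 <= M2 by exact: le_trans (bM2 point).
have M2p : 0 < M2 + 1 by rewrite ltr_wpDl.
have [j1 [f1 [c1 l1 le1]]] := h1 (e / 2 / (M2 + 1)) (divr_gt0 e20 M2p).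
have [M1 bM1] := c1.2.
have M10 : 0 <= M1 by exact: le_trans (bM1 point).
have M1p : 0 < M1 + 1 by rewrite ltr_wpDl.
have [j2 [f2 [c2 l2 le2]]] := h2 (e / 2 / (M1 + 1)) (divr_gt0 e20 M1p).
exists (maxn j1 j2), (fun xi => f1 xi * f2 xi); split; first exact: bmfM.
  move=> xi zeta xz; congr (_ * _).
    by apply: (local_le (leq_maxl j1 j2)).
  by apply: (local_le (leq_maxr j1 j2)).
have bd1 : bmf (fun xi => (M2 + 1) * `|g1 xi - f1 xi|) by apply: bmfZ; exact: bdist.
have bd2 : bmf (fun xi => (M1 + 1) * `|g2 xi - f2 xi|) by apply: bmfZ; exact: bdist.
apply: (@le_trans _ _ (Ex (fun xi => (M2 + 1) * `|g1 xi - f1 xi| +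
    (M1 + 1) * `|g2 xi - f2 xi|))).
  apply: bint_le; [by apply: bdist; exact: bmfM|exact: bmfD|].
  move=> z; have -> : g1 z * g2 z - f1 z * f2 z =
      g2 z * (g1 z - f1 z) + f1 z * (g2 z - f2 z) by ring.
  rewrite (le_trans (ler_normD _ _))// !normrM lerD// ler_wpM2r//.
    by rewrite (le_trans (bM2 z))// lerDl.
  by rewrite (le_trans (bM1 z))// lerDl.
rewrite bintD// !bintZ; [|exact: bdist..]; rewrite [leRHS]splitr; apply: lerD.
  by rewrite mulrC -ler_pdivlMr.
by rewrite mulrC -ler_pdivlMr.
Qed.

Lemma approxZ c g : locally_approximable g -> locally_approximable (fun xi => c * g xi).
Proof. by move=> ag; apply: approxM => //; exact: approx_cst. Qed.

Lemma approx_sum (I : Type) (s : seq I) (F : I -> N -> R) :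
  (forall i, locally_approximable (F i)) ->
  locally_approximable (fun xi => \sum_(i <- s) F i xi).
Proof.
move=> aF; elim: s => [|i s ih].
  by under eq_fun do rewrite big_nil; exact: approx_cst.
by under eq_fun do rewrite big_cons; exact: approxD.
Qed.

(** These sets form a sigma-algebra containing the events that generate the
    space of counting measures. *)
Definition approx_sets : set (set N) :=
  [set A | measurable A /\ locally_approximable (\1_A)].

Lemma approx_setsC A : approx_sets A -> approx_sets (~` A).
Proof.
move=> [mA aA]; split; first exact: measurableC.
have -> : \1_(~` A) = (fun xi => 1 + (-1) * \1_A xi) :> (N -> R).
  apply/funext => xi; rewrite !indicE in_setC mulN1r.
  by case: (xi \in A); rewrite ?subrr ?subr0.
by apply: approxD; [exact: approx_cst|exact: approxZ].
Qed.

Lemma approx_setsU A B : approx_sets A -> approx_sets B -> approx_sets (A `|` B).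
Proof.
move=> hA hB; rewrite -[A `|` B]setCK setCU; apply: approx_setsC.
have [mA aA] := approx_setsC hA; have [mB aB] := approx_setsC hB.
split; first exact: measurableI.
by rewrite indicI; exact: approxM.
Qed.

Lemma approx_sets_bigcup (F : (set N)^nat) : (forall i, approx_sets (F i)) ->
  approx_sets (\bigcup_i F i).
Proof.
move=> aF; have mU : measurable (\bigcup_i F i).
  by apply: bigcup_measurable => i _; exact: (aF i).1.
split => //; pose U n := \big[setU/set0]_(i < n) F i.
have aU n : approx_sets (U n).
  rewrite /U; elim: n => [|n ih].
    rewrite big_ord0; split; first exact: measurable0.
    by rewrite indic0; exact: approx_cst.
  by rewrite big_ord_recr; exact: approx_setsU.
have UF : \bigcup_n U n = \bigcup_i F i.
  apply/seteqP; split => [x [n _]|x [i _ Fx]].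
    by rewrite /U -bigcup_mkord => -[i _ Fx]; exists i.
  by exists i.+1 => //; rewrite /U -bigcup_mkord; exists i => //=.
have cvU : (nu \o U) @ \oo --> nu (\bigcup_i F i).
  rewrite -UF; apply: nondecreasing_cvg_mu.
  - by move=> n; exact: (aU n).1.
  - by rewrite UF.
  - by move=> n k nk; apply/subsetPset; exact: subset_bigsetU.
apply: approx_lim; first exact: bmf_indic.
move=> e e0.
have fU A : measurable A -> nu A \is a fin_num by move=> mA; exact: fin_num_measure.
have cvE : (fun n => Ex (\1_(U n))) @ \oo --> Ex (\1_(\bigcup_i F i)).
  have E1 A : measurable A -> Ex (\1_A) = fine (nu A).
    by move=> mA; rewrite /Rintegral integral_indic ?setIT//.
  have -> : (fun n => Ex (\1_(U n))) = (fun n => fine (nu (U n))).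
    by apply/funext => n; apply: E1; exact: (aU n).1.
  rewrite E1//.
  by apply: fine_cvg; rewrite fineK ?fU.
have [n _ /(_ n (leqnn n))] := (cvgrPdist_le _ _).1 cvE e e0.
move=> len; exists (\1_(U n)); split; first exact: (aU n).2.
have bU : bmf (\1_(U n) : N -> R) by apply: bmf_indic; exact: (aU n).1.
have bF : bmf (\1_(\bigcup_i F i) : N -> R) by exact: bmf_indic.
apply: le_trans len; rewrite -bintB//; apply: le_trans (ler_norm _).
rewrite le_eqVlt; apply/orP; left; apply/eqP; apply: eq_Rintegral => xi _.
rewrite ger0_norm// subr_ge0 !indicE ler_nat.
case: (boolP (xi \in U n)) => // /set_mem xU; rewrite mem_set//.
by rewrite -UF; exists n.
Qed.

Lemma measurable_approx_sets A : measurable A -> approx_sets A.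
Proof.
have sG : sigma_algebra setT approx_sets.
  split.
  - by split; [exact: measurable0|rewrite indic0; exact: approx_cst].
  - by move=> B; rewrite setTD; exact: approx_setsC.
  - exact: approx_sets_bigcup.
pose T := g_sigma_algebraType approx_sets.
have mT (B : set T) : measurable B = approx_sets B.
  by rewrite /measurable/= sigma_algebra_id.
have idm : measurable_fun setT (id : T -> N).
  apply: measurable_fun_counting => B mB.
  apply: (emeasurable_fun_cvg (fun n (xi : T) => (xi : N) (B `&` W n))).
    move=> n _ Y mY; rewrite setTI mT.
    have mBW : measurable (B `&` W n) by exact: measurableI.
    have mE : measurable ((fun xi : N => xi (B `&` W n)) @^-1` Y).
      by rewrite -[X in measurable X]setTI; exact: measurable_eval.
    split => //; split; first exact: bmf_indic.
    move=> e e0; exists n, (\1_((fun xi : N => xi (B `&` W n)) @^-1` Y)); split.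
    - exact: bmf_indic.
    - move=> xi zeta xz; rewrite !indicE; congr (_%:R); apply: congr1.
      by apply/idP/idP; rewrite !inE /= xz.
    - under eq_Rintegral do rewrite subrr normr0.
      by rewrite bint_cst mul0r ltW.
  move=> xi _; have {2}-> : B = \bigcup_n (B `&` W n) by rewrite -setI_bigcupr WT setIT.
  apply: nondecreasing_cvg_mu.
  - by move=> n; exact: measurableI.
  - by apply: bigcup_measurable => n _; exact: measurableI.
  - by move=> n k nk; apply/subsetPset; apply: setIS; exact/subsetPset/ndW.
move=> mA; have := idm measurableT A mA.
by rewrite setTI mT.
Qed.

Import HBSimple.

(** Simple functions are dense in [L^1]. *)
Lemma bmf_approximable g : bmf g -> locally_approximable g.
Proof.
move=> bg; apply: approx_lim => // e e0.
have [g_ [ig _ cg]] := approximation_sfun_integrable measurableT (bmf_integrable nu bg).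
have cf : (fun n => fine (\int[nu]_z `|(g z)%:E - (g_ n z)%:E|)%E) @ \oo --> (0 : R).
  exact: (fine_cvg cg).
have [n _ /(_ n (leqnn n)) /=] := (cvgrPdist_le _ _).1 cf e e0.
rewrite sub0r normrN => /(le_trans (ler_norm _)) len.
exists (g_ n); split; last exact: len.
have -> : (g_ n : N -> R) = (fun xi => \sum_(y <- finmap.enum_fset (fset_set (range (g_ n))))
    (y * \1_(g_ n @^-1` [set y]) xi)).
  by apply/funext => xi; rewrite fimfunE fsbig_finite.
apply: approx_sum => y; apply: approxZ.
by have [] := @measurable_approx_sets (g_ n @^-1` [set y]) _.
Qed.

Lemma local_approximation g e : bmf g -> 0 < e ->
  exists j g', [/\ bmf g', local (W j) g' & Ex (fun xi => `|g xi - g' xi|) <= e].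
Proof. by move=> bg; apply: (bmf_approximable bg).2. Qed.

End local_approximation.

(** * The entropy inequality for exponentials *)

Section gain_bound.
Local Open Scope ring_scope.
Context {R : realType}.

Lemma expR_quarter_le (y : R) : 0 <= y -> 1 - 3 / 4 * y ^+ 2 <= (1 + y) * expR (- y).
Proof.
move=> y0; have [y2|y2] := leP 2 y.
  apply: (@le_trans _ _ 0); first by nra.
  by rewrite mulr_ge0 ?expR_ge0// addr_ge0.
have -> : expR (- y) = expR (- (y / 2)) ^+ 2 by rewrite -expRM_natl; congr expR; field.
have := expR_ge1Dx (- (y / 2)); set e := expR _ => h.
have e2 : (1 - y / 2) ^+ 2 <= e ^+ 2 by apply: lerXn2r => //; rewrite nnegrE ?expR_ge0//; lra.
apply: (@le_trans _ _ ((1 + y) * (1 - y / 2) ^+ 2)); last by apply: ler_wpM2l => //; lra.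
by rewrite !expr2; nra.
Qed.

Lemma expR_neg_le (y : R) : 0 <= y -> y - 1 + expR (- y) <= 3 / 4 * y ^+ 2.
Proof.
move=> y0.
have -> : expR (- y) = (expR (y / 2) ^+ 2)^-1.
  by rewrite -expRM_natl expRN; congr (expR _)^-1; field.
have := expR_ge1Dx (y / 2); set e := expR _ => h.
have e0 : 0 < 1 + y / 2 by lra.
have e2 : (1 + y / 2) ^+ 2 <= e ^+ 2 by apply: lerXn2r => //; rewrite nnegrE ?expR_ge0//; lra.
have : (e ^+ 2)^-1 <= ((1 + y / 2) ^+ 2)^-1.
  by rewrite lef_pV2 ?posrE ?exprn_gt0// expR_gt0.
suff : ((1 + y / 2) ^+ 2)^-1 <= 1 - y + 3 / 4 * y ^+ 2 by lra.
rewrite -[leLHS]mul1r ler_pdivrMr ?exprn_gt0// !expr2.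
have y2 : 0 <= y * y by rewrite mulr_ge0.
have y3 : 0 <= y * y * y by rewrite mulr_ge0.
have y4 : 0 <= y * y * y * y by rewrite mulr_ge0.
lra.
Qed.

(** With [y] the absolute difference of the exponents, one of the two scalar
    inequalities above applies, according to its sign. *)
Lemma bregman_exp_le (u v : R) :
  bregman (expR v) (expR u) <=
  3 / 4 * (expR u * neg_part (v - u) ^+ 2) + 3 / 4 * (expR v * pos_part (v - u) ^+ 2).
Proof.
rewrite /bregman !expRK /neg_part /pos_part; have [uv|vu] := leP 0 (v - u).
  rewrite expr0n /= !mulr0 add0r.
  have h := ler_wpM2l (expR_ge0 v) (expR_neg_le uv).
  have e : expR v * expR (- (v - u)) = expR u by rewrite -expRD; congr expR; ring.
  by move: h; rewrite mulrDr e; lra.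
rewrite expr0n /= !mulr0 addr0.
have uv : 0 <= u - v by rewrite subr_ge0 -subr_le0 ltW.
have h := ler_wpM2l (expR_ge0 u) (expR_quarter_le uv).
have e : expR u * expR (- (u - v)) = expR v by rewrite -expRD; congr expR; ring.
have -> : (v - u) ^+ 2 = (u - v) ^+ 2 by rewrite -sqrrN opprB.
move: h; rewrite [expR u * ((1 + _) * _)]mulrCA e; lra.
Qed.

End gain_bound.

Section entropy_inequality.
Local Open Scope ring_scope.
Context {d} {X : measurableType d} {R : realType}.
Local Notation N := (counting_measure X R).
Context {dO} {Omega : measurableType dO} (P : probability Omega R).
Variables (mu : {sigma_finite_measure set X -> \bar R}) (eta : {mfun Omega >-> N}).
Local Notation nu := (distribution P eta).
Hypothesis Hnu : poisson_counts mu nu.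
Local Notation Ex g := (\int[nu]_xi g xi).
Variables (f f1 : N -> R) (L : R).
Hypotheses (mf : measurable_fun setT f) (bf1 : bmf f1) (L0 : 0 <= L).
Hypothesis f1f : forall a b,
  pos_part (f1 a - f1 b) ^+ 2 <= pos_part (f a - f b) ^+ 2 /\
  neg_part (f1 a - f1 b) ^+ 2 <= neg_part (f a - f b) ^+ 2.
Hypothesis Hadd : {ae P, forall w,
  (\int[mu]_x (neg_part (difference f (eta w) x) ^+ 2)%:E <= L%:E)%E}.
Hypothesis Hrem : {ae P, forall w,
  (\int[eta w]_x removal_sq pos_part f (eta w) x <= L%:E)%E}.

Let mf1 : measurable_fun setT f1 := bf1.1.

Lemma measurable_difference (g : N -> R) : measurable_fun setT g ->
  measurable_fun setT (fun z : N * X => difference g z.1 z.2).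
Proof.
move=> mg; apply: measurable_funB; first exact: (measurableT_comp mg measurable_add_dirac).
exact: (measurableT_comp mg measurable_fst).
Qed.

Lemma bmf_difference (g : N -> R) : bmf g ->
  bmf (fun z : N * X => difference g z.1 z.2).
Proof. by move=> bg; apply: bmfB; [exact: bmf_add|exact: (bmf_comp measurable_fst bg)]. Qed.

Lemma bmf_pos_part {dT} {T : measurableType dT} (g : T -> R) :
  bmf g -> bmf (fun z => pos_part (g z) ^+ 2).
Proof.
move=> bg; under eq_fun do rewrite expr2.
suff : bmf (fun z => pos_part (g z)) by move=> h; exact: bmfM.
split; first by apply: measurable_maxr => //; exact: bg.1.
have [_ [M bM]] := bg; exists M => z; rewrite /pos_part.
have M0 : 0 <= M by exact: le_trans (bM z).
have [_|_] := leP 0 (g z); last by rewrite normr0.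
exact: bM.
Qed.

Lemma bmf_neg_part {dT} {T : measurableType dT} (g : T -> R) :
  bmf g -> bmf (fun z => neg_part (g z) ^+ 2).
Proof.
move=> bg; under eq_fun do rewrite expr2.
suff : bmf (fun z => neg_part (g z)) by move=> h; exact: bmfM.
split; first by apply: measurable_minr => //; exact: bg.1.
have [_ [M bM]] := bg; exists M => z; rewrite /neg_part.
have M0 : 0 <= M by exact: le_trans (bM z).
have [_|_] := leP 0 (g z); first by rewrite normr0.
exact: bM.
Qed.

Section window.
Variables (W : set X) (mW : measurable W) (Wfin : (mu W < +oo)%E).
Local Notation muW := (mfrestr mW Wfin).

Lemma addition_bound (h : N -> R) : bmf h -> (forall xi, 0 <= h xi) ->
  \int[nu]_xi \int[muW]_x (h xi * neg_part (difference f1 xi x) ^+ 2) <= L * Ex h.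
Proof.
move=> bh h0.
have bg : bmf (fun z : N * X => h z.1 * neg_part (difference f1 z.1 z.2) ^+ 2).
  apply: bmfM; first exact: (bmf_comp measurable_fst bh).
  by apply: bmf_neg_part; exact: bmf_difference.
have bg1 xi : bmf (fun x => h xi * neg_part (difference f1 xi x) ^+ 2).
  exact: (bmf_comp (measurable_pair1 xi) bg).
have bI := bmf_bint1 nu muW bg; rewrite /= in bI.
rewrite -bintZ// -lee_fin !bint_EFin//; last exact: bmfZ.
pose A xi := (\int[mu]_x (neg_part (difference f xi x) ^+ 2)%:E)%E.
have mn2 : measurable_fun setT (fun z : N * X => (neg_part (difference f z.1 z.2) ^+ 2)%:E).
  apply/measurable_EFinP; apply: measurable_funX; apply: measurable_minr => //.
  exact: measurable_difference.
rewrite (ge0_integral_distribution eta (f := fun xi =>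
    (\int[muW]_x (h xi * neg_part (difference f1 xi x) ^+ 2))%:E)); last 2 first.
- by apply/measurable_EFinP; exact: bI.1.
- by move=> xi; rewrite lee_fin; apply: bint_ge0 => x; rewrite mulr_ge0// sqr_ge0.
rewrite (ge0_integral_distribution eta (f := fun xi => (L * h xi)%:E)); last 2 first.
- by apply/measurable_EFinP; exact: (bmfZ L bh).1.
- by move=> xi; rewrite lee_fin mulr_ge0.
apply: ae_ge0_le_integral => //.
- by move=> w _; rewrite lee_fin; apply: bint_ge0 => x; rewrite mulr_ge0// sqr_ge0.
- by apply: measurableT_comp => //; apply/measurable_EFinP; exact: bI.1.
- by move=> w _; rewrite lee_fin mulr_ge0.
- by apply: measurableT_comp => //; apply/measurable_EFinP; exact: (bmfZ L bh).1.
apply: filterS Hadd => w Hw _ /=.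
rewrite bint_EFin// EFinM.
have mn1 : measurable_fun setT (fun x => (neg_part (difference f (eta w) x) ^+ 2)%:E).
  exact: (measurableT_comp mn2 (measurable_pair1 (eta w))).
have n0 x : (0 <= (neg_part (difference f (eta w) x) ^+ 2)%:E)%E by rewrite lee_fin sqr_ge0.
apply: (@le_trans _ _ (\int[muW]_x ((h (eta w))%:E *
    (neg_part (difference f (eta w) x) ^+ 2)%:E))%E).
  apply: ge0_le_integral => //.
  - by move=> x _; rewrite lee_fin mulr_ge0// sqr_ge0.
  - by apply/measurable_EFinP; exact: (bg1 _).1.
  - by apply: emeasurable_funM.
  - by move=> x _; rewrite -EFinM lee_fin ler_wpM2l// (f1f _ _).2.
rewrite ge0_integralZl//; last by rewrite lee_fin.
rewrite [leRHS]muleC; apply: lee_wpmul2l; first by rewrite lee_fin.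
apply: le_trans Hw; rewrite /mfrestr ge0_integral_mrestr//.
exact: ge0_subset_integral.
Qed.

Lemma removal_bint (h : N -> R) : bmf h -> (forall xi, 0 <= h xi) ->
  \int[nu]_xi \int[muW]_x (h (add_dirac xi x) * pos_part (difference f1 xi x) ^+ 2)
  <= L * Ex h.
Proof.
move=> bh h0.
have bg : bmf (fun z : N * X => h (add_dirac z.1 z.2) * pos_part (difference f1 z.1 z.2) ^+ 2).
  apply: bmfM; first exact: bmf_add.
  by apply: bmf_pos_part; exact: bmf_difference.
have bI := bmf_bint1 nu muW bg; rewrite /= in bI.
rewrite -lee_fin EFinM !bint_EFin//.
apply: le_trans (removal_bound Hnu mW Wfin mf mf1 bh.1 h0 L0 (fun a b => (f1f a b).1) Hrem).
rewrite le_eqVlt; apply/orP; left; apply/eqP; apply: eq_integral => xi _.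
by rewrite bint_EFin//; exact: (bmf_comp (measurable_pair1 xi) bg).
Qed.

(** The two halves of [bregman_exp_le] are bounded by the two halves of the
    hypothesis on the increments of [f]. *)
Lemma gain_bound l (Z := fun xi => expR (l * f1 xi)) : 0 <= l ->
  Ex (gain muW Z) <= 3 / 2 * L * l ^+ 2 * Ex Z.
Proof.
move=> l0; have [M bM] := bf1.2.
have mZ : measurable_fun setT Z by apply: measurableT_comp => //; exact: (bmfZ l bf1).1.
have Zab z : expR (- (l * M)) <= Z z <= expR (l * M).
  rewrite !ler_expR; have := bM z; rewrite ler_norml => /andP[h1 h2].
  by rewrite -mulrN !ler_wpM2l.
have bZ : bmf Z by exact: bmf_itv Zab.
have bgn : bmf (fun z : N * X => Z z.1 * neg_part (difference f1 z.1 z.2) ^+ 2).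
  apply: bmfM; first exact: (bmf_comp measurable_fst bZ).
  by apply: bmf_neg_part; exact: bmf_difference.
have bgp : bmf (fun z : N * X => Z (add_dirac z.1 z.2) * pos_part (difference f1 z.1 z.2) ^+ 2).
  apply: bmfM; first exact: bmf_add.
  by apply: bmf_pos_part; exact: bmf_difference.
have bIn := bmf_bint1 nu muW bgn; have bIp := bmf_bint1 nu muW bgp; rewrite /= in bIn bIp.
have Z0 xi : 0 <= Z xi by exact: expR_ge0.
have hn := addition_bound bZ Z0; have hp := removal_bint bZ Z0.
pose c := 3 / 4 * l ^+ 2.
have c0 : 0 <= c by rewrite mulr_ge0// sqr_ge0.
have le1 : Ex (gain muW Z) <=
    c * (\int[nu]_xi \int[muW]_x (Z xi * neg_part (difference f1 xi x) ^+ 2)) +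
    c * (\int[nu]_xi \int[muW]_x (Z (add_dirac xi x) * pos_part (difference f1 xi x) ^+ 2)).
  rewrite -!bintZ// -bintD//; [|exact: bmfZ..].
  apply: bint_le.
  - exact: (bmf_gain muW (expR_gt0 _) mZ Zab).
  - by apply: bmfD; apply: bmfZ.
  move=> xi.
  have b1 := bmf_comp (measurable_pair1 xi) bgn.
  have b2 := bmf_comp (measurable_pair1 xi) bgp; rewrite /= in b1 b2.
  rewrite -!bintZ// -bintD//; [|exact: bmfZ..].
  apply: bint_le.
  - have := bmf_comp (measurable_pair1 xi) (bmf_bregman_add (expR_gt0 _) mZ Zab).
    by [].
  - by apply: bmfD; apply: bmfZ.
  move=> x; rewrite (le_trans (bregman_exp_le _ _))//.
  have -> : l * f1 (add_dirac xi x) - l * f1 xi = l * difference f1 xi x.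
    by rewrite /difference mulrBr.
  have np y : neg_part (l * y) ^+ 2 = l ^+ 2 * neg_part y ^+ 2.
    by rewrite /neg_part -[X in Num.min X _](mulr0 l) -minr_pMr// exprMn.
  have pp y : pos_part (l * y) ^+ 2 = l ^+ 2 * pos_part y ^+ 2.
    by rewrite /pos_part -[X in Num.max X _](mulr0 l) -maxr_pMr// exprMn.
  rewrite np pp /c /Z le_eqVlt; apply/orP; left; apply/eqP; ring.
apply: (le_trans le1); apply: le_trans (lerD (ler_wpM2l c0 hn) (ler_wpM2l c0 hp)) _.
by rewrite /c le_eqVlt; apply/orP; left; apply/eqP; field.
Qed.

End window.

(** [local_entropy] on a window where [Z] is nearly local, with [gain_bound],
    which is uniform in the window. *)
Lemma entropy_inequality l (Z := fun xi => expR (l * f1 xi)) : 0 <= l ->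
  Ex (phi_ent \o Z) <= phi_ent (Ex Z) + 3 / 2 * L * l ^+ 2 * Ex Z.
Proof.
move=> l0; have [M bM] := bf1.2.
have mZ : measurable_fun setT Z by apply: measurableT_comp => //; exact: (bmfZ l bf1).1.
have Zab z : expR (- (l * M)) <= Z z <= expR (l * M).
  rewrite !ler_expR; have := bM z; rewrite ler_norml => /andP[h1 h2].
  by rewrite -mulrN !ler_wpM2l.
have bZ : bmf Z by exact: bmf_itv Zab.
have [W [WT ndW fW]] := (sigma_finiteP _ _).1 (sigma_finiteT mu).
set D := phi_lip (expR (- (l * M))) (expR (l * M)).
have D0 : 0 <= D by rewrite !addr_ge0.
apply/ler_addgt0Pr => e e0.
have D1 : 0 < 2 * D + 1 by lra.
have [j [Z' [bZ' lZ' leZ']]] := local_approximation nu (fun j => (fW j).1) ndW (esym WT) bZ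
  (divr_gt0 e0 D1).
have h1 := local_entropy Hnu (fW j).1 (fW j).2 (expR_gt0 _) mZ Zab bZ' lZ'.
have h2 := gain_bound (fW j).1 (fW j).2 l0.
have I0 : 0 <= Ex (fun xi => `|Z xi - Z' xi|) by apply: bint_ge0.
have h3 : 2 * D * Ex (fun xi => `|Z xi - Z' xi|) <= e.
  move: leZ'; rewrite ler_pdivlMr// mulrC; apply: le_trans.
  by apply: ler_wpM2r => //; rewrite lerDl.
apply: (le_trans h1); apply: lerD h3; exact: lerD.
Qed.

End entropy_inequality.

(** * The Herbst argument *)

Lemma measurable_superlevel {d} {T : measurableType d} {R : realType} (g : T -> R)
  (a s : R) : measurable_fun setT g -> measurable [set x | (s <= g x - a)%R].
Proof.
move=> mg; rewrite -[X in measurable X]setTI.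
have mga : measurable_fun setT (fun x => g x - a)%R by exact: measurable_funB.
have := mga measurableT _ (measurable_itv `[s, +oo[%R).
congr (measurable (_ `&` _)); apply/seteqP.
by split => x; rewrite /preimage /= in_itv/= andbT.
Qed.

Lemma measurable_sublevel {d} {T : measurableType d} {R : realType} (g : T -> R)
  (a s : R) : measurable_fun setT g -> measurable [set x | (g x - a <= s)%R].
Proof.
move=> mg; rewrite -[X in measurable X]setTI.
have mga : measurable_fun setT (fun x => g x - a)%R by exact: measurable_funB.
have := mga measurableT _ (measurable_itv `]-oo, s]%R).
by congr (measurable (_ `&` _)); apply/seteqP; split => x; rewrite /preimage /= in_itv.
Qed.

Section herbst.
Local Open Scope ring_scope.
Context {d} {T : measurableType d} {R : realType}.
Variables (nu : probability T R) (f : T -> R) (C : R).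
Local Notation Ex g := (\int[nu]_x g x).
Hypothesis bf : bmf f.
Hypothesis C0 : 0 <= C.
Local Notation Z l := (fun x => expR (l * f x)).
Hypothesis Hent : forall l, 0 <= l ->
  Ex (fun x => phi_ent (Z l x)) <= phi_ent (Ex (Z l)) + C * l ^+ 2 * Ex (Z l).

Lemma bint_prob_cst c : \int[nu]_x c = c.
Proof.
have e : fine (nu setT) = 1 by rewrite (_ : nu setT = 1%E)//; exact: probability_setT.
by rewrite bint_cst; apply: etrans (congr1 ( *%R c) e) (mulr1 c).
Qed.

Lemma bmf_expR (g : T -> R) : bmf g -> bmf (fun x => expR (g x)).
Proof.
move=> [mg [M bM]]; apply: (@bmf_itv _ _ _ _ 0 (expR M)).
  exact: measurableT_comp.
move=> x; rewrite expR_ge0 ler_expR; exact: le_trans (ler_norm _) (bM x).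
Qed.

Lemma bmf_laplace l : bmf (Z l).
Proof. by apply: bmf_expR; exact: bmfZ. Qed.

Lemma laplace_gt0 l : 0 < Ex (Z l).
Proof.
have [_ [M bM]] := bmfZ l bf.
apply: (@lt_le_trans _ _ (expR (- M))); first exact: expR_gt0.
rewrite -[leLHS]bint_prob_cst; apply: bint_le; [exact: bmf_cst|exact: bmf_laplace|].
by move=> x; rewrite ler_expR; have := bM x; rewrite ler_norml => /andP[].
Qed.

(** The entropy bound controls the mean [c] of [l * f] under the density
    proportional to [Z l]; by convexity the mean of [expR (- l * f / 2)] under
    it is at least [expR (- c / 2)], which bounds [Ex (Z (l / 2))] from
    below. *)
Lemma laplace_half l : 0 <= l ->
  ln (Ex (Z l)) <= 2 * ln (Ex (Z (l / 2))) + C * l ^+ 2.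
Proof.
move=> l0; have Z0 := laplace_gt0 l; have Y0 := laplace_gt0 (l / 2).
have bZl := bmf_laplace l.
have bZf : bmf (fun x => phi_ent (Z l x)).
  rewrite /phi_ent; apply: bmfM => //; under eq_fun do rewrite expRK.
  exact: bmfZ.
pose c := Ex (fun x => phi_ent (Z l x)) / Ex (Z l).
have cK : c <= ln (Ex (Z l)) + C * l ^+ 2.
  rewrite /c ler_pdivrMr// (le_trans (Hent l0))// /phi_ent.
  by rewrite le_eqVlt; apply/orP; left; apply/eqP; ring.
have tang x : expR (- (c / 2)) * ((1 + c / 2) * Z l x - 1 / 2 * phi_ent (Z l x))
    <= Z (l / 2) x.
  rewrite /phi_ent expRK; set y := l * f x.
  have e1 : expR (l / 2 * f x) = expR (- (c / 2)) * expR y * expR (c / 2 - y / 2).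
    by rewrite -!expRD; congr expR; rewrite /y; field.
  rewrite e1 -[leRHS]mulrA; apply: ler_wpM2l; first exact: expR_ge0.
  have := ler_wpM2l (expR_ge0 y) (expR_ge1Dx (c / 2 - y / 2)); lra.
have bl : bmf (fun x => (1 + c / 2) * Z l x) by exact: bmfZ.
have br : bmf (fun x => 1 / 2 * phi_ent (Z l x)) by exact: bmfZ.
have := bint_le nu (bmfZ _ (bmfB bl br)) (bmf_laplace (l / 2)) tang.
rewrite bintZ ?bintB ?bintZ//; last exact: bmfB.
have -> : Ex (fun x => phi_ent (Z l x)) = c * Ex (Z l) by rewrite /c divfK// gt_eqF.
have -> : expR (- (c / 2)) * ((1 + c / 2) * Ex (Z l) - 1 / 2 * (c * Ex (Z l))) =
  expR (- (c / 2)) * Ex (Z l) by field.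
move=> h; have : ln (expR (- (c / 2)) * Ex (Z l)) <= ln (Ex (Z (l / 2))).
  by rewrite ler_ln ?posrE// mulr_gt0// expR_gt0.
rewrite lnM ?posrE ?expR_gt0// expRK; lra.
Qed.

(** Near 0 the exponential is at most [1 + y + 2 y^2]; this replaces the
    derivative at 0 in the iteration of [laplace_half]. *)
Lemma laplace_small (M s : R) : (forall x, `|f x| <= M) -> 0 <= s -> s * M <= 1 / 2 ->
  ln (Ex (Z s)) <= s * Ex f + 2 * (s * M) ^+ 2.
Proof.
move=> bM s0 sM.
have quad (y : R) : y <= 1 / 2 -> expR y <= 1 + y + 2 * y ^+ 2.
  move=> y12; have := expR_ge1Dx (- y); rewrite expRN => h.
  have y1 : 0 < 1 - y by lra.
  have e0 := expR_gt0 y.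
  have h2 : expR y <= (1 - y)^-1.
    by rewrite -[leLHS]invrK lef_pV2 ?posrE ?invr_gt0.
  apply: (le_trans h2); rewrite -[leLHS]mul1r ler_pdivrMr// expr2.
  have : 0 <= y * y * (1 - 2 * y) by apply: mulr_ge0; [rewrite -expr2 sqr_ge0|lra].
  lra.
have pw x : Z s x <= 1 + s * f x + 2 * (s * M) ^+ 2.
  have := bM x; rewrite ler_norml => /andP[h1 h2].
  have a1 := ler_wpM2l s0 h1; have a2 := ler_wpM2l s0 h2.
  have h3 : s * f x <= 1 / 2 by lra.
  rewrite /=; apply: le_trans (quad _ h3) _; rewrite lerD2l ler_wpM2l//.
  have : 0 <= (s * M - s * f x) * (s * M + s * f x) by apply: mulr_ge0; lra.
  rewrite !expr2; lra.
have b1 : bmf (fun x => 1 + s * f x) by apply: bmfD; [exact: bmf_cst|exact: bmfZ].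
have b2 : bmf (fun _ : T => 2 * (s * M) ^+ 2) by exact: bmf_cst.
have := bint_le nu (bmf_laplace s) (bmfD b1 b2) pw.
have c1 : bmf (fun _ : T => 1 : R) by exact: bmf_cst.
have c2 : bmf (fun x => s * f x) by exact: bmfZ.
rewrite (bintD nu b1 b2) (bintD nu c1 c2) bintZ// !bint_prob_cst.
by have := ln_le_sub1 (laplace_gt0 s); lra.
Qed.

Lemma laplace_dyadic l n : 0 <= l ->
  ln (Ex (Z l)) <= 2 ^+ n * ln (Ex (Z (l / 2 ^+ n))) + 2 * C * l ^+ 2 * (1 - 2 ^- n).
Proof.
move=> l0; elim: n => [|n ih].
  by rewrite expr0 mul1r invr1 mulr1 subrr mulr0 addr0.
apply: (le_trans ih).
have p0 : 0 < 2 ^+ n :> R by rewrite exprn_gt0.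
have ln0 : 0 <= l / 2 ^+ n by rewrite divr_ge0// ltW.
have h := ler_wpM2l (ltW p0) (laplace_half ln0).
have e : l / 2 ^+ n / 2 = l / 2 ^+ n.+1 by rewrite exprSr invfM mulrA.
rewrite e in h; apply: le_trans (lerD h (lexx _)) _.
rewrite mulrDr mulrA -exprSr -addrA lerD2l le_eqVlt; apply/orP; left; apply/eqP.
by rewrite [2 ^+ n.+1]exprS; move: p0; set p := 2 ^+ n => p0; field; rewrite gt_eqF.
Qed.

Lemma laplace_le l : 0 <= l ->
  Ex (Z l) <= expR (l * Ex f + 2 * C * l ^+ 2).
Proof.
move=> l0; rewrite -[leLHS]lnK ?posrE ?laplace_gt0// ler_expR.
have [_ [M bM]] := bf.
have M0 : 0 <= M by exact: le_trans (bM point).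
apply/ler_addgt0Pr => e e0.
pose B := l * M + 2 * (l * M) ^+ 2.
have B0 : 0 <= B by rewrite addr_ge0 ?mulr_ge0// sqr_ge0.
(* At this dyadic level laplace_small applies and its error is at most e. *)
have [n nB] : exists n, 2 * B + B / e <= 2 ^+ n.
  have := ltW (truncnS_gt (2 * B + B / e)); set k := Num.truncn _ => h.
  exists k.+1; apply: (le_trans h); rewrite -natrX ler_nat ltnW//.
  exact: ltn_expl.
have p0 : 0 < 2 ^+ n :> R by rewrite exprn_gt0.
have Be : 0 <= B / e by rewrite divr_ge0// ltW.
have sn0 : 0 <= l / 2 ^+ n by rewrite divr_ge0// ltW.
have lM0 : 0 <= l * M by rewrite mulr_ge0.
have sM : l / 2 ^+ n * M <= 1 / 2.
  rewrite mulrAC ler_pdivrMr//.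
  have : l * M <= B by rewrite lerDl mulr_ge0// sqr_ge0.
  lra.
have h1 := laplace_dyadic n l0.
have h2 := ler_wpM2l (ltW p0) (laplace_small bM sn0 sM).
apply: (le_trans h1).
have h3 : 2 * C * l ^+ 2 * (1 - 2 ^- n) <= 2 * C * l ^+ 2.
  rewrite -[leRHS]mulr1; apply: ler_wpM2l; first by rewrite !mulr_ge0 ?sqr_ge0.
  by rewrite gerBl invr_ge0 ltW.
have h4 : 2 ^+ n * (l / 2 ^+ n * Ex f + 2 * (l / 2 ^+ n * M) ^+ 2) =
    l * Ex f + 2 * (l * M) ^+ 2 / 2 ^+ n by field; rewrite gt_eqF.
have h5 : 2 * (l * M) ^+ 2 / 2 ^+ n <= e.
  have hB : B <= 2 ^+ n * e.
    by rewrite -ler_pdivrMr//; apply: le_trans nB; rewrite lerDr mulr_ge0.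
  by rewrite ler_pdivrMr// [e * _]mulrC; apply: le_trans hB; rewrite lerDr.
rewrite h4 in h2; lra.
Qed.

(** The exponential Markov inequality at the optimal parameter [t / (4 * C)]. *)
Lemma chernoff t : 0 < C -> 0 <= t ->
  (nu [set x | (t <= f x - Ex f)%R] <= (expR (- (t ^+ 2 / (8 * C))))%:E)%E.
Proof.
move=> Cp t0; pose l := t / (4 * C).
have l0 : 0 <= l by rewrite divr_ge0// mulr_ge0// ltW.
have mA : measurable [set x | (t <= f x - Ex f)%R].
  by apply: measurable_superlevel; exact: bf.1.
have bA : bmf (\1_[set x | (t <= f x - Ex f)%R] : T -> R) by exact: bmf_indic.
have -> : nu [set x | (t <= f x - Ex f)%R] =
    (Ex (\1_[set x | (t <= f x - Ex f)%R]))%:E.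
  by rewrite bint_EFin// integral_indic// setIT.
rewrite lee_fin.
apply: (@le_trans _ _ (Ex (fun x => expR (- (l * (Ex f + t))) * Z l x))).
  apply: bint_le => //; first by apply: bmfZ; exact: bmf_laplace.
  move=> x; rewrite indicE; case: (boolP (x \in _)) => [/set_mem /= h|_]; last first.
    by rewrite mulr_ge0// expR_ge0.
  rewrite -expRD -[leLHS](expR0 R) ler_expR.
  have : 0 <= l * (f x - Ex f - t) by rewrite mulr_ge0// subr_ge0.
  lra.
rewrite bintZ; last exact: bmf_laplace.
apply: le_trans (ler_wpM2l (expR_ge0 _) (laplace_le l0)) _.
rewrite -expRD ler_expR le_eqVlt; apply/orP; left; apply/eqP.
by rewrite /l; field; rewrite gt_eqF.
Qed.

End herbst.

(** * Truncation and the upper tail *)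

Section truncation.
Local Open Scope ring_scope.
Context {R : realType}.
Implicit Types M a b y : R.

Definition clamp M y : R := Num.max (- M) (Num.min y M).

Lemma clamp_le M a b : a <= b -> clamp M a <= clamp M b.
Proof. by move=> ab; rewrite /clamp; have [?|?] := leP a M; have [?|?] := leP b M; have [?|?] := leP (- M) a;
  have [?|?] := leP (- M) b; have [?|?] := leP (- M) M; lra. Qed.

Lemma clamp_lip M a b : 0 <= M -> a <= b -> clamp M b - clamp M a <= b - a.
Proof. by move=> M0 ab; rewrite /clamp; have [?|?] := leP a M; have [?|?] := leP b M; have [?|?] := leP (- M) a;
  have [?|?] := leP (- M) b; have [?|?] := leP (- M) M; lra. Qed.

Lemma clamp_bound M y : 0 <= M -> `|clamp M y| <= M.
Proof.
move=> M0; rewrite ler_norml /clamp; apply/andP.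
by split; have [?|?] := leP y M; have [?|?] := leP (- M) y; have [?|?] := leP (- M) M; lra.
Qed.

Lemma clamp_norm M y : 0 <= M -> `|clamp M y| <= `|y|.
Proof.
move=> M0; have h1 := ler_norm y; have h2 := ler_norm (- y); rewrite normrN in h2.
have h3 := normr_ge0 y.
rewrite ler_norml /clamp; apply/andP.
by split; have [?|?] := leP y M; have [?|?] := leP (- M) y; have [?|?] := leP (- M) M; lra.
Qed.

Lemma clamp_id M y : `|y| <= M -> clamp M y = y.
Proof.
rewrite ler_norml => /andP[h1 h2]; rewrite /clamp.
by have [?|?] := leP y M; have [?|?] := leP (- M) y; have [?|?] := leP (- M) M; lra.
Qed.

(** Truncation is a nondecreasing contraction, so it keeps the sign of an
    increment and does not enlarge it. *)
Lemma clamp_parts M a b : 0 <= M ->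
  pos_part (clamp M a - clamp M b) ^+ 2 <= pos_part (a - b) ^+ 2 /\
  neg_part (clamp M a - clamp M b) ^+ 2 <= neg_part (a - b) ^+ 2.
Proof.
move=> M0; rewrite /pos_part /neg_part; have [ab|/ltW ba] := leP a b.
  have h1 := clamp_le M ab; have h2 := clamp_lip M0 ab.
  rewrite !max_l ?min_r ?subr_le0//; split => //.
  by rewrite -sqrrN -[leRHS]sqrrN !opprB lerXn2r// nnegrE subr_ge0.
have h1 := clamp_le M ba; have h2 := clamp_lip M0 ba.
rewrite !max_r ?min_l ?subr_ge0//; split => //.
by rewrite lerXn2r// nnegrE subr_ge0.
Qed.

Lemma measurable_clamp {d} {T : measurableType d} M (f : T -> R) :
  measurable_fun setT f -> measurable_fun setT (fun x => clamp M (f x)).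
Proof. by move=> mf; apply: measurable_maxr => //; exact: measurable_minr. Qed.

End truncation.

Section tail.
Local Open Scope ring_scope.
Context {d} {X : measurableType d} {R : realType}.
Local Notation N := (counting_measure X R).
Context {dO} {Omega : measurableType dO} (P : probability Omega R).
Variables (mu : {sigma_finite_measure set X -> \bar R}) (eta : {mfun Omega >-> N}).
Local Notation nu := (distribution P eta).
Hypothesis Hnu : poisson_counts mu nu.
Variables (f : N -> R) (L : R).
Hypotheses (mf : measurable_fun setT f) (L0 : 0 < L).
Hypothesis fint : P.-integrable setT (fun w => (f (eta w))%:E).
Hypothesis HV : {ae P, forall w, (Vplus mu f (eta w) <= L%:E)%E}.
Local Notation E := (fine (\int[P]_w (f (eta w))%:E)%E).

Let Hadd : {ae P, forall w,
  (\int[mu]_x (neg_part (difference f (eta w) x) ^+ 2)%:E <= L%:E)%E}.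
Proof.
apply: filterS HV => w; apply: le_trans; rewrite leeDl//.
by apply: integral_ge0 => x _; exact: removal_sq_ge0.
Qed.

Let Hrem : {ae P, forall w,
  (\int[eta w]_x removal_sq pos_part f (eta w) x <= L%:E)%E}.
Proof.
apply: filterS HV => w; apply: le_trans; rewrite leeDr//.
by apply: integral_ge0 => x _; rewrite lee_fin sqr_ge0.
Qed.

Lemma cvg_clamp_mean :
  (fun n => \int[nu]_xi clamp n%:R (f xi)) @ \oo --> E.
Proof.
have mfe : measurable_fun setT (fun w => f (eta w)) by exact: measurableT_comp.
have bc n : bmf (fun xi => clamp n%:R (f xi)).
  by split; [exact: measurable_clamp|exists n%:R => xi; exact: clamp_bound].
pose g n w := (clamp n%:R (f (eta w)))%:E.
have e n : \int[nu]_xi clamp n%:R (f xi) = fine (\int[P]_w g n w)%E.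
  rewrite /Rintegral (integral_distribution (f := fun xi => (clamp n%:R (f xi))%:E))//.
    by apply/measurable_EFinP; exact: (bc n).1.
  by apply: (bmf_integrable P); exact: (bmf_comp _ (bc n)).
under eq_fun do rewrite e.
have mg n : measurable_fun setT (g n).
  by apply/measurable_EFinP; exact: measurable_clamp.
have cg : {ae P, forall w, setT w -> g ^~ w @ \oo --> (f (eta w))%:E}.
  apply: aeW => w _; apply: cvg_EFin; first exact: nearW.
  apply: cvg_near_cst; near=> n; rewrite /g /= clamp_id//.
  near: n; exact: nbhs_infty_ger.
have dg : {ae P, forall w n, setT w -> (`|g n w| <= `|(f (eta w))%:E|)%E}.
  by apply: aeW => w n _; rewrite lee_fin clamp_norm.
have [_ _ key] := dominated_convergence measurableT mg
  ((measurable_EFinP _ _).2 mfe) cg (integrable_abse fint) dg.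
apply: fine_cvg; rewrite fineK; first exact: key.
exact: integrable_fin_num.
Unshelve. all: by end_near. Qed.

Lemma clamp_tail n t : 0 <= t ->
  (nu [set xi | (t <= clamp n%:R (f xi) - \int[nu]_xi clamp n%:R (f xi))%R]
   <= (expR (- (t ^+ 2 / (12 * L))))%:E)%E.
Proof.
move=> t0; have bc : bmf (fun xi => clamp n%:R (f xi)).
  by split; [exact: measurable_clamp|exists n%:R => xi; exact: clamp_bound].
have C0 : 0 < 3 / 2 * L by rewrite mulr_gt0// divr_gt0.
have -> : 12 * L = 8 * (3 / 2 * L) by field.
apply: chernoff => //; first exact: ltW.
move=> l l0; apply: (entropy_inequality Hnu mf bc (ltW L0) _ Hadd Hrem l0).
by move=> a b; exact: clamp_parts.
Qed.

(** [clamp_tail] for a truncation whose mean is within [e] of the true one, as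
    [e] tends to 0. *)
Lemma upper_tail t : 0 <= t ->
  (P [set w | (t <= f (eta w) - E)%R] <= (expR (- (t ^+ 2 / (12 * L))))%:E)%E.
Proof.
move=> t0'; have mfe : measurable_fun setT (fun w => f (eta w)) by exact: measurableT_comp.
have mT : measurable [set w | (t <= f (eta w) - E)%R] by exact: measurable_superlevel.
move: t0'; rewrite le_eqVlt => /predU1P[t0|t0].
  by rewrite -t0 expr0n /= mul0r oppr0 expR0 probability_le1// t0.
have shrink e : 0 < e -> e <= t ->
  (P [set w | (t <= f (eta w) - E)%R] <= (expR (- ((t - e) ^+ 2 / (12 * L))))%:E)%E.
  move=> e0 et.
  have [n [nE nt]] : exists n : nat,
      \int[nu]_xi clamp n%:R (f xi) <= E + e /\ `|E + t| <= n%:R.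
    have h1 := (cvgrPdist_le _ _).1 cvg_clamp_mean e e0.
    have : \forall n \near \oo, \int[nu]_xi clamp n%:R (f xi) <= E + e /\
        `|E + t| <= n%:R.
      near=> n; split; last by near: n; exact: nbhs_infty_ger.
      have : `|E - \int[nu]_xi clamp n%:R (f xi)| <= e by near: n; exact: h1.
      by rewrite ler_norml => /andP[h2 h3]; lra.
    by move=> [n _ /(_ n (leqnn n))] H; exists n.
  apply: le_trans (clamp_tail n _); last by rewrite subr_ge0.
  rewrite /distribution /pushforward.
  apply: le_measure; rewrite ?inE//.
    by apply: measurable_superlevel; exact: measurable_clamp.
  move=> w /= h; have /(clamp_le n%:R) : E + t <= f (eta w) by lra.
  by rewrite (clamp_id nt); lra.
have -> : P [set w | (t <= f (eta w) - E)%R] =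
    (fine (P [set w | (t <= f (eta w) - E)%R]))%:E.
  by rewrite fineK// fin_num_measure.
rewrite lee_fin.
have cv : (fun n => expR (- ((t - t * harmonic n) ^+ 2 / (12 * L)))) @ \oo -->
    expR (- ((t - t * 0) ^+ 2 / (12 * L))).
  apply: continuous_cvg; first exact: continuous_expR.
  apply: cvgN; apply: cvgMl; rewrite !expr2.
  have c1 : (fun n => t - t * harmonic n) @ \oo --> t - t * 0.
    by apply: cvgB; [exact: cvg_cst|apply: cvgMr; exact: cvg_harmonic].
  exact: cvgM.
rewrite mulr0 subr0 in cv; apply: ler_cvg_to (cvg_cst _) cv _; apply: nearW => n.
rewrite -lee_fin fineK ?fin_num_measure//; apply: shrink.
  by rewrite mulr_gt0// /harmonic invr_gt0.
rewrite -[leRHS]mulr1; apply: ler_wpM2l; first exact: ltW.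
by rewrite /harmonic /= invf_le1 ?ler1n// ltr0n.
Unshelve. all: by end_near. Qed.

End tail.

(** * The concentration inequalities *)

Section constants.
Local Open Scope ring_scope.
Context {R : realType}.

(** [2 <= (1 + 3/32)^8 <= expR (3/4)]. *)
Lemma ln2_le : ln 2 <= 3 / 4 :> R.
Proof.
rewrite -ler_expR lnK ?posrE//.
have -> : 3 / 4 = 8%:R * (3 / 32) :> R by field.
rewrite expRM_natl.
have h : (1 + 3 / 32) ^+ 8 <= expR (3 / 32) ^+ 8 :> R.
  by apply: lerXn2r; rewrite ?nnegrE ?expR_ge0 ?expR_ge1Dx//; lra.
by apply: le_trans h; rewrite !exprS expr0; lra.
Qed.

Lemma sqrt_expR1 : Num.sqrt (expR 1) = expR (1 / 2) :> R.
Proof.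
have -> : expR 1 = expR (1 / 2) ^+ 2 :> R by rewrite -expRM_natl; congr expR; field.
by rewrite sqrtr_sqr ger0_norm ?expR_ge0.
Qed.

(** [expR (1 / 4) <= 4 / 3], inverting [expR (- 1 / 4) >= 3 / 4]. *)
Lemma sqrt_expR1_le : Num.sqrt (expR 1) <= 16 / 9 :> R.
Proof.
rewrite sqrt_expR1 (_ : 1 / 2 = 2%:R * (1 / 4)); last by field.
rewrite expRM_natl (_ : 16 / 9 = (4 / 3) ^+ 2); last by field.
apply: lerXn2r; rewrite ?nnegrE ?expR_ge0//.
rewrite -[leLHS]invrK -expRN (_ : 4 / 3 = (3 / 4)^-1); last by field.
rewrite lef_pV2 ?posrE ?expR_gt0//.
by have := expR_ge1Dx (- (1 / 4) : R); lra.
Qed.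

(** The quotient multiplied by [m] is at least [8 / 7], being nonincreasing in
    the square root, and [ln 2 <= 3 / 4]. *)
Lemma tail_rate_le (m : R) : 8 <= m ->
  ln 2 / (m * (Num.sqrt (expR 1) / (2 * (Num.sqrt (expR 1) - 1)))) <= 12^-1.
Proof.
move=> m8; have l1 := ln2_le; have s2 := sqrt_expR1_le.
have s1 : 1 < Num.sqrt (expR 1) :> R.
  by rewrite sqrt_expR1 -[ltLHS](expR0 R) ltr_expR divr_gt0.
move: s1 s2; set s := Num.sqrt _ => s1 s2.
have k : 8 / 7 <= s / (2 * (s - 1)) by rewrite ler_pdivlMr; lra.
have mk : 8 * (8 / 7) <= m * (s / (2 * (s - 1))) by apply: ler_pM => //; lra.
rewrite ler_pdivrMr; lra.
Qed.

Lemma expR_rate_le c t L : 0 < L -> c <= 12^-1 ->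
  expR (- (t ^+ 2 / (12 * L))) <= expR (- (c * t ^+ 2 / L)) :> R.
Proof.
move=> L0 c12; rewrite ler_expR lerN2 -mulrA.
have -> : t ^+ 2 / (12 * L) = 12^-1 * (t ^+ 2 / L) by field; rewrite gt_eqF.
apply: ler_wpM2r => //.
by rewrite divr_ge0 ?sqr_ge0// ltW.
Qed.

End constants.

Section functional.
Local Open Scope ring_scope.
Context {d} {X : measurableType d} {R : realType}.
Local Notation N := (counting_measure X R).
Variable mu : {sigma_finite_measure set X -> \bar R}.

Lemma pos_partN (y : R) : pos_part (- y) = - neg_part y.
Proof. by rewrite /pos_part /neg_part oppr_min oppr0. Qed.

Lemma neg_partN (y : R) : neg_part (- y) = - pos_part y.
Proof. by rewrite /pos_part /neg_part oppr_max oppr0. Qed.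

Lemma Vminus_opp (f : N -> R) xi : Vminus mu f xi = Vplus mu (fun xi => - f xi) xi.
Proof.
rewrite /Vminus /Vplus; congr (_ + _)%E; apply: eq_integral => x _.
  by rewrite /difference -opprD neg_partN sqrrN.
rewrite /removal_sq; case: remove_dirac => [zeta|//].
by rewrite -opprD pos_partN sqrrN.
Qed.

Lemma part_sq_le (y : R) : pos_part y ^+ 2 <= y ^+ 2 /\ neg_part y ^+ 2 <= y ^+ 2.
Proof.
rewrite /pos_part /neg_part.
have [_|_] := leP 0 y; split; rewrite ?expr0n/= ?lexx ?sqr_ge0//.
Qed.

Lemma Vplus_le (f : N -> R) xi : (Vplus mu f xi <= Vtotal mu f xi)%E.
Proof.
apply: leeD; apply: integral_le_nonmeasurable => [x|x].
- by rewrite lee_fin sqr_ge0.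
- by rewrite lee_fin (part_sq_le _).2.
- exact: removal_sq_ge0.
- rewrite /removal_sq; case: remove_dirac => [zeta|//].
  by rewrite lee_fin (part_sq_le _).1.
Qed.

Lemma Vminus_le (f : N -> R) xi : (Vminus mu f xi <= Vtotal mu f xi)%E.
Proof.
apply: leeD; apply: integral_le_nonmeasurable => [x|x].
- by rewrite lee_fin sqr_ge0.
- by rewrite lee_fin (part_sq_le _).1.
- exact: removal_sq_ge0.
- rewrite /removal_sq; case: remove_dirac => [zeta|//].
  by rewrite lee_fin (part_sq_le _).2.
Qed.

End functional.

Section functional_tail.
Local Open Scope ring_scope.
Context {d} {X : measurableType d} {R : realType}.
Local Notation N := (counting_measure X R).
Context {dO} {Omega : measurableType dO} (P : probability Omega R).
Variables (mu : {sigma_finite_measure set X -> \bar R}) (eta : Omega -> N).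
Hypothesis Heta : poisson_process P mu eta.
Variables (F : Omega -> R) (f : N -> R).
Hypotheses (HF : F \in Lfun P 1%E) (Hf : representative P eta F f).
Local Notation EF := (fine 'E_P[F]%E).

(** [upper_tail] concerns [f] evaluated at the process, from which [F] differs
    on a null set only. *)
Lemma poisson_functional_tail L t : 0 < L ->
  {ae P, forall w, (Vplus mu f (eta w) <= L%:E)%E} -> 0 <= t ->
  (P [set w | (t <= F w - EF)%R] <= (expR (- (t ^+ 2 / (12 * L))))%:E)%E.
Proof.
move=> L0 HV t0.
have meta : measurable_fun setT eta by case: Heta.
pose eta' : {mfun Omega >-> N} := HB.pack eta (isMeasurableFun.Build _ _ _ _ eta meta).
have Hnu := poisson_process_counts (eta := eta') Heta.
have [mf ae] := Hf.
have /Lfun1_integrable Fint := HF.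
have mF : measurable_fun setT F by apply/measurable_EFinP; case/integrableP: Fint.
have mfe : measurable_fun setT (fun w => f (eta w)) by exact: measurableT_comp.
have aeE : ae_eq P setT (EFin \o F) (fun w => (f (eta w))%:E).
  by apply: filterS ae => w /= -> _.
have fint : P.-integrable setT (fun w => (f (eta' w))%:E).
  apply/integrableP; split; first exact/measurable_EFinP.
  move/integrableP : Fint => [_]; congr (_ < _)%E; apply: ae_eq_integral => //.
  - by apply: measurableT_comp => //; exact/measurable_EFinP.
  - by apply: measurableT_comp => //; exact/measurable_EFinP.
  - by apply: filterS ae => w /= -> _.
have eE : fine 'E_P[F]%E = fine (\int[P]_w (f (eta' w))%:E)%E.
  by rewrite unlock; congr fine; apply: ae_eq_integral => //; exact/measurable_EFinP.
rewrite eE; apply: le_trans (upper_tail Hnu mf L0 fint HV t0).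
set m := fine _; case: ae => B [mB PB0 subB].
apply: (@le_trans _ _ (P ([set w | (t <= f (eta w) - m)%R] `|` B))).
  apply: le_measure; rewrite ?inE; [exact: measurable_superlevel|by apply: measurableU => //; exact: measurable_superlevel|].
  move=> w /= h; have [Bw|nBw] := pselect (B w); [by right|left].
  by rewrite -(_ : F w = f (eta w))//; apply: contrapT => /subB.
apply: le_trans (measureU2 _ _ _) _ => //; first exact: measurable_superlevel.
by move: PB0 => /= ->; rewrite adde0.
Qed.

End functional_tail.

Section functional_lower_tail.
Local Open Scope ring_scope.
Context {d} {X : measurableType d} {R : realType}.
Local Notation N := (counting_measure X R).
Context {dO} {Omega : measurableType dO} (P : probability Omega R).
Variables (mu : {sigma_finite_measure set X -> \bar R}) (eta : Omega -> N).
Hypothesis Heta : poisson_process P mu eta.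
Variables (F : Omega -> R) (f : N -> R).
Hypotheses (HF : F \in Lfun P 1%E) (Hf : representative P eta F f).
Local Notation EF := (fine 'E_P[F]%E).

(** The upper tail of [- F]. *)
Lemma poisson_functional_lower_tail L t : 0 < L ->
  {ae P, forall w, (Vminus mu f (eta w) <= L%:E)%E} -> 0 <= t ->
  (P [set w | (F w - EF <= - t)%R] <= (expR (- (t ^+ 2 / (12 * L))))%:E)%E.
Proof.
move=> L0 HV t0.
have /Lfun1_integrable Fint := HF.
have HNF : (fun w => - F w) \in Lfun P 1%E.
  by apply/Lfun1_integrable; exact: (integrableN Fint).
have HNf : representative P eta (fun w => - F w) (fun xi => - f xi).
  split; first by apply: measurable_funN; exact: Hf.1.
  by apply: filterS Hf.2 => w ->.
have HNV : {ae P, forall w, (Vplus mu (fun xi => (- f xi)%R) (eta w) <= L%:E)%E}.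
  have e w := Vminus_opp mu f (eta w).
  by apply: filterS HV => w; rewrite e.
have := poisson_functional_tail Heta HNF HNf L0 HNV t0.
have -> : fine 'E_P[fun w => (- F w)%R]%E = - EF.
  rewrite unlock -fineN -integralN//; exact: integrable_add_def.
congr (P _ <= _)%E; apply/seteqP; split=> w /=; lra.
Qed.

End functional_lower_tail.

Local Open Scope ring_scope.
Theorem corollary4p3 (R : realType) (dO : measure_display)
    (Omega : measurableType dO) (P : probability Omega R)
    (d : measure_display) (X : measurableType d)
    (mu : {sigma_finite_measure set X -> \bar R})
    (eta : Omega -> counting_measure X R)
    (Heta : poisson_process P mu eta)
    (F : Omega -> R) (HF : F \in Lfun P 1%E)
    (f : counting_measure X R -> R) (Hf : representative P eta F f) :
  let EF : R := fine 'E_P[F]%E in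
  let kappa : R :=
    Num.sqrt (expR 1) / (2%:R * (Num.sqrt (expR 1) - 1)) in
  [/\ forall L : R, 0 < L ->
        {ae P, forall w, (Vplus mu f (eta w) <= L%:E)%E} ->
        forall t : R, 4%:R * Num.sqrt kappa <= t ->
        let c := ln 2%:R / (8%:R * kappa) in
        (P [set w | (F w - EF >= t)%R] <= (expR (- (c * t ^+ 2 / L)))%:E)%E,
      forall L : R, 0 < L ->
        {ae P, forall w, (Vminus mu f (eta w) <= L%:E)%E} ->
        forall t : R, 4%:R * Num.sqrt kappa <= t ->
        let c := ln 2%:R / (8%:R * kappa) in
        (P [set w | (F w - EF <= - t)%R] <= (expR (- (c * t ^+ 2 / L)))%:E)%E &
      forall L : R, 0 < L ->
        {ae P, forall w, (Vtotal mu f (eta w) <= L%:E)%E} ->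
        forall t : R, 0 <= t ->
        let c := ln 2%:R / (16%:R * kappa) in
        (P [set w | (`|F w - EF| >= t)%R]
          <= (2%:R * expR (- (c * t ^+ 2 / L)))%:E)%E ].
Proof.
move=> EF kappa.
have upper L t : 0 < L -> {ae P, forall w, (Vplus mu f (eta w) <= L%:E)%E} -> 0 <= t ->
    (P [set w | (F w - EF >= t)%R] <= (expR (- (t ^+ 2 / (12 * L))))%:E)%E.
  exact: (poisson_functional_tail Heta HF Hf).
have lower L t : 0 < L -> {ae P, forall w, (Vminus mu f (eta w) <= L%:E)%E} -> 0 <= t ->
    (P [set w | (F w - EF <= - t)%R] <= (expR (- (t ^+ 2 / (12 * L))))%:E)%E.
  exact: (poisson_functional_lower_tail Heta HF Hf).
have rate m L t : 8 <= m -> 0 < L ->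
    expR (- (t ^+ 2 / (12 * L))) <= expR (- (ln 2 / (m * kappa) * t ^+ 2 / L)) :> R.
  by move=> m8 L0; apply: expR_rate_le => //; exact: tail_rate_le.
have t0 t : 4%:R * Num.sqrt kappa <= t -> 0 <= t.
  by apply: le_trans; rewrite mulr_ge0// sqrtr_ge0.
split=> L L0 HV t /= ht.
- apply: le_trans (upper L t L0 HV (t0 t ht)) _; rewrite lee_fin; exact: rate.
- apply: le_trans (lower L t L0 HV (t0 t ht)) _; rewrite lee_fin; exact: rate.
have Hp : {ae P, forall w, (Vplus mu f (eta w) <= L%:E)%E}.
  by apply: filterS HV => w; apply: le_trans; exact: Vplus_le.
have Hm : {ae P, forall w, (Vminus mu f (eta w) <= L%:E)%E}.
  by apply: filterS HV => w; apply: le_trans; exact: Vminus_le.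
have /Lfun1_integrable/integrableP[/measurable_EFinP mF _] := HF.
have mA : measurable [set w | t <= F w - EF].
  exact: measurable_superlevel.
have mB : measurable [set w | F w - EF <= - t].
  exact: measurable_sublevel.
have -> : [set w | `|F w - EF| >= t] =
    [set w | t <= F w - EF] `|` [set w | F w - EF <= - t].
  apply/seteqP; split=> w /=; rewrite ler_normr lerNr.
    by case/orP; [left|right].
  by case=> ->; rewrite ?orbT.
have r : expR (- (t ^+ 2 / (12 * L))) <= expR (- (ln 2 / (16 * kappa) * t ^+ 2 / L)) :> R.
  by apply: rate => //; rewrite ler_nat.
apply: le_trans (measureU2 _ mA mB) _.
apply: le_trans (leeD (upper L t L0 Hp ht) (lower L t L0 Hm ht)) _.
by rewrite -EFinD lee_fin; lra.
Qed.
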